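(* Let $f$ be a function satisfying the standing assumptions given in the context, with modulator $p_f$. (i) If $p_f$ is even, then for all $s\in\mathbb{C}\setminus\{0\}$, $$L(1-s,f)=2(2\pi)^{-s}\Gamma(s)\cos\left(\frac{\pi s}{2}\right)F(s,f_{(2i\pi)}),$$ and equivalently $$L(1-s,f)=\frac{(2\pi)^{-s}}{2i\sin\left(\frac{\pi s}{2}\right)}\int_{\mu_{f_{(2i\pi)}}}\frac{z^{(s-1,f_{(2i\pi)})}}{e^{-z}-1}\,dz.$$ (ii) If $p_f$ is odd, then for all $s\in\mathbb{C}$, $$L(1-s,f)=2i(2\pi)^{-s}\Gamma(s)\sin\left(\frac{\pi s}{2}\right)F(s,f_{(2i\pi)}),$$ and equivalently $$L(1-s,f)=\frac{(2\pi)^{-s}}{2\cos\left(\frac{\pi s}{2}\right)}\int_{\mu_{f_{(2i\pi)}}}\frac{z^{(s-1,f_{(2i\pi)})}}{e^{-z}-1}\,dz.$$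
   Context: Standing assumptions and notation. $f$ is a real-analytic function at $0$, $f(t)=\sum_{n\ge 0}\frac{C_{f,n}}{n!}t^n$. Its modulator is $p_f(t):=\frac{e^t-1}{t}f(t)=\sum_{n\ge 0}\frac{P_{f,n}}{n!}t^n$, which defines the numbers $P_{f,n}$. It is assumed that the power series $\sum_{n\ge0}P_{f,n}t^n$ has a non-zero (possibly infinite) radius of convergence $\rho_f$; consequently $p_f$ extends to an entire function. Put $r_f:=1/\rho_f$ (with $r_f=0$ if $\rho_f=\infty$), $n_f:=\lfloor r_f\rfloor+1$, and $\Omega_f:=\{z\in\mathbb{C} : z\notin\mathbb{R}_{\le 0},\ |z|>r_f\}$. Generalized power: for $s\in\mathbb{C}$ and $z\in\Omega_f$, $z^{(s,f)}:=\sum_{k=0}^{\infty}\binom{s}{k}P_{f,k}z^{s-k}$, where complex powers $z^{a}=e^{a\log z}$ use the principal logarithm. LC-function: for $\Re(s)>1$, $L(s,f):=\sum_{n=n_f}^{\infty}n^{(-s,f)}$. The same symbol denotes its meromorphic continuation to $\mathbb{C}$, which is known to be entire if $p_f(0)=0$ and otherwise to have only a simple pole, at $s=1$, with residue $p_f(0)$. For $\alpha\in\mathbb{C}\setminus\{0\}$, $f_{(\alpha)}(t):=\frac{e^{\alpha t}-1}{\alpha(e^t-1)}f(\alpha t)$. One has $p_{f_{(\alpha)}}(t)=p_f(\alpha t)$, hence $P_{f_{(\alpha)},n}=\alpha^nP_{f,n}$ and $r_{f_{(\alpha)}}=|\alpha|r_f$; all the definitions above and below apply to $f_{(\alpha)}$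 in place of $f$ (its coefficients may be complex). FC-function: $F(s,f):=\frac{\Gamma(1-s)}{2i\pi}\int_{\mu_f}\frac{z^{(s-1,f)}}{e^{-z}-1}\,dz$, where $\mu_f$ is a Hankel contour contained in $\Omega_f$: it comes from $-\infty$ below the negative real axis, goes once counterclockwise around the closed disk $|z|\le r_f$ (around the origin if $r_f=0$), and returns to $-\infty$ above the negative real axis, without encircling any of the singularities $2i\pi k$ ($k\in\mathbb{Z}$, $2\pi|k|>r_f$) of $1/(e^{-z}-1)$ lying in $\Omega_f$. The integral is an entire function of $s$, so $F(s,f)$ is analytic for $s\neq1,2,3,\dots$. Convention: the right-hand sides may have isolated singularities at integers $s$ in the stated ranges; these are removable and the right-hand sides are understood there by analytic continuation. *)

(* Defs.v *)
(* Classical reals of the standard library, with Coquelicot for complex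
   numbers, series, derivatives and integrals. *)
From Stdlib Require Import Reals Factorial.
From Coquelicot Require Export Coquelicot.

Open Scope R_scope.

(* ---------- Complex elementary functions ---------- *)

Definition Cexp (z : C) : C :=
  (exp (Re z) * cos (Im z), exp (Re z) * sin (Im z)).

Definition Ccos (z : C) : C := ((Cexp (Ci * z) + Cexp (- (Ci * z))) / 2)%C.
Definition Csin (z : C) : C := ((Cexp (Ci * z) - Cexp (- (Ci * z))) / (2 * Ci))%C.

(* Principal argument, with values in (-PI, PI]; meaningless at 0. *)
Definition Carg (z : C) : R :=
  if Rle_dec 0 (Im z) then acos (Re z / Cmod z) else - acos (Re z / Cmod z).

Definition Clog (z : C) : C := (ln (Cmod z), Carg z).

(* z ^ a = exp (a log z); Coquelicot's Cpow is the power with exponent in nat. *)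
Definition Cpower (z a : C) : C := Cexp (a * Clog z)%C.

(* Sum of a convergent complex series and limit of a convergent complex
   sequence; as for Series and Lim_seq, the value is meaningless otherwise. *)
Definition CSeries (a : nat -> C) : C :=
  (Series (fun n => Re (a n)), Series (fun n => Im (a n))).

Definition CLim_seq (u : nat -> C) : C :=
  (real (Lim_seq (fun n => Re (u n))), real (Lim_seq (fun n => Im (u n)))).

Fixpoint Cprod (u : nat -> C) (n : nat) : C :=
  match n with
  | O => 1%C
  | S m => (Cprod u m * u m)%C
  end.

Definition Cbinom (s : C) (k : nat) : C :=
  (Cprod (fun j => s - INR j) k / INR (fact k))%C.

(* Euler's (Gauss's) limit n! n^s / (s (s+1) ... (s+n)), which defines Gamma on
   the whole of C outside the poles 0, -1, -2, ... *)
Definition CGamma (s : C) : C :=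
  CLim_seq (fun n =>
    INR (fact n) * Cpower (INR n) s / Cprod (fun j => s + INR j) (S n))%C.

(* ---------- Analytic functions at 0 and their modulators ---------- *)

(* The derivatives at 0, i.e. the numbers C_{f,n}. *)
Definition taylor0 (f : R -> C) (n : nat) : C :=
  (Derive_n (fun t => Re (f t)) n 0, Derive_n (fun t => Im (f t)) n 0).

(* Near 0, f(t) is the sum of its Taylor series. The values are complex so that
   the class of functions contains f_(alpha) together with f. *)
Definition real_analytic0 (f : R -> C) : Prop :=
  locally 0 (fun t : R =>
    is_series (fun n => taylor0 f n / INR (fact n) * RtoC t ^ n)%C (f t)).

(* The sum of the Taylor series at 0 of f, at a complex argument. *)
Definition taylor_ext (f : R -> C) (z : C) : C :=
  CSeries (fun n => taylor0 f n / INR (fact n) * z ^ n)%C.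

(* The quotient (e^t - 1) / t is 1 at t = 0. *)
Definition modulator (f : R -> C) (t : R) : C :=
  if Req_EM_T t 0 then f 0 else (RtoC ((exp t - 1) / t) * f t)%C.

Definition P_coef (f : R -> C) : nat -> C := taylor0 (modulator f).

(* The entire extension of the modulator. *)
Definition modulator_ext (f : R -> C) : C -> C := taylor_ext (modulator f).

Definition modulator_even (f : R -> C) : Prop :=
  forall z : C, modulator_ext f (- z)%C = modulator_ext f z.
Definition modulator_odd (f : R -> C) : Prop :=
  forall z : C, modulator_ext f (- z)%C = (- modulator_ext f z)%C.

(* Radius of convergence of the power series with coefficients P_{f,n}: it only
   depends on their moduli. *)
Definition rho (f : R -> C) : Rbar := CV_radius (fun n => Cmod (P_coef f n)).

Definition r_ (f : R -> C) : R :=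
  match rho f with
  | Finite x => / x
  | _ => 0
  end.

Definition n_ (f : R -> C) : nat := Z.to_nat (Int_part (r_ f) + 1).

(* f_(alpha); the quotient (e^(alpha t) - 1) / (alpha (e^t - 1)) is 1 at t = 0,
   and f (alpha t) is given by the power series of f. *)
Definition dilate (alpha : C) (f : R -> C) (t : R) : C :=
  if Req_EM_T t 0 then f 0
  else ((Cexp (alpha * t) - 1) / (alpha * (exp t - 1)%R)
        * taylor_ext f (alpha * t))%C.

(* ---------- LC-function ---------- *)

(* gpow f z s is z^(s,f). *)
Definition gpow (f : R -> C) (z s : C) : C :=
  CSeries (fun k => Cbinom s k * P_coef f k * Cpower z (s - INR k))%C.

(* L is the meromorphic continuation of s |-> sum_{n >= n_f} n^(-s,f): entire
   if p_f(0) = 0, and otherwise with a single pole, at 1, which is simple and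
   has residue p_f(0). The value L 1 is irrelevant when p_f(0) <> 0. *)
Definition is_LC_function (f : R -> C) (L : C -> C) : Prop :=
  (forall s : C, 1 < Re s ->
     L s = CSeries (fun n => gpow f (INR (n_ f + n)) (- s)%C)) /\
  (forall s : C, s <> RtoC 1 -> ex_derive L s) /\
  (modulator_ext f 0 = RtoC 0 -> ex_derive L (RtoC 1)) /\
  filterlim (fun s : C => ((s - 1) * L s)%C)
    (locally' (RtoC 1)) (locally (modulator_ext f 0)).

(* ---------- Hankel contours and FC-function ---------- *)

(* The contour with parameters c and th consists of the horizontal half-line
   from -infinity to c e^(-i th), the counterclockwise arc c e^(i phi),
   -th <= phi <= th, and the horizontal half-line from c e^(i th) back to
   -infinity. *)
Definition hankel_int (c th : R) (g : C -> C) : C :=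
  (RInt_gen (V := C_R_CompleteNormedModule)
     (fun x : R => g (x, - (c * sin th))%R)
     (Rbar_locally m_infty) (at_point (c * cos th)%R)
   + RInt (V := C_R_CompleteNormedModule)
     (fun phi : R => g (c * Cexp (Ci * phi)) * (Ci * (c * Cexp (Ci * phi))))
     (- th)%R th
   + RInt_gen (V := C_R_CompleteNormedModule)
     (fun x : R => g (x, c * sin th)%R)
     (at_point (c * cos th)%R) (Rbar_locally m_infty))%C.

(* With PI/2 < th < PI the half-lines lie outside the disk |z| < c, one on each
   side of the negative real axis, so the contour lies in Omega_f as soon as
   r_f < c; the last condition keeps the singularities 2 i PI k of
   1 / (e^(-z) - 1) that belong to Omega_f on the outer side of the contour. *)
Definition hankel_contour (f : R -> C) (c th : R) : Prop :=
  r_ f < c /\ PI / 2 < th < PI /\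
  (forall k : Z, r_ f < 2 * PI * Rabs (IZR k) -> c < 2 * PI * Rabs (IZR k)).

(* The integral over mu_f of z^(s-1,f) / (e^(-z) - 1). *)
Definition FC_int (f : R -> C) (c th : R) (s : C) : C :=
  hankel_int c th (fun z => gpow f z (s - 1) / (Cexp (- z) - 1))%C.

Definition FC (f : R -> C) (c th : R) (s : C) : C :=
  (CGamma (1 - s) / (2 * Ci * PI) * FC_int f c th s)%C.

(* ---------- Equality up to removable singularities ---------- *)

Definition C_integer (s : C) : Prop := exists k : Z, s = RtoC (IZR k).

(* v is the value at s of g, where g is given by a formula valid outside the
   isolated points satisfying sing, and is extended by continuity there. *)
Definition continued_value (sing : C -> Prop) (g : C -> C) (s v : C) : Prop :=
  (~ sing s -> v = g s) /\
  (sing s -> filterlim g (locally' s) (locally v)).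

(* Main.v *)
(* For Re s < 0 the Hankel integral of f_(2 pi i) is evaluated by residues at the
   poles 2 pi i k, |k| >= n_f, of 1 / (e^(-z) - 1). The coefficients of f_(2 pi i)
   are those of f times powers of 2 pi i, so the residues at 2 pi i k and -2 pi i k
   are (2 pi)^(s-1) k^(s-1,f) up to powers of i and the parity sign of p_f; they add
   up to a multiple of the series L(1-s, f), with factor (2 pi)^s times
   2 i sin (pi s / 2) in the even case and 2 cos (pi s / 2) in the odd case. After
   multiplication by s^2 both sides are entire, and the identity theorem extends
   the equality to all s. The form with Gamma follows from the reflection formula,
   which comes from Gauss's limit and the sine product, the latter evaluated by the
   integrals of cos^n x cos (2 s x). *)

Require Import Defs.
From Stdlib Require Import Reals Factorial.
From Coquelicot Require Import Coquelicot.
From Stdlib Require Import ZArith Lra Lia Psatz Classical ClassicalEpsilon.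

Open Scope R_scope.

(** * Complex derivatives and integrals along real segments *)

(** Cauchy theory is developed on rectangles only: Goursat's theorem by bisection, then Cauchy's
    formula on squares, which yields Taylor expansions with explicit remainders. The second-order
    remainder is stable under limits and under integration, so it replaces Morera's theorem, for
    generalized powers and for Hankel integrals alike. The obstacle is that the Hankel contour has
    an arc, while the generalized power is holomorphic only off the negative axis and outside a
    disc. A primitive of the kernel on a slit domain that contains the contour but no pole, built in
    the coordinate [log z], reduces the truncated contour to two end values. The same primitive
    along the lines at heights [c] and [-c] connects these values with stacks of rectangles, one
    pole in each. The factor [s^2] is one power more than the pole of [L] demands: differentiability
    at [0] is then immediate from the residue limit. The identity is first obtained off the real
    axis, where the trigonometric factor has no zero; dividing by it, the series for [L] converges
    because the residue sums do. *)

Notation CRInt := (RInt (V := C_R_CompleteNormedModule)).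
Notation is_CRInt := (is_RInt (V := C_R_CompleteNormedModule)).
Notation ex_CRInt := (ex_RInt (V := C_R_CompleteNormedModule)).
Notation Cderive := (is_derive (K := C_AbsRing) (V := C_NormedModule)).
Notation holo := (ex_derive (K := C_AbsRing) (V := C_NormedModule)).
Notation Rcont := (continuous (T := R_UniformSpace) (U := C_UniformSpace)).

(** The generic derivative and integral lemmas leave equations typed in a Coquelicot structure; the
    [change] restates them over [C], where [ring] and [field] are registered. *)
Ltac cring := cbv beta; match goal with |- @eq _ ?a ?b => change (@eq C a b) end; ring.
Ltac cfield := cbv beta; match goal with |- @eq _ ?a ?b => change (@eq C a b) end; field.

Lemma pos_min2 (a b : R) : 0 < a -> 0 < b -> exists t, 0 < t /\ t <= a /\ t <= b.
Proof.
  intros. exists (Rmin a b). split; [apply Rmin_glb_lt; auto|split; [apply Rmin_l|apply Rmin_r]].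
Qed.

Lemma pos_min3 (a b c : R) : 0 < a -> 0 < b -> 0 < c -> exists t, 0 < t /\ t <= a /\ t <= b /\ t <= c.
Proof.
  intros Ha Hb Hc. destruct (pos_min2 a b Ha Hb) as (t & Ht & H1 & H2).
  destruct (pos_min2 t c Ht Hc) as (u & Hu & H3 & H4). exists u. repeat split; lra.
Qed.

Lemma Rdiv_add1_le (k e : R) : 0 <= k -> 0 < e -> 0 < e / (k + 1) /\ k * (e / (k + 1)) <= e.
Proof.
  intros Hk He. assert (H : 0 < e / (k + 1)) by (apply Rdiv_lt_0_compat; lra).
  split; [exact H|]. apply Rle_trans with ((k + 1) * (e / (k + 1))); [nra|right; field; lra].
Qed.

Lemma Cmod_minus_sym (a b : C) : Cmod (a - b) = Cmod (b - a).
Proof. rewrite <- Cmod_opp; f_equal; ring. Qed.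

Lemma Cmod_triangle_minus (a b : C) : Cmod (a - b) <= Cmod a + Cmod b.
Proof. rewrite <- (Cmod_opp b); apply Cmod_triangle. Qed.

Lemma Cmod_triangle_inv (a b : C) : Cmod a - Cmod b <= Cmod (a - b).
Proof.
  pose proof (Cmod_triangle (a - b) b) as H.
  replace (a - b + b)%C with a in H by ring. lra.
Qed.

Lemma locally_C_eps (z : C) (P : C -> Prop) :
  locally (T := AbsRing_UniformSpace C_AbsRing) z P <->
  exists d, 0 < d /\ forall w, Cmod (w - z) < d -> P w.
Proof.
  split.
  - intros [d Hd]. exists d. split; [apply cond_pos|]. intros w Hw. apply Hd. exact Hw.
  - intros [d [Hd H]]. exists (mkposreal d Hd). intros w Hw. apply H. exact Hw.
Qed.

(** [C_UniformSpace] is the product structure, with squares as balls, whereas the absolute ring has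
    the discs of [Cmod]; [locally_C] says that both give the same neighbourhoods. Continuity along
    real paths refers to the first, complex derivatives to the second. *)
Lemma locally_CU_eps (z : C) (P : C -> Prop) :
  locally (T := C_UniformSpace) z P <->
  exists d, 0 < d /\ forall w, Cmod (w - z) < d -> P w.
Proof. rewrite <- locally_C_eps. apply locally_C. Qed.

Lemma Cderive_eps (g : C -> C) (z d : C) :
  Cderive g z d <->
  forall eps, 0 < eps -> exists del, 0 < del /\
    forall w, Cmod (w - z) < del ->
      Cmod (g w - g z - d * (w - z)) <= eps * Cmod (w - z).
Proof.
  split.
  - intros [_ H] eps He.
    specialize (H z (fun P HP => HP) (mkposreal eps He)).
    apply locally_C_eps in H. destruct H as [del [Hd H]].
    exists del. split; [exact Hd|]. intros w Hw. specialize (H w Hw).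
    rewrite Cmult_comm. exact H.
  - intros H. split.
    + apply (is_linear_scal_l (K := C_AbsRing) (V := C_NormedModule)).
    + intros x Hx eps.
      apply (is_filter_lim_locally_unique (K := C_AbsRing) (V := AbsRing_NormedModule C_AbsRing) z x) in Hx. subst x.
      destruct (H eps (cond_pos eps)) as [del [Hd H1]].
      apply locally_C_eps. exists del. split; [exact Hd|].
      intros w Hw. specialize (H1 w Hw). rewrite Cmult_comm in H1. exact H1.
Qed.

(** A quadratic error bound survives limits and integration. Limits of functions, parameter
    integrals and difference quotients are all shown to be holomorphic through this estimate, fed
    with Taylor remainders. *)
Lemma Cderive_quadratic (g : C -> C) (z l : C) (K d : R) : 0 <= K -> 0 < d ->
  (forall w, Cmod (w - z) <= d -> Cmod (g w - g z - l * (w - z)) <= K * Cmod (w - z) ^ 2) ->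
  Cderive g z l.
Proof.
  intros HK Hd H. apply Cderive_eps. intros eps He.
  destruct (Rdiv_add1_le K eps HK He) as [Hq Hq'].
  destruct (pos_min2 _ _ Hd Hq) as (t & Ht & T1 & T2). exists t. split; [exact Ht|]. intros w Hw.
  eapply Rle_trans; [apply H; lra|].
  replace (K * Cmod (w - z) ^ 2) with (K * Cmod (w - z) * Cmod (w - z)) by ring.
  apply Rmult_le_compat_r; [apply Cmod_ge_0|]. pose proof (Cmod_ge_0 (w - z)). nra.
Qed.

(** The product and chain rules of Coquelicot regard the ring as a module over itself. The error
    estimate is the same in both structures, so only the linearity clause has to be supplied
    again. *)
Lemma Cderive_AbsRing (g : C -> C) (z d : C) :
  Cderive g z d <->
  is_derive (K := C_AbsRing) (V := AbsRing_NormedModule C_AbsRing) g z d.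
Proof.
  split; intros [H1 H2].
  - split; [apply (is_linear_scal_l (K := C_AbsRing) (V := AbsRing_NormedModule C_AbsRing))|].
    exact H2.
  - split; [apply (is_linear_scal_l (K := C_AbsRing) (V := C_NormedModule))|].
    exact H2.
Qed.

Lemma Cderive_mult (f g : C -> C) (z df dg : C) :
  Cderive f z df -> Cderive g z dg ->
  Cderive (fun w => f w * g w)%C z (df * g z + f z * dg)%C.
Proof.
  rewrite !Cderive_AbsRing. intros Hf Hg.
  apply (is_derive_mult (K := C_AbsRing) f g z df dg Hf Hg Cmult_comm).
Qed.

Lemma Cderive_comp (f g : C -> C) (z df dg : C) :
  Cderive f (g z) df -> Cderive g z dg ->
  Cderive (fun w => f (g w)) z (dg * df)%C.
Proof.
  intros Hf Hg. rewrite Cderive_AbsRing in Hg.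
  exact (is_derive_comp (K := C_AbsRing) (V := C_NormedModule) f g z df dg Hf Hg).
Qed.

Lemma Cderive_plus (f g : C -> C) (z df dg : C) :
  Cderive f z df -> Cderive g z dg -> Cderive (fun w => f w + g w)%C z (df + dg)%C.
Proof. exact (is_derive_plus (K := C_AbsRing) (V := C_NormedModule) f g z df dg). Qed.

Lemma Cderive_opp (f : C -> C) (z df : C) :
  Cderive f z df -> Cderive (fun w => - f w)%C z (- df)%C.
Proof. exact (is_derive_opp (K := C_AbsRing) (V := C_NormedModule) f z df). Qed.

Lemma Cderive_minus (f g : C -> C) (z df dg : C) :
  Cderive f z df -> Cderive g z dg -> Cderive (fun w => f w - g w)%C z (df - dg)%C.
Proof. exact (is_derive_minus (K := C_AbsRing) (V := C_NormedModule) f g z df dg). Qed.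

Lemma Cderive_const (a z : C) : Cderive (fun _ => a) z (RtoC 0).
Proof. exact (is_derive_const (K := C_AbsRing) (V := C_NormedModule) a z). Qed.

Lemma Cderive_id (z : C) : Cderive (fun w => w) z (RtoC 1).
Proof. apply Cderive_AbsRing. apply (is_derive_id (K := C_AbsRing)). Qed.

Lemma Cderive_eq (f : C -> C) (z l l' : C) : Cderive f z l -> l = l' -> Cderive f z l'.
Proof. intros H E; rewrite <- E; exact H. Qed.

Lemma Cderive_scal (a : C) (f : C -> C) (z df : C) :
  Cderive f z df -> Cderive (fun w => a * f w)%C z (a * df)%C.
Proof.
  intros H. eapply Cderive_eq; [apply Cderive_mult; [apply Cderive_const | exact H]|]. cring. Qed.

Lemma Cderive_ext_loc (f g : C -> C) (z l : C) (d : R) :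
  0 < d -> (forall w, Cmod (w - z) < d -> f w = g w) ->
  Cderive f z l -> Cderive g z l.
Proof.
  intros Hd H. apply (is_derive_ext_loc (K := C_AbsRing) (V := C_NormedModule)).
  apply locally_C_eps. exists d; auto.
Qed.

Definition Ccont (g : C -> C) (z : C) : Prop :=
  forall eps, 0 < eps -> exists del, 0 < del /\
    forall w, Cmod (w - z) < del -> Cmod (g w - g z) < eps.

Lemma holo_cont (g : C -> C) (z : C) : holo g z -> Ccont g z.
Proof.
  intros [d H] eps He. rewrite Cderive_eps in H.
  destruct (H 1 Rlt_0_1) as [del [Hd H1]].
  pose proof (Cmod_ge_0 d) as Hp.
  destruct (Rdiv_add1_le (Cmod d + 1) (eps / 2) ltac:(lra) ltac:(lra)) as [Hq Hq'].
  destruct (pos_min2 _ _ Hd Hq) as (t & Ht & T1 & T2). exists t. split; [exact Ht|]. intros w Hw.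
  specialize (H1 w ltac:(lra)).
  replace (g w - g z)%C with ((g w - g z - d * (w - z)) + d * (w - z))%C by ring.
  eapply Rle_lt_trans; [apply Cmod_triangle|]. rewrite Cmod_mult.
  pose proof (Cmod_ge_0 (w - z)). nra.
Qed.

Lemma Cderive_inv (z : C) : z <> RtoC 0 -> Cderive Cinv z (- / (z * z))%C.
Proof.
  intros Hz. apply Cderive_eps. intros eps He.
  assert (Hm : 0 < Cmod z) by (apply Cmod_gt_0; auto).
  assert (Hd : 0 < eps * (Cmod z * Cmod z * Cmod z) / 2).
  { apply Rdiv_lt_0_compat; [|lra]. repeat apply Rmult_lt_0_compat; auto. }
  destruct (pos_min2 (Cmod z / 2) _ ltac:(lra) Hd) as (t & Ht & T1 & T2).
  exists t. split; [exact Ht|]. intros w Hw.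
  assert (Hw2 : Cmod (w - z) <= eps * (Cmod z * Cmod z * Cmod z) / 2) by lra.
  assert (Hwm : Cmod z / 2 < Cmod w).
  { pose proof (Cmod_triangle_inv z (z - w)) as H. replace (z - (z - w))%C with w in H by ring.
    rewrite (Cmod_minus_sym z w) in H. lra. }
  assert (Hw0 : w <> RtoC 0) by (apply Cmod_gt_0; lra).
  replace (/ w - / z - - / (z * z) * (w - z))%C with ((w - z) * ((w - z) / (w * (z * z))))%C
    by (field; auto).
  rewrite Cmod_mult, Cmod_div by (repeat apply Cmult_neq_0; auto).
  rewrite !Cmod_mult, Rmult_comm.
  apply Rmult_le_compat_r; [apply Cmod_ge_0|].
  apply Rmult_le_reg_r with (Cmod w * (Cmod z * Cmod z)).
  { repeat apply Rmult_lt_0_compat; lra. }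
  unfold Rdiv. rewrite Rmult_assoc, Rinv_l, Rmult_1_r.
  2:{ apply Rgt_not_eq. repeat apply Rmult_lt_0_compat; lra. }
  eapply Rle_trans; [apply Hw2|].
  assert (0 < eps * (Cmod z * Cmod z)) by (repeat apply Rmult_lt_0_compat; auto).
  nra.
Qed.

Lemma Cderive_comp_inv (f : C -> C) (z df : C) :
  f z <> RtoC 0 -> Cderive f z df -> Cderive (fun w => / f w)%C z (- df / (f z * f z))%C.
Proof.
  intros Hz H. eapply Cderive_eq.
  - apply (Cderive_comp Cinv f z _ _ (Cderive_inv (f z) Hz) H).
  - cfield. exact Hz.
Qed.

Lemma holo_plus (f g : C -> C) (z : C) : holo f z -> holo g z -> holo (fun w => f w + g w)%C z.
Proof. intros [a Ha] [b Hb]. eexists. apply Cderive_plus; eassumption. Qed.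
Lemma holo_minus (f g : C -> C) (z : C) : holo f z -> holo g z -> holo (fun w => f w - g w)%C z.
Proof. intros [a Ha] [b Hb]. eexists. apply Cderive_minus; eassumption. Qed.
Lemma holo_opp (f : C -> C) (z : C) : holo f z -> holo (fun w => - f w)%C z.
Proof. intros [a Ha]. eexists. apply Cderive_opp; eassumption. Qed.
Lemma holo_mult (f g : C -> C) (z : C) : holo f z -> holo g z -> holo (fun w => f w * g w)%C z.
Proof. intros [a Ha] [b Hb]. eexists. apply Cderive_mult; eassumption. Qed.
Lemma holo_inv (f : C -> C) (z : C) : f z <> RtoC 0 -> holo f z -> holo (fun w => / f w)%C z.
Proof. intros H [a Ha]. eexists. apply Cderive_comp_inv; eassumption. Qed.
Lemma holo_div (f g : C -> C) (z : C) : g z <> RtoC 0 -> holo f z -> holo g z -> holo (fun w => f w / g w)%C z.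
Proof. intros H Hf Hg. apply holo_mult; [|apply holo_inv]; assumption. Qed.
Lemma holo_const (a z : C) : holo (fun _ => a) z.
Proof. eexists. apply Cderive_const. Qed.
Lemma holo_id (z : C) : holo (fun w => w) z.
Proof. eexists. apply Cderive_id. Qed.
Lemma holo_comp (f g : C -> C) (z : C) : holo f (g z) -> holo g z -> holo (fun w => f (g w)) z.
Proof. intros [a Ha] [b Hb]. eexists. apply Cderive_comp; eassumption. Qed.
Lemma holo_ext_loc (f g : C -> C) (z : C) (d : R) :
  0 < d -> (forall w, Cmod (w - z) < d -> f w = g w) -> holo f z -> holo g z.
Proof. intros Hd H [l Hl]. exists l. eapply Cderive_ext_loc; eassumption. Qed.
Lemma holo_ext (f g : C -> C) (z : C) : (forall w, f w = g w) -> holo f z -> holo g z.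
Proof. intros H. apply holo_ext_loc with 1; auto; lra. Qed.
Lemma holo_pow (f : C -> C) (n : nat) (z : C) : holo f z -> holo (fun w => f w ^ n)%C z.
Proof.
  intros H. induction n as [|n IH]; simpl.
  - apply holo_const.
  - apply holo_mult; assumption.
Qed.

Lemma Rcont_eps (f : R -> C) (t : R) :
  Rcont f t <-> forall eps, 0 < eps -> exists del, 0 < del /\
    forall u, Rabs (u - t) < del -> Cmod (f u - f t) < eps.
Proof.
  split.
  - intros H eps He.
    assert (H1 : locally (T := C_UniformSpace) (f t) (fun w => Cmod (w - f t) < eps)).
    { apply locally_CU_eps. exists eps; auto. }
    destruct (H _ H1) as [d Hd]. exists d. split; [apply cond_pos|].
    intros u Hu. apply Hd. exact Hu.
  - intros H P HP. apply locally_CU_eps in HP. destruct HP as [e [He HP]].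
    destruct (H e He) as [d [Hd H1]]. exists (mkposreal d Hd).
    intros u Hu. apply HP, H1. exact Hu.
Qed.

Lemma Rcont_comp (g : C -> C) (f : R -> C) (t : R) :
  Ccont g (f t) -> Rcont f t -> Rcont (fun u => g (f u)) t.
Proof.
  rewrite !Rcont_eps. intros Hg Hf eps He.
  destruct (Hg eps He) as [d [Hd H]]. destruct (Hf d Hd) as [d' [Hd' H']].
  exists d'. split; auto.
Qed.

Definition Rderive (f : R -> C) (t : R) (l : C) : Prop :=
  is_derive (K := R_AbsRing) (V := C_R_NormedModule) f t l.

Lemma Rderive_eps (f : R -> C) (t : R) (l : C) :
  Rderive f t l <-> forall eps, 0 < eps -> exists del, 0 < del /\
    forall u, Rabs (u - t) < del -> Cmod (f u - f t - l * (u - t)%R) <= eps * Rabs (u - t).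
Proof.
  assert (E : forall u, Cmod (f u - f t - l * (u - t)%R) =
    norm (minus (minus (f u : C_R_NormedModule) (f t)) (scal (minus u t) (l : C_R_NormedModule)))).
  { intros u. rewrite <- Cmod_norm. f_equal. rewrite scal_R_Cmult.
    change (f u - f t - l * (u - t)%R = f u - f t - (u - t)%R * l)%C. ring. }
  split.
  - intros [_ H] eps He. specialize (H t (fun P HP => HP) (mkposreal eps He)).
    destruct H as [d H]. exists d. split; [apply cond_pos|]. intros u Hu.
    rewrite E. exact (H u Hu).
  - intros H. split; [apply (is_linear_scal_l (K := R_AbsRing) (V := C_R_NormedModule))|].
    intros x Hx eps. apply (is_filter_lim_locally_unique (K := R_AbsRing) (V := AbsRing_NormedModule R_AbsRing) t x) in Hx. subst x.
    destruct (H eps (cond_pos eps)) as [d [Hd H1]].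
    exists (mkposreal d Hd). intros u Hu. specialize (H1 u Hu). rewrite E in H1. exact H1.
Qed.

Lemma Rderive_cont (f : R -> C) (t : R) (l : C) : Rderive f t l -> Rcont f t.
Proof.
  intros H. apply (ex_derive_continuous (K := R_AbsRing) (V := C_R_NormedModule) f t).
  exists l; exact H.
Qed.

Lemma Rderive_comp (A : C -> C) (f : R -> C) (t : R) (dA l : C) :
  Cderive A (f t) dA -> Rderive f t l -> Rderive (fun u => A (f u)) t (dA * l)%C.
Proof.
  rewrite Cderive_eps, !Rderive_eps. intros HA Hf eps He.
  pose proof (Cmod_ge_0 dA) as PdA. pose proof (Cmod_ge_0 l) as Pl.
  destruct (Rdiv_add1_le (Cmod l + 1) (eps / 2) ltac:(lra) ltac:(lra)) as [He1 E1].
  destruct (Rdiv_add1_le (Cmod dA) (eps / 2) ltac:(lra) ltac:(lra)) as [He2 E2].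
  (* Half of [eps] goes to the remainder of [A], where [e1] compensates the slope [Cmod l + 1] of
     [f]; the other half goes to the remainder of [f], where [e2] compensates [Cmod dA]. The cap
     [e3 <= 1] below is what gives that slope. *)
  set (e1 := eps / 2 / (Cmod l + 1 + 1)) in *. set (e2 := eps / 2 / (Cmod dA + 1)) in *.
  destruct (HA e1 He1) as [d1 [Hd1 H1]].
  destruct (pos_min2 1 e2 Rlt_0_1 He2) as (e3 & He3 & F1 & F2).
  destruct (Hf e3 He3) as [d2 [Hd2 H2]].
  destruct (Rdiv_add1_le (Cmod l + 1) (d1 / 2) ltac:(lra) ltac:(lra)) as [Hd3 D3].
  destruct (pos_min2 _ _ Hd2 Hd3) as (t0 & Ht & T1 & T2).
  exists t0. split; [exact Ht|]. intros u Hu. pose proof (Rabs_pos (u - t)) as Pu.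
  specialize (H2 u ltac:(lra)).
  assert (Hfu : Cmod (f u - f t) <= (Cmod l + 1) * Rabs (u - t)).
  { replace (f u - f t)%C with ((f u - f t - l * (u - t)%R) + l * (u - t)%R)%C by ring.
    eapply Rle_trans; [apply Cmod_triangle|]. rewrite Cmod_mult, Cmod_R. nra. }
  specialize (H1 (f u) ltac:(nra)).
  replace (A (f u) - A (f t) - dA * l * (u - t)%R)%C with
    ((A (f u) - A (f t) - dA * (f u - f t)) + dA * (f u - f t - l * (u - t)%R))%C by ring.
  eapply Rle_trans; [apply Cmod_triangle|]. rewrite Cmod_mult.
  assert (e1 * Cmod (f u - f t) <= eps / 2 * Rabs (u - t)).
  { apply Rle_trans with (e1 * ((Cmod l + 1) * Rabs (u - t))); [apply Rmult_le_compat_l; lra|].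
    rewrite <- Rmult_assoc. apply Rmult_le_compat_r; lra. }
  assert (Cmod dA * (e3 * Rabs (u - t)) <= eps / 2 * Rabs (u - t)).
  { rewrite <- Rmult_assoc. apply Rmult_le_compat_r; [exact Pu|]. nra. }
  assert (Cmod dA * Cmod (f u - f t - l * (u - t)%R) <= Cmod dA * (e3 * Rabs (u - t)))
    by (apply Rmult_le_compat_l; lra).
  lra.
Qed.

Lemma CRInt_derive (A dA : R -> C) (a b : R) :
  (forall t, Rmin a b <= t <= Rmax a b -> Rderive A t (dA t)) ->
  (forall t, Rmin a b <= t <= Rmax a b -> Rcont dA t) ->
  is_CRInt dA a b (A b - A a)%C.
Proof. exact (is_RInt_derive (V := C_R_CompleteNormedModule) A dA a b). Qed.

Lemma CRInt_le (f : R -> C) (a b M : R) (l : C) :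
  a <= b -> (forall t, a <= t <= b -> Cmod (f t) <= M) -> is_CRInt f a b l ->
  Cmod l <= (b - a) * M.
Proof.
  intros Hab H Hl. rewrite Cmod_norm.
  apply (norm_RInt_le_const (V := C_R_NormedModule) f a b l M); auto.
  intros t Ht. rewrite <- Cmod_norm. auto.
Qed.

Lemma ex_CRInt_cont (f : R -> C) (a b : R) :
  (forall t, Rmin a b <= t <= Rmax a b -> Rcont f t) -> ex_CRInt f a b.
Proof. exact (ex_RInt_continuous (V := C_R_CompleteNormedModule) f a b). Qed.

Lemma CRInt_correct (f : R -> C) (a b : R) : ex_CRInt f a b -> is_CRInt f a b (CRInt f a b).
Proof. exact (RInt_correct (V := C_R_CompleteNormedModule) f a b). Qed.

Lemma CRInt_unique (f : R -> C) (a b : R) (l : C) : is_CRInt f a b l -> CRInt f a b = l.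
Proof. exact (is_RInt_unique (V := C_R_CompleteNormedModule) f a b l). Qed.

Lemma CRInt_Chasles (f : R -> C) (a b c : R) :
  ex_CRInt f a b -> ex_CRInt f b c -> (CRInt f a b + CRInt f b c)%C = CRInt f a c.
Proof. exact (RInt_Chasles (V := C_R_CompleteNormedModule) f a b c). Qed.

Lemma Rderive_linear (a b : C) (t : R) : Rderive (fun u => a + b * RtoC u)%C t b.
Proof.
  apply Rderive_eps. intros eps He. exists 1. split; [lra|]. intros u _.
  replace (a + b * u - (a + b * t) - b * (u - t)%R)%C with (RtoC 0).
  - rewrite Cmod_0. apply Rmult_le_pos; [lra|apply Rabs_pos].
  - rewrite RtoC_minus. ring.
Qed.

Lemma Rderive_ext (f g : R -> C) (t : R) (l : C) :
  (forall u, f u = g u) -> Rderive f t l -> Rderive g t l.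
Proof. intros H. apply (is_derive_ext (K := R_AbsRing) (V := C_R_NormedModule)). exact H. Qed.

Lemma C_re_im (x y : R) : ((x, y) : C) = (RtoC x + Ci * RtoC y)%C.
Proof. unfold RtoC, Ci, Cplus, Cmult; simpl. f_equal; ring. Qed.

Lemma Rderive_horiz (y t : R) : Rderive (fun x => (x, y)) t (RtoC 1).
Proof.
  apply Rderive_ext with (fun u => Ci * y + 1 * RtoC u)%C; [|apply Rderive_linear].
  intros u. rewrite C_re_im. ring.
Qed.

Lemma Rderive_vert (x t : R) : Rderive (fun y => (x, y)) t Ci.
Proof.
  apply Rderive_ext with (fun u => RtoC x + Ci * RtoC u)%C; [|apply Rderive_linear].
  intros u. rewrite C_re_im. ring.
Qed.

(** * Goursat's theorem and Cauchy's formula on rectangles *)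

Lemma Cmod_le_abs (z : C) : Cmod z <= Rabs (Re z) + Rabs (Im z).
Proof.
  destruct z as [x y]. change (Cmod (x, y) <= Rabs x + Rabs y).
  rewrite C_re_im. eapply Rle_trans; [apply Cmod_triangle|].
  rewrite Cmod_mult, Cmod_Ci, !Cmod_R. lra.
Qed.

Lemma im_le_Cmod (z : C) : Rabs (Im z) <= Cmod z.
Proof. eapply Rle_trans; [apply Rmax_r | apply (Rmax_Cmod z)]. Qed.

Lemma Rderive_pair (f g : R -> R) (t a b : R) :
  is_derive f t a -> is_derive g t b -> Rderive (fun u => (f u, g u)) t (a, b).
Proof.
  intros Hf Hg. apply Rderive_eps. intros eps He.
  assert (E : forall (h : R -> R) (l : R), is_derive h t l -> exists d, 0 < d /\
     forall u, Rabs (u - t) < d -> Rabs (h u - h t - l * (u - t)) <= eps / 2 * Rabs (u - t)).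
  { intros h l [_ H]. assert (He2 : 0 < eps / 2) by lra.
    destruct (H t (fun P HP => HP) (mkposreal _ He2)) as [d Hd].
    exists d. split; [apply cond_pos|]. intros u Hu. specialize (Hd u Hu).
    change (Rabs ((h u - h t) - (u - t) * l) <= eps / 2 * Rabs (u - t)) in Hd.
    rewrite (Rmult_comm l). exact Hd. }
  destruct (E f a Hf) as [d1 [Hd1 H1]]. destruct (E g b Hg) as [d2 [Hd2 H2]].
  destruct (pos_min2 _ _ Hd1 Hd2) as (t0 & Ht & T1 & T2).
  exists t0. split; [exact Ht|]. intros u Hu. specialize (H1 u ltac:(lra)). specialize (H2 u ltac:(lra)).
  eapply Rle_trans; [apply Cmod_le_abs|].
  replace (Re _) with (f u - f t - a * (u - t)) by (unfold Re; simpl; ring).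
  replace (Im _) with (g u - g t - b * (u - t)) by (unfold Im; simpl; ring).
  lra.
Qed.

(** The contour integral around a rectangle, counterclockwise when [a <= b] and [c <= d]; the factor
    [Ci] is [dz / dy] on the vertical sides. *)
Definition RectInt (g : C -> C) (a b c d : R) : C :=
  (CRInt (fun x => g (x, c)) a b - CRInt (fun x => g (x, d)) a b
   + Ci * (CRInt (fun y => g (b, y)) c d - CRInt (fun y => g (a, y)) c d))%C.

Lemma Rcont_horiz (g : C -> C) (x y : R) : Ccont g (x, y) -> Rcont (fun t => g (t, y)) x.
Proof. intros H. apply Rcont_comp; [exact H|]. eapply Rderive_cont, Rderive_horiz. Qed.

Lemma Rcont_vert (g : C -> C) (x y : R) : Ccont g (x, y) -> Rcont (fun t => g (x, t)) y.
Proof. intros H. apply Rcont_comp; [exact H|]. eapply Rderive_cont, Rderive_vert. Qed.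

Lemma ex_CRInt_horiz (g : C -> C) (a b y : R) : a <= b ->
  (forall x, a <= x <= b -> Ccont g (x, y)) -> ex_CRInt (fun x => g (x, y)) a b.
Proof.
  intros Hab H. apply ex_CRInt_cont. intros t Ht. rewrite Rmin_left, Rmax_right in Ht by auto.
  apply Rcont_horiz; auto.
Qed.

Lemma ex_CRInt_vert (g : C -> C) (c d x : R) : c <= d ->
  (forall y, c <= y <= d -> Ccont g (x, y)) -> ex_CRInt (fun y => g (x, y)) c d.
Proof.
  intros Hab H. apply ex_CRInt_cont. intros t Ht. rewrite Rmin_left, Rmax_right in Ht by auto.
  apply Rcont_vert; auto.
Qed.

Definition rect_sides (g : C -> C) (a b c d : R) : Prop :=
  ex_CRInt (fun x => g (x, c)) a b /\ ex_CRInt (fun x => g (x, d)) a b /\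
  ex_CRInt (fun y => g (b, y)) c d /\ ex_CRInt (fun y => g (a, y)) c d.

Lemma rect_sides_cont (g : C -> C) (a b c d : R) : a <= b -> c <= d ->
  (forall x, a <= x <= b -> Ccont g (x, c) /\ Ccont g (x, d)) ->
  (forall y, c <= y <= d -> Ccont g (a, y) /\ Ccont g (b, y)) ->
  rect_sides g a b c d.
Proof.
  intros Hab Hcd H1 H2. repeat split.
  - apply ex_CRInt_horiz; auto; intros; apply H1; auto.
  - apply ex_CRInt_horiz; auto; intros; apply H1; auto.
  - apply ex_CRInt_vert; auto; intros; apply H2; auto.
  - apply ex_CRInt_vert; auto; intros; apply H2; auto.
Qed.

Lemma rect_sides_cont_all (g : C -> C) (a b c d : R) : a <= b -> c <= d ->
  (forall x y, a <= x <= b -> c <= y <= d -> Ccont g (x, y)) -> rect_sides g a b c d.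
Proof.
  intros Hab Hcd H. apply rect_sides_cont; auto; intros; split; apply H; lra.
Qed.

Lemma RectInt_hsplit (g : C -> C) (a m b c d : R) :
  rect_sides g a m c d -> rect_sides g m b c d ->
  RectInt g a b c d = (RectInt g a m c d + RectInt g m b c d)%C.
Proof.
  intros (H1 & H2 & _ & _) (H3 & H4 & _ & _). unfold RectInt.
  rewrite <- (CRInt_Chasles _ a m b H1 H3), <- (CRInt_Chasles _ a m b H2 H4). ring.
Qed.

Lemma RectInt_vsplit (g : C -> C) (a b c m d : R) :
  rect_sides g a b c m -> rect_sides g a b m d ->
  RectInt g a b c d = (RectInt g a b c m + RectInt g a b m d)%C.
Proof.
  intros (_ & _ & H1 & H2) (_ & _ & H3 & H4). unfold RectInt.
  rewrite <- (CRInt_Chasles _ c m d H1 H3), <- (CRInt_Chasles _ c m d H2 H4). ring.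
Qed.

Lemma CRInt_plus (f g : R -> C) (a b : R) : ex_CRInt f a b -> ex_CRInt g a b ->
  CRInt (fun t => f t + g t)%C a b = (CRInt f a b + CRInt g a b)%C.
Proof. exact (RInt_plus (V := C_R_CompleteNormedModule) f g a b). Qed.

Lemma is_CRInt_scal (f : R -> C) (k : C) (a b : R) (l : C) : is_CRInt f a b l ->
  is_CRInt (fun t => k * f t)%C a b (k * l)%C.
Proof.
  intros H.
  assert (H1 := is_RInt_fct_extend_fst (U := R_NormedModule) (V := R_NormedModule) f a b l H).
  assert (H2 := is_RInt_fct_extend_snd (U := R_NormedModule) (V := R_NormedModule) f a b l H).
  apply (is_RInt_fct_extend_pair (U := R_NormedModule) (V := R_NormedModule)).
  - apply (is_RInt_minus (V := R_NormedModule) (fun t => fst k * fst (f t)) (fun t => snd k * snd (f t)));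
    apply (is_RInt_scal (V := R_NormedModule)); assumption.
  - apply (is_RInt_plus (V := R_NormedModule) (fun t => fst k * snd (f t)) (fun t => snd k * fst (f t)));
    apply (is_RInt_scal (V := R_NormedModule)); assumption.
Qed.

Lemma CRInt_scal (f : R -> C) (k : C) (a b : R) : ex_CRInt f a b ->
  CRInt (fun t => k * f t)%C a b = (k * CRInt f a b)%C.
Proof. intros H. apply CRInt_unique, is_CRInt_scal, CRInt_correct, H. Qed.

Lemma RectInt_plus (f g : C -> C) (a b c d : R) :
  rect_sides f a b c d -> rect_sides g a b c d ->
  RectInt (fun z => f z + g z)%C a b c d = (RectInt f a b c d + RectInt g a b c d)%C.
Proof.
  intros (F1 & F2 & F3 & F4) (G1 & G2 & G3 & G4). unfold RectInt.
  rewrite (CRInt_plus (fun x => f (x, c)) (fun x => g (x, c)) a b), (CRInt_plus (fun x => f (x, d)) (fun x => g (x, d)) a b),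
   (CRInt_plus (fun y => f (a, y)) (fun y => g (a, y)) c d), (CRInt_plus (fun y => f (b, y)) (fun y => g (b, y)) c d) by auto.
  ring.
Qed.

Lemma RectInt_scal (f : C -> C) (k : C) (a b c d : R) : rect_sides f a b c d ->
  RectInt (fun z => k * f z)%C a b c d = (k * RectInt f a b c d)%C.
Proof.
  intros (F1 & F2 & F3 & F4). unfold RectInt.
  rewrite (CRInt_scal (fun x => f (x, c)) k a b), (CRInt_scal (fun x => f (x, d)) k a b),
   (CRInt_scal (fun y => f (a, y)) k c d), (CRInt_scal (fun y => f (b, y)) k c d) by auto.
  ring.
Qed.

Lemma CRInt_ext (f g : R -> C) (a b : R) :
  (forall t, Rmin a b < t < Rmax a b -> f t = g t) -> CRInt f a b = CRInt g a b.
Proof. exact (RInt_ext (V := C_R_CompleteNormedModule) f g a b). Qed.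

Lemma ex_CRInt_ext (f g : R -> C) (a b : R) :
  (forall t, Rmin a b < t < Rmax a b -> f t = g t) -> ex_CRInt f a b -> ex_CRInt g a b.
Proof. exact (ex_RInt_ext (V := C_R_CompleteNormedModule) f g a b). Qed.

Lemma RectInt_ext (f g : C -> C) (a b c d : R) : a <= b -> c <= d ->
  (forall x, a <= x <= b -> f (x, c) = g (x, c) /\ f (x, d) = g (x, d)) ->
  (forall y, c <= y <= d -> f (a, y) = g (a, y) /\ f (b, y) = g (b, y)) ->
  RectInt f a b c d = RectInt g a b c d.
Proof.
  intros Hab Hcd H1 H2. unfold RectInt.
  rewrite (CRInt_ext (fun x => f (x, c)) (fun x => g (x, c)) a b),
    (CRInt_ext (fun x => f (x, d)) (fun x => g (x, d)) a b),
    (CRInt_ext (fun y => f (a, y)) (fun y => g (a, y)) c d),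
    (CRInt_ext (fun y => f (b, y)) (fun y => g (b, y)) c d);
    try reflexivity; intros t Ht; rewrite Rmin_left, Rmax_right in Ht by auto;
    (apply H1 || apply H2); lra.
Qed.

Lemma RectInt_bound (g : C -> C) (a b c d M : R) : a <= b -> c <= d ->
  rect_sides g a b c d ->
  (forall x, a <= x <= b -> Cmod (g (x, c)) <= M /\ Cmod (g (x, d)) <= M) ->
  (forall y, c <= y <= d -> Cmod (g (a, y)) <= M /\ Cmod (g (b, y)) <= M) ->
  Cmod (RectInt g a b c d) <= 2 * ((b - a) + (d - c)) * M.
Proof.
  intros Hab Hcd (F1 & F2 & F3 & F4) H1 H2. unfold RectInt.
  assert (B1 : Cmod (CRInt (fun x => g (x, c)) a b) <= (b - a) * M)
    by (eapply CRInt_le; [exact Hab | intros t Ht; exact (proj1 (H1 t Ht)) | apply CRInt_correct; exact F1]).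
  assert (B2 : Cmod (CRInt (fun x => g (x, d)) a b) <= (b - a) * M)
    by (eapply CRInt_le; [exact Hab | intros t Ht; exact (proj2 (H1 t Ht)) | apply CRInt_correct; exact F2]).
  assert (B3 : Cmod (CRInt (fun y => g (b, y)) c d) <= (d - c) * M)
    by (eapply CRInt_le; [exact Hcd | intros t Ht; exact (proj2 (H2 t Ht)) | apply CRInt_correct; exact F3]).
  assert (B4 : Cmod (CRInt (fun y => g (a, y)) c d) <= (d - c) * M)
    by (eapply CRInt_le; [exact Hcd | intros t Ht; exact (proj1 (H2 t Ht)) | apply CRInt_correct; exact F4]).
  eapply Rle_trans; [apply Cmod_triangle|]. rewrite Cmod_mult, Cmod_Ci.
  pose proof (Cmod_triangle_minus (CRInt (fun x => g (x, c)) a b) (CRInt (fun x => g (x, d)) a b)).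
  pose proof (Cmod_triangle_minus (CRInt (fun y => g (b, y)) c d) (CRInt (fun y => g (a, y)) c d)).
  lra.
Qed.

Lemma CRInt_horiz_prim (A g : C -> C) (a b y : R) : a <= b ->
  (forall x, a <= x <= b -> Cderive A (x, y) (g (x, y))) ->
  (forall x, a <= x <= b -> Ccont g (x, y)) ->
  is_CRInt (fun x => g (x, y)) a b (A (b, y) - A (a, y))%C.
Proof.
  intros Hab HA Hg. apply (CRInt_derive (fun x => A (x, y)));
    intros t Ht; rewrite Rmin_left, Rmax_right in Ht by auto.
  - rewrite <- (Cmult_1_r (g (t, y))). apply Rderive_comp; [apply HA; auto | apply Rderive_horiz].
  - apply Rcont_horiz; auto.
Qed.

Lemma CRInt_vert_prim (A g : C -> C) (c d x : R) : c <= d ->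
  (forall y, c <= y <= d -> Cderive A (x, y) (g (x, y))) ->
  (forall y, c <= y <= d -> Ccont g (x, y)) ->
  (Ci * CRInt (fun y => g (x, y)) c d)%C = (A (x, d) - A (x, c))%C.
Proof.
  intros Hab HA Hg.
  rewrite <- (CRInt_scal (fun y => g (x, y))) by (apply ex_CRInt_vert; auto).
  apply CRInt_unique. apply (CRInt_derive (fun y => A (x, y)));
    intros t Ht; rewrite Rmin_left, Rmax_right in Ht by auto.
  - rewrite Cmult_comm. apply Rderive_comp; [apply HA; auto | apply Rderive_vert].
  - apply (Rcont_comp (fun w => Ci * w)%C).
    + apply holo_cont, holo_mult; [apply holo_const | apply holo_id].
    + apply Rcont_vert; auto.
Qed.

Lemma RectInt_prim (A g : C -> C) (a b c d : R) : a <= b -> c <= d ->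
  (forall x y, a <= x <= b -> c <= y <= d -> Cderive A (x, y) (g (x, y))) ->
  (forall x y, a <= x <= b -> c <= y <= d -> Ccont g (x, y)) ->
  RectInt g a b c d = RtoC 0.
Proof.
  intros Hab Hcd HA Hg. unfold RectInt.
  rewrite (CRInt_unique _ _ _ _ (CRInt_horiz_prim A g a b c Hab (fun x Hx => HA x c Hx ltac:(lra)) (fun x Hx => Hg x c Hx ltac:(lra)))).
  rewrite (CRInt_unique _ _ _ _ (CRInt_horiz_prim A g a b d Hab (fun x Hx => HA x d Hx ltac:(lra)) (fun x Hx => Hg x d Hx ltac:(lra)))).
  replace (Ci * (CRInt (fun y => g (b, y)) c d - CRInt (fun y => g (a, y)) c d))%C
   with (Ci * CRInt (fun y => g (b, y)) c d - Ci * CRInt (fun y => g (a, y)) c d)%C by ring.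
  rewrite (CRInt_vert_prim A g c d b Hcd (fun y Hy => HA b y ltac:(lra) Hy) (fun y Hy => Hg b y ltac:(lra) Hy)).
  rewrite (CRInt_vert_prim A g c d a Hcd (fun y Hy => HA a y ltac:(lra) Hy) (fun y Hy => Hg a y ltac:(lra) Hy)).
  ring.
Qed.

Lemma nested_intervals (a b : nat -> R) :
  (forall n, a n <= a (S n)) -> (forall n, b (S n) <= b n) -> (forall n, a n <= b n) ->
  exists x, forall n, a n <= x <= b n.
Proof.
  intros Ha Hb Hab.
  assert (Ha' : forall n k, a n <= a (n + k)%nat).
  { intros n k. induction k; [rewrite Nat.add_0_r; lra|]. rewrite Nat.add_succ_r. specialize (Ha (n + k)%nat). lra. }
  assert (Hb' : forall n k, b (n + k)%nat <= b n).
  { intros n k. induction k; [rewrite Nat.add_0_r; lra|]. rewrite Nat.add_succ_r. specialize (Hb (n + k)%nat). lra. }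
  assert (X : forall n m, a n <= b m).
  { intros n m. apply Rle_trans with (a (n + m)%nat); [apply Ha'|].
    apply Rle_trans with (b (n + m)%nat); [apply Hab|]. rewrite Nat.add_comm. apply Hb'. }
  destruct (completeness (fun r => exists n, r = a n)) as [x [H1 H2]].
  - exists (b O). intros r [n Hn]. rewrite Hn. apply X.
  - exists (a O). exists O; auto.
  - exists x. intros n. split; [apply H1; exists n; auto|].
    apply H2. intros r [m Hm]. rewrite Hm. apply X.
Qed.

Lemma geometric_small (K th eps : R) : 0 <= th < 1 -> 0 < eps ->
  exists N, forall n, (N <= n)%nat -> K * th ^ n < eps.
Proof.
  intros Hth He.
  assert (L : is_lim_seq (fun n => K * th ^ n) (Rbar_mult K 0)).
  { apply is_lim_seq_scal_l, is_lim_seq_geom. rewrite Rabs_pos_eq; lra. }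
  replace (Rbar_mult K 0) with (Finite 0) in L by (simpl; f_equal; ring).
  apply is_lim_seq_spec in L. destruct (L (mkposreal _ He)) as [N HN].
  exists N. intros n Hn. specialize (HN n Hn). simpl in HN. rewrite Rminus_0_r in HN.
  apply Rabs_lt_between in HN. lra.
Qed.

(** If [P] failed, a failing quarter could be chosen again and again; these quarters shrink to a
    point, near which [P] holds. The principle carries both Goursat's theorem and the boundedness of
    continuous functions on squares. *)
Lemma rect_bisection (P : R -> R -> R -> R -> Prop) (a0 b0 c0 d0 : R) :
  a0 <= b0 -> c0 <= d0 ->
  (forall a b c d, a <= b -> c <= d ->
     P a ((a + b) / 2) c ((c + d) / 2) -> P ((a + b) / 2) b c ((c + d) / 2) ->
     P a ((a + b) / 2) ((c + d) / 2) d -> P ((a + b) / 2) b ((c + d) / 2) d -> P a b c d) ->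
  (forall x y, a0 <= x <= b0 -> c0 <= y <= d0 -> exists del, 0 < del /\
     forall a b c d, a <= x <= b -> c <= y <= d -> b - a < del -> d - c < del -> P a b c d) ->
  P a0 b0 c0 d0.
Proof.
  intros Hab0 Hcd0 Hstep Hloc. apply NNPP. intros HN.
  (* Three quarters are tested and the fourth is taken without a test: by [Hstep] the four cannot
     all satisfy [P]. *)
  set (step := fun q : (R * R) * (R * R) =>
    let '((a, b), (c, d)) := q in
    let m := (a + b) / 2 in let n := (c + d) / 2 in
    if excluded_middle_informative (P a m c n) then
      if excluded_middle_informative (P m b c n) then
        if excluded_middle_informative (P a m n d) then ((m, b), (n, d))
        else ((a, m), (n, d))
      else ((m, b), (c, n))
    else ((a, m), (c, n))).
  set (u := fun n => Nat.iter n step ((a0, b0), (c0, d0))).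
  set (an := fun n => fst (fst (u n))). set (bn := fun n => snd (fst (u n))).
  set (cn := fun n => fst (snd (u n))). set (dn := fun n => snd (snd (u n))).
  assert (Inv : forall n, an n <= bn n /\ cn n <= dn n /\ ~ P (an n) (bn n) (cn n) (dn n)
     /\ bn n - an n = (b0 - a0) * (/ 2) ^ n /\ dn n - cn n = (d0 - c0) * (/ 2) ^ n).
  { induction n as [|n IH].
    - unfold an, bn, cn, dn, u; simpl. repeat split; auto; lra.
    - unfold an, bn, cn, dn in *. change (u (S n)) with (step (u n)). simpl pow.
      destruct (u n) as [[a b] [c d]]. simpl in IH |- *.
      destruct IH as (I1 & I2 & I3 & I4 & I5).
      repeat (match goal with |- context [excluded_middle_informative ?Q] =>
        destruct (excluded_middle_informative Q) end); simpl; repeat split; try lra; try assumption.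
      intros H; apply I3, Hstep; assumption. }
  assert (Mon : forall n, an n <= an (S n) /\ bn (S n) <= bn n /\ cn n <= cn (S n) /\ dn (S n) <= dn n).
  { intros n. destruct (Inv n) as (I1 & I2 & _).
    unfold an, bn, cn, dn in *. change (u (S n)) with (step (u n)).
    destruct (u n) as [[a b] [c d]]. simpl in *.
    repeat (match goal with |- context [excluded_middle_informative ?Q] =>
        destruct (excluded_middle_informative Q) end); simpl; repeat split; lra. }
  destruct (nested_intervals an bn) as [x Hx]; try (intros n; apply Mon); try (intros n; apply Inv).
  destruct (nested_intervals cn dn) as [y Hy]; try (intros n; apply Mon); try (intros n; apply Inv).
  destruct (Hloc x y (Hx O) (Hy O)) as [del [Hd H]].
  destruct (geometric_small (b0 - a0) (/ 2) del ltac:(lra) Hd) as [N1 HN1].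
  destruct (geometric_small (d0 - c0) (/ 2) del ltac:(lra) Hd) as [N2 HN2].
  specialize (HN1 (max N1 N2) (Nat.le_max_l _ _)). specialize (HN2 (max N1 N2) (Nat.le_max_r _ _)).
  destruct (Inv (max N1 N2)) as (I1 & I2 & I3 & I4 & I5).
  apply I3, H; auto; lra.
Qed.

Lemma Rle_0_eps (x k : R) : 0 <= k -> (forall eps, 0 < eps -> x <= eps * k) -> x <= 0.
Proof.
  intros Hk H. apply Rle_plus_epsilon. intros e He.
  destruct (Rdiv_add1_le k e Hk He) as [Hq Hq']. specialize (H _ Hq). lra.
Qed.

Lemma Cmod_le_0 (z : C) : Cmod z <= 0 -> z = RtoC 0.
Proof. intros H. apply Cmod_eq_0. pose proof (Cmod_ge_0 z). lra. Qed.

(** The bound [eps] times the squared half perimeter is additive over the four quarters, hence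
    suited to bisection. It holds near each point because the affine part of [g] has a primitive,
    while the rest is at most [eps / 2] times the half perimeter and is integrated over twice that
    length. *)
Lemma goursat (g : C -> C) (a b c d : R) : a <= b -> c <= d ->
  (forall x y, a <= x <= b -> c <= y <= d -> holo g (x, y)) ->
  RectInt g a b c d = RtoC 0.
Proof.
  intros Hab Hcd Hg. apply Cmod_le_0.
  apply Rle_0_eps with (((b - a) + (d - c)) ^ 2); [apply pow2_ge_0|].
  intros eps He.
  set (P := fun a' b' c' d' : R => a <= a' -> b' <= b -> c <= c' -> d' <= d ->
     Cmod (RectInt g a' b' c' d') <= eps * ((b' - a') + (d' - c')) ^ 2).
  enough (H : P a b c d) by (apply H; lra).
  assert (Hc : forall x y, a <= x <= b -> c <= y <= d -> Ccont g (x, y))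
    by (intros; apply holo_cont, Hg; auto).
  apply rect_bisection; auto.
  - intros a' b' c' d' Hab' Hcd' H1 H2 H3 H4 Ha Hb Hc' Hd.
    set (m := (a' + b') / 2) in *. set (n := (c' + d') / 2) in *.
    assert (Hm : a' <= m <= b' /\ m - a' = (b' - a') / 2 /\ b' - m = (b' - a') / 2) by (unfold m; lra).
    assert (Hn : c' <= n <= d' /\ n - c' = (d' - c') / 2 /\ d' - n = (d' - c') / 2) by (unfold n; lra).
    clearbody m n. destruct Hm as (Hm & E1 & E2). destruct Hn as (Hn & E3 & E4).
    unfold P in H1, H2, H3, H4.
    specialize (H1 ltac:(lra) ltac:(lra) ltac:(lra) ltac:(lra)).
    specialize (H2 ltac:(lra) ltac:(lra) ltac:(lra) ltac:(lra)).
    specialize (H3 ltac:(lra) ltac:(lra) ltac:(lra) ltac:(lra)).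
    specialize (H4 ltac:(lra) ltac:(lra) ltac:(lra) ltac:(lra)).
    rewrite E1, ?E2, E3, ?E4 in *.
    assert (S : forall p q r s, a' <= p -> p <= q -> q <= b' -> c' <= r -> r <= s -> s <= d' -> rect_sides g p q r s).
    { intros. apply rect_sides_cont_all; auto. intros; apply Hc; lra. }
    rewrite (RectInt_hsplit g a' m b') by (apply S; lra).
    rewrite (RectInt_vsplit g a' m c' n d'), (RectInt_vsplit g m b' c' n d') by (apply S; lra).
    eapply Rle_trans; [apply Cmod_triangle|].
    eapply Rle_trans; [apply Rplus_le_compat; apply Cmod_triangle|].
    replace (eps * (b' - a' + (d' - c')) ^ 2) with (4 * (eps * ((b' - a') / 2 + (d' - c') / 2) ^ 2)) by field.
    lra.
  - intros x y Hx Hy. destruct (Hg x y Hx Hy) as [l Hl]. rewrite Cderive_eps in Hl.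
    destruct (Hl (eps / 2) ltac:(lra)) as [del [Hd H]].
    exists (del / 2). split; [lra|].
    intros a' b' c' d' Hx' Hy' Hba Hdc Ha Hb Hc' Hd'.
    set (D := (b' - a') + (d' - c')).
    set (p := (x, y) : C).
    set (lin := fun z => (g p + l * (z - p))%C).
    set (r := fun z => (g z - lin z)%C).
    assert (Hlin : forall z, holo lin z).
    { intros z. apply holo_plus; [apply holo_const|]. apply holo_mult; [apply holo_const|].
      apply holo_minus; [apply holo_id | apply holo_const]. }
    assert (Hr : forall x' y', a' <= x' <= b' -> c' <= y' <= d' -> Ccont r (x', y')).
    { intros. apply holo_cont. apply holo_minus; [apply Hg; lra | apply Hlin]. }
    assert (E : RectInt g a' b' c' d' = RectInt (fun z => r z + lin z)%C a' b' c' d').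
    { apply RectInt_ext; try lra; intros; unfold r; split; ring. }
    rewrite E. rewrite RectInt_plus.
    2:{ apply rect_sides_cont_all; auto; lra. }
    2:{ apply rect_sides_cont_all; try lra. intros; apply holo_cont, Hlin. }
    rewrite (RectInt_prim (fun z => g p * z + l * ((z - p) * (z - p) / 2))%C lin); try lra.
    2:{ intros x' y' _ _. eapply Cderive_eq.
        - apply Cderive_plus.
          + apply Cderive_scal, Cderive_id.
          + apply Cderive_scal. apply Cderive_mult; [|apply Cderive_const].
            apply Cderive_mult; (apply Cderive_minus; [apply Cderive_id | apply Cderive_const]).
        - unfold lin. cfield. }
    2:{ intros; apply holo_cont, Hlin. }
    rewrite Cplus_0_r.
    assert (Hpt : forall x' y', a' <= x' <= b' -> c' <= y' <= d' -> Cmod (r (x', y')) <= eps / 2 * D).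
    { intros x' y' Hx1 Hy1.
      assert (B : Cmod ((x', y') - p) <= D).
      { eapply Rle_trans; [apply Cmod_le_abs|]. change (Rabs (x' - x) + Rabs (y' - y) <= D).
        apply Rplus_le_compat; apply Rabs_le; lra. }
      unfold r, lin. replace (g (x', y') - (g p + l * ((x', y') - p)))%C
        with (g (x', y') - g p - l * ((x', y') - p))%C by ring.
      eapply Rle_trans; [apply H|].
      - eapply Rle_lt_trans; [apply B|]. unfold D; lra.
      - apply Rmult_le_compat_l; [lra | exact B]. }
    eapply Rle_trans.
    + apply (RectInt_bound r a' b' c' d' (eps / 2 * D)); try lra.
      * apply rect_sides_cont_all; auto; lra.
      * intros; split; apply Hpt; lra.
      * intros; split; apply Hpt; lra.
    + fold D. right. field.
Qed.

Lemma C_surj (z : C) : z = (Re z, Im z).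
Proof. destruct z; reflexivity. Qed.

(** Cutting at [px - del] and [px + del], then cutting the middle column at [py - del] and
    [py + del], leaves four outer rectangles without the exceptional point, to which Goursat's
    theorem applies. *)
Lemma RectInt_isolate (g : C -> C) (a b c d px py del : R) :
  0 < del -> a <= px - del -> px + del <= b -> c <= py - del -> py + del <= d ->
  (forall x y, a <= x <= b -> c <= y <= d -> (x <> px \/ y <> py) -> holo g (x, y)) ->
  RectInt g a b c d = RectInt g (px - del) (px + del) (py - del) (py + del).
Proof.
  intros Hd H1 H2 H3 H4 Hg.
  assert (Hc : forall x y, a <= x <= b -> c <= y <= d -> (x <> px \/ y <> py) -> Ccont g (x, y))
    by (intros; apply holo_cont, Hg; auto).
  assert (S : forall p q r s, a <= p -> p <= q -> q <= b -> c <= r -> r <= s -> s <= d ->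
     p <> px -> q <> px -> r <> py -> s <> py -> rect_sides g p q r s).
  { intros. apply rect_sides_cont; auto; intros; split; apply Hc; try lra; auto. }
  rewrite (RectInt_hsplit g a (px - del) b) by (apply S; lra).
  rewrite (RectInt_hsplit g (px - del) (px + del) b) by (apply S; lra).
  rewrite (RectInt_vsplit g (px - del) (px + del) c (py - del) d) by (apply S; lra).
  rewrite (RectInt_vsplit g (px - del) (px + del) (py - del) (py + del) d) by (apply S; lra).
  rewrite (goursat g a (px - del)), (goursat g (px + del) b),
    (goursat g (px - del) (px + del) c (py - del)), (goursat g (px - del) (px + del) (py + del) d);
    try lra; try (intros; apply Hg; lra).
  ring.
Qed.

Lemma Cinv_pair (x y : R) : x <> 0 \/ y <> 0 ->
  (/ (x, y))%C = (x / (x ^ 2 + y ^ 2), - y / (x ^ 2 + y ^ 2)).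
Proof. reflexivity. Qed.

Lemma pair_neq_0 (x y : R) : x <> 0 \/ y <> 0 -> (x, y) <> RtoC 0.
Proof. intros H E. injection E; intros. destruct H; auto. Qed.

Lemma is_derive_eq (f : R -> R) (x l l' : R) : is_derive f x l -> l = l' -> is_derive f x l'.
Proof. intros H E; rewrite <- E; exact H. Qed.

(** The primitive is a branch of the logarithm along a horizontal line that misses [0], with the
    angle written as [- atan ((x - m) / e)]. The end points have equal modulus, so only the angle
    remains. *)
Lemma CRInt_inv_line (m e del : R) : 0 < del -> e <> 0 ->
  is_CRInt (fun x => / ((x - m)%R, e))%C (m - del) (m + del) (0, - (2 * atan (del / e))).
Proof.
  intros Hd He.
  replace ((0, - (2 * atan (del / e))) : C) with
   (((ln (((m + del) - m) ^ 2 + e ^ 2) / 2)%R, (- atan ((m + del - m) / e))%R) -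
    ((ln (((m - del) - m) ^ 2 + e ^ 2) / 2)%R, (- atan ((m - del - m) / e))%R))%C.
  2:{ cbv [Cminus Cplus Copp fst snd].
      replace ((m - del - m) / e) with (- ((m + del - m) / e)) by (field; auto).
      rewrite atan_opp. replace ((m - del - m) ^ 2) with ((m + del - m) ^ 2) by ring.
      replace ((m + del - m) / e) with (del / e) by (field; auto). f_equal; ring. }
  apply (CRInt_derive (fun x => (ln ((x - m) ^ 2 + e ^ 2) / 2, - atan ((x - m) / e)))).
  - intros t Ht. rewrite Cinv_pair by auto.
    assert (0 < (t - m) ^ 2 + e ^ 2) by (pose proof (pow2_ge_0 (t - m)); pose proof (pow2_gt_0 e He); lra).
    apply Rderive_pair; (eapply is_derive_eq; [auto_derive; auto|]).
    + field. lra.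
    + field. split; auto. intros E. replace ((t - m) * (t - m) + e * e) with ((t - m) ^ 2 + e ^ 2) in E by ring. lra.
  - intros t Ht. apply (Rcont_comp Cinv).
    + apply holo_cont. eexists. apply Cderive_inv, pair_neq_0. auto.
    + apply Rderive_cont with (RtoC 1).
      apply Rderive_ext with (fun u => (Ci * e - m) + 1 * RtoC u)%C; [|apply Rderive_linear].
      intros u. rewrite C_re_im, RtoC_minus. ring.
Qed.

Lemma CRInt_is_ext (f g : R -> C) (a b : R) (l : C) :
  (forall t, f t = g t) -> is_CRInt f a b l -> is_CRInt g a b l.
Proof. intros H. apply (is_RInt_ext (V := C_R_CompleteNormedModule)). intros; apply H. Qed.

Lemma Cminus_pair (a b c d : R) : ((a, b) - (c, d))%C = ((a - c)%R, (b - d)%R).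
Proof. reflexivity. Qed.

Lemma RectInt_inv (px py del : R) : 0 < del ->
  RectInt (fun z => / (z - (px, py)))%C (px - del) (px + del) (py - del) (py + del) = (2 * Ci * PI)%C.
Proof.
  intros Hd. unfold RectInt.
  assert (E1 : - (2 * atan (del / - del)) = PI / 2).
  { replace (del / - del) with (- (1)) by (field; lra). rewrite atan_opp, atan_1. field. }
  assert (E2 : - (2 * atan (del / del)) = - (PI / 2)).
  { replace (del / del) with 1 by (field; lra). rewrite atan_1. field. }
  assert (B := CRInt_inv_line px (- del) del Hd ltac:(lra)).
  assert (T := CRInt_inv_line px del del Hd ltac:(lra)).
  assert (B' := CRInt_inv_line py (- del) del Hd ltac:(lra)).
  assert (T' := CRInt_inv_line py del del Hd ltac:(lra)).
  rewrite E1 in B, B'. rewrite E2 in T, T'.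
  rewrite (CRInt_unique _ _ _ (0, PI / 2)).
  2:{ eapply CRInt_is_ext; [|exact B]. intros t. cbv beta. rewrite Cminus_pair.
      replace (py - del - py) with (- del) by ring. replace (py + del - py) with del by ring. reflexivity. }
  rewrite (CRInt_unique _ _ _ (0, - (PI / 2))).
  2:{ eapply CRInt_is_ext; [|exact T]. intros t. cbv beta. rewrite Cminus_pair.
      replace (py - del - py) with (- del) by ring. replace (py + del - py) with del by ring. reflexivity. }
  (* Taking [i] out of [z - p] turns the vertical sides into horizontal lines at heights [- del] and
     [del], so the same angles reappear; every side contributes a quarter turn. *)
  rewrite (CRInt_unique _ (py - del) (py + del) ((- Ci) * (0, (PI / 2)%R))%C).
  2:{ eapply CRInt_is_ext; [|apply is_CRInt_scal, B']. intros t. cbv beta.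
      replace (((px + del)%R, t) - (px, py))%C with (Ci * ((t - py)%R, (- del)%R))%C
        by (unfold Ci, Cminus, Cplus, Copp, Cmult; simpl; f_equal; ring).
      assert (((t - py)%R, (- del)%R) <> RtoC 0) by (apply pair_neq_0; lra).
      rewrite <- Ci_inv. field. split; auto. apply Ci_nz. }
  rewrite (CRInt_unique _ (py - del) (py + del) ((- Ci) * (0, (- (PI / 2))%R))%C).
  2:{ eapply CRInt_is_ext; [|apply is_CRInt_scal, T']. intros t. cbv beta.
      replace (((px - del)%R, t) - (px, py))%C with (Ci * ((t - py)%R, del))%C
        by (unfold Ci, Cminus, Cplus, Copp, Cmult; simpl; f_equal; ring).
      assert (((t - py)%R, del) <> RtoC 0) by (apply pair_neq_0; lra).
      rewrite <- Ci_inv. field. split; auto. apply Ci_nz. }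
  unfold RtoC, Ci, Cminus, Cplus, Copp, Cmult; simpl. f_equal; field.
Qed.

Lemma holo_inv_sub (p z : C) : z <> p -> holo (fun w => / (w - p))%C z.
Proof.
  intros H. apply holo_inv; [apply Cminus_eq_contra; exact H|].
  apply holo_minus; [apply holo_id | apply holo_const].
Qed.

Lemma pair_neq (x y px py : R) : x <> px \/ y <> py -> ((x, y) : C) <> (px, py).
Proof. intros H E. injection E; intros. destruct H; auto. Qed.

Lemma Cmod_2PI : Cmod (2 * Ci * PI) = 2 * PI.
Proof.
  rewrite !Cmod_mult, Cmod_Ci, !Cmod_R. pose proof PI_RGT_0. rewrite !Rabs_pos_eq by lra. ring.
Qed.

Lemma C2PI_nz : (2 * Ci * PI)%C <> RtoC 0.
Proof. apply Cmod_gt_0. rewrite Cmod_2PI. pose proof PI_RGT_0. lra. Qed.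

(** After shrinking to a square of half-side [del] around the pole, [q z / (z - p)] splits into the
    difference quotient, bounded by [Cmod l + 1], and [q p / (z - p)], whose integral is explicit.
    The perimeter [8 del] makes the first part vanish. *)
Lemma cauchy_rect (q : C -> C) (a b c d px py : R) :
  a < px < b -> c < py < d ->
  (forall x y, a <= x <= b -> c <= y <= d -> holo q (x, y)) ->
  RectInt (fun z => q z / (z - (px, py)))%C a b c d = (2 * Ci * PI * q (px, py))%C.
Proof.
  intros Hx Hy Hq.
  set (p := (px, py) : C).
  destruct (Hq px py ltac:(lra) ltac:(lra)) as [l Hl]. fold p in Hl.
  rewrite Cderive_eps in Hl. destruct (Hl 1 Rlt_0_1) as [d0 [Hd0 H0]].
  apply (proj2 (Ceq_minus _ _)). apply Cmod_le_0.
  apply Rle_0_eps with (8 * (Cmod l + 1)); [pose proof (Cmod_ge_0 l); lra|].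
  intros eps He.
  (* With [del <= d0 / 4] the small square lies inside the disc where the derivative estimate holds;
     the other bounds keep it inside the rectangle. *)
  destruct (pos_min3 eps (d0 / 4) (px - a) He ltac:(lra) ltac:(lra)) as (t & Ht & T1 & T2 & T3).
  destruct (pos_min3 (b - px) (py - c) (d - py) ltac:(lra) ltac:(lra) ltac:(lra)) as (u & Hu & U1 & U2 & U3).
  destruct (pos_min2 t u Ht Hu) as (del & Hdel & D1 & D2).
  assert (Hh : forall x y, a <= x <= b -> c <= y <= d -> (x <> px \/ y <> py) -> holo (fun z => q z / (z - p))%C (x, y)).
  { intros x y Hx1 Hy1 Hn. apply holo_mult; [apply Hq; auto|]. apply holo_inv_sub, pair_neq, Hn. }
  rewrite (RectInt_isolate _ a b c d px py del); try lra; try assumption.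
  assert (S1 : rect_sides (fun z => (q z - q p) / (z - p))%C (px - del) (px + del) (py - del) (py + del)).
  { apply rect_sides_cont; try lra; intros; split; (apply holo_cont, holo_mult;
     [apply holo_minus; [apply Hq; lra | apply holo_const] | apply holo_inv_sub, pair_neq; lra]). }
  assert (S2 : rect_sides (fun z => / (z - p))%C (px - del) (px + del) (py - del) (py + del)).
  { apply rect_sides_cont; try lra; intros; split; (apply holo_cont, holo_inv_sub, pair_neq; lra). }
  assert (S3 : rect_sides (fun z => q p * / (z - p))%C (px - del) (px + del) (py - del) (py + del)).
  { apply rect_sides_cont; try lra; intros; split; (apply holo_cont, holo_mult;
     [apply holo_const | apply holo_inv_sub, pair_neq; lra]). }
  rewrite (RectInt_ext _ (fun z => (q z - q p) / (z - p) + q p * / (z - p))%C); try lra.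
  2,3: intros; split; unfold Cdiv; ring.
  rewrite RectInt_plus by assumption. rewrite RectInt_scal by assumption.
  unfold p at 4. rewrite RectInt_inv by assumption. fold p.
  replace (_ - _)%C with (RectInt (fun z => (q z - q p) / (z - p))%C (px - del) (px + del) (py - del) (py + del)) by ring.
  assert (Bd : forall x y, px - del <= x <= px + del -> py - del <= y <= py + del -> (x <> px \/ y <> py) ->
     Cmod ((q (x, y) - q p) / ((x, y) - p)) <= Cmod l + 1).
  { intros x y Hx1 Hy1 Hn.
    assert (Hnp : ((x, y) - p)%C <> RtoC 0) by (apply Cminus_eq_contra, pair_neq, Hn).
    rewrite Cmod_div by exact Hnp.
    assert (Hm : 0 < Cmod ((x, y) - p)) by (apply Cmod_gt_0; exact Hnp).
    apply Rmult_le_reg_r with (Cmod ((x, y) - p)); [exact Hm|].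
    unfold Rdiv. rewrite Rmult_assoc, Rinv_l, Rmult_1_r by (apply Rgt_not_eq; exact Hm).
    replace (q (x, y) - q p)%C with ((q (x, y) - q p - l * ((x, y) - p)) + l * ((x, y) - p))%C by ring.
    eapply Rle_trans; [apply Cmod_triangle|]. rewrite Cmod_mult.
    assert (B : Cmod ((x, y) - p) < d0).
    { eapply Rle_lt_trans; [apply Cmod_le_abs|].
      change (Rabs (x - px) + Rabs (y - py) < d0).
      assert (Rabs (x - px) <= del) by (apply Rabs_le; lra).
      assert (Rabs (y - py) <= del) by (apply Rabs_le; lra). lra. }
    specialize (H0 _ B). rewrite Rmult_1_l in H0.
    rewrite Rmult_plus_distr_r, Rmult_1_l, Rplus_comm. apply Rplus_le_compat_l. exact H0. }
  eapply Rle_trans.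
  - apply (RectInt_bound _ _ _ _ _ (Cmod l + 1)); try lra; try assumption;
      intros; split; apply Bd; lra.
  - pose proof (Cmod_ge_0 l). nra.
Qed.

(** * Taylor expansions on squares *)

Fixpoint Csum (u : nat -> C) (n : nat) : C :=
  match n with O => RtoC 0 | S m => (Csum u m + u m)%C end.

(** Squares stand in for discs, since Cauchy's formula is established on rectangles. *)
Definition in_square (z0 : C) (r : R) (z : C) : Prop :=
  Re z0 - r <= Re z <= Re z0 + r /\ Im z0 - r <= Im z <= Im z0 + r.

Lemma disc_in_square (z0 z : C) (r : R) : Cmod (z - z0) <= r -> in_square z0 r z.
Proof.
  intros H. pose proof (re_le_Cmod (z - z0)) as H1. pose proof (im_le_Cmod (z - z0)) as H2.
  unfold Cminus in H1, H2. rewrite re_plus, re_opp in H1. rewrite im_plus, im_opp in H2.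
  unfold Cminus in H. assert (A := Rle_trans _ _ _ H1 H). assert (B := Rle_trans _ _ _ H2 H).
  apply Rabs_le_between in A. apply Rabs_le_between in B.
  split; lra.
Qed.

Definition SqInt (g : C -> C) (z0 : C) (r : R) : C :=
  RectInt g (Re z0 - r) (Re z0 + r) (Im z0 - r) (Im z0 + r).

(** A set larger than the boundary: the square without the open inscribed disc. The estimates on the
    sides need only membership in the square and the distance [r] from the centre. *)
Definition sq_boundary (z0 : C) (r : R) (z : C) : Prop :=
  in_square z0 r z /\ r <= Cmod (z - z0).

Lemma square_sides (z0 : C) (r : R) (P : C -> Prop) : 0 < r ->
  (forall z, sq_boundary z0 r z -> P z) ->
  (forall x, Re z0 - r <= x <= Re z0 + r -> P (x, (Im z0 - r)%R) /\ P (x, (Im z0 + r)%R)) /\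
  (forall y, Im z0 - r <= y <= Im z0 + r -> P ((Re z0 - r)%R, y) /\ P ((Re z0 + r)%R, y)).
Proof.
  intros Hr H.
  assert (B : forall x y, Re z0 - r <= x <= Re z0 + r -> Im z0 - r <= y <= Im z0 + r ->
    (Rabs (x - Re z0) = r \/ Rabs (y - Im z0) = r) -> sq_boundary z0 r (x, y)).
  { intros x y Hx Hy Hb. split; [split; assumption|]. destruct Hb as [Hb|Hb].
    - rewrite <- Hb at 1. exact (re_le_Cmod ((x, y) - z0)).
    - rewrite <- Hb at 1. exact (im_le_Cmod ((x, y) - z0)). }
  split; intros t Ht; split; apply H, B; try lra.
  - right. rewrite Rabs_left; lra.
  - right. rewrite Rabs_pos_eq; lra.
  - left. rewrite Rabs_left; lra.
  - left. rewrite Rabs_pos_eq; lra.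
Qed.

Lemma square_rect_sides (g : C -> C) (z0 : C) (r : R) : 0 < r ->
  (forall z, sq_boundary z0 r z -> Ccont g z) ->
  rect_sides g (Re z0 - r) (Re z0 + r) (Im z0 - r) (Im z0 + r).
Proof.
  intros Hr H. destruct (square_sides z0 r _ Hr H) as [H1 H2].
  apply rect_sides_cont; try lra; auto.
Qed.

Lemma SqInt_bound (g : C -> C) (z0 : C) (r M : R) : 0 < r ->
  (forall z, sq_boundary z0 r z -> Ccont g z) ->
  (forall z, sq_boundary z0 r z -> Cmod (g z) <= M) ->
  Cmod (SqInt g z0 r) <= 8 * r * M.
Proof.
  intros Hr Hc H. destruct (square_sides z0 r _ Hr H) as [H1 H2].
  replace (8 * r * M) with (2 * ((Re z0 + r - (Re z0 - r)) + (Im z0 + r - (Im z0 - r))) * M) by ring.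
  unfold SqInt. apply RectInt_bound; try lra; auto. apply square_rect_sides; auto.
Qed.

Lemma SqInt_plus (f g : C -> C) (z0 : C) (r : R) : 0 < r ->
  (forall z, sq_boundary z0 r z -> Ccont f z) -> (forall z, sq_boundary z0 r z -> Ccont g z) ->
  SqInt (fun z => f z + g z)%C z0 r = (SqInt f z0 r + SqInt g z0 r)%C.
Proof. intros Hr Hf Hg. unfold SqInt. apply (RectInt_plus f g); apply square_rect_sides; auto. Qed.

Lemma SqInt_scal (f : C -> C) (k : C) (z0 : C) (r : R) : 0 < r ->
  (forall z, sq_boundary z0 r z -> Ccont f z) ->
  SqInt (fun z => k * f z)%C z0 r = (k * SqInt f z0 r)%C.
Proof. intros Hr Hf. unfold SqInt. apply (RectInt_scal f k); apply square_rect_sides; auto. Qed.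

Lemma SqInt_ext (f g : C -> C) (z0 : C) (r : R) : 0 < r ->
  (forall z, sq_boundary z0 r z -> f z = g z) -> SqInt f z0 r = SqInt g z0 r.
Proof.
  intros Hr H. destruct (square_sides z0 r _ Hr H) as [H1 H2]. unfold SqInt. apply (RectInt_ext f g); auto; lra.
Qed.

Lemma cauchy_square (q : C -> C) (z0 w : C) (r : R) : Cmod (w - z0) < r ->
  (forall z, in_square z0 r z -> holo q z) ->
  SqInt (fun z => q z / (z - w))%C z0 r = (2 * Ci * PI * q w)%C.
Proof.
  intros Hw Hq. unfold SqInt. rewrite (C_surj w).
  assert (in_square z0 ((Cmod (w - z0) + r) / 2) w) as [H1 H2] by (apply disc_in_square; lra).
  apply cauchy_rect; try lra. intros x y Hx Hy. apply Hq. split; assumption.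
Qed.

(* The n-th remainder is the Cauchy integral of q(z) (w - z0)^n / ((z - w) (z - z0)^n). *)
Lemma taylor_square (q : C -> C) (z0 : C) (r M : R) : 0 < r ->
  (forall z, in_square z0 r z -> holo q z) ->
  (forall z, in_square z0 r z -> Cmod (q z) <= M) ->
  exists c : nat -> C, (forall k, Cmod (c k) <= 2 * M / r ^ k) /\
    forall n w, Cmod (w - z0) <= r / 2 ->
      Cmod (q w - Csum (fun k => c k * (w - z0) ^ k)%C n) <= 3 * M * (Cmod (w - z0) / r) ^ n.
Proof.
  intros Hr Hq HM.
  assert (HM0 : 0 <= M).
  { eapply Rle_trans; [apply Cmod_ge_0|]. apply (HM z0). split; lra. }
  (* The constants rest on [3 < PI]: after division by [2 PI], the factor [8] becomes at most [2] in
     the coefficients and [16] at most [3] in the remainder. *)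
  assert (P2 := PI2_3_2). pose proof C2PI_nz as Hpi.
  assert (Bz : forall z, sq_boundary z0 r z -> (z - z0)%C <> RtoC 0).
  { intros z [_ Hz]. apply Cmod_gt_0. lra. }
  assert (Bw : forall w z, Cmod (w - z0) <= r / 2 -> sq_boundary z0 r z -> r / 2 <= Cmod (z - w)).
  { intros w z Hw [_ Hz]. pose proof (Cmod_triangle_inv (z - z0) (w - z0)) as H.
    replace (z - z0 - (w - z0))%C with (z - w)%C in H by ring. lra. }
  assert (Bw0 : forall w z, Cmod (w - z0) <= r / 2 -> sq_boundary z0 r z -> (z - w)%C <> RtoC 0).
  { intros w z Hw Hz. apply Cmod_gt_0. pose proof (Bw w z Hw Hz). lra. }
  assert (Cz : forall n z, sq_boundary z0 r z -> holo (fun z => q z / (z - z0) ^ n)%C z).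
  { intros n z Hz. apply holo_div; [apply Cpow_nz, Bz, Hz | apply Hq, Hz|].
    apply holo_pow, holo_minus; [apply holo_id | apply holo_const]. }
  assert (Cw : forall n w z, Cmod (w - z0) <= r / 2 -> sq_boundary z0 r z ->
     holo (fun z => q z / ((z - w) * (z - z0) ^ n))%C z).
  { intros n w z Hw Hz. apply holo_div; [apply Cmult_neq_0; [apply Bw0; auto | apply Cpow_nz, Bz, Hz] | apply Hq, Hz|].
    apply holo_mult; [apply holo_minus; [apply holo_id | apply holo_const]|].
    apply holo_pow, holo_minus; [apply holo_id | apply holo_const]. }
  assert (Rn : forall n z, sq_boundary z0 r z -> r ^ n <= Cmod ((z - z0) ^ n)).
  { intros n z [_ Hz]. rewrite Cmod_pow. apply pow_incr. lra. }
  assert (Rp : forall n, 0 < r ^ n) by (intros; apply pow_lt; auto).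
  pose (c := fun k => (SqInt (fun z => q z / (z - z0) ^ S k) z0 r / (2 * Ci * PI))%C).
  exists c. split.
  - intros k. unfold c. rewrite Cmod_div by exact Hpi. rewrite Cmod_2PI.
    assert (B : Cmod (SqInt (fun z => q z / (z - z0) ^ S k)%C z0 r) <= 8 * r * (M / r ^ S k)).
    { apply SqInt_bound; auto.
      - intros z Hz. apply holo_cont, Cz, Hz.
      - intros z Hz. rewrite Cmod_div by (apply Cpow_nz, Bz, Hz).
        apply Rmult_le_compat; try apply Cmod_ge_0.
        + apply Rlt_le, Rinv_0_lt_compat. eapply Rlt_le_trans; [apply Rp|apply Rn; exact Hz].
        + apply HM, Hz.
        + apply Rinv_le_contravar; [apply Rp | apply Rn; exact Hz]. }
    replace (8 * r * (M / r ^ S k)) with (4 * (2 * M / r ^ k)) in B by (simpl; field; split; [apply Rgt_not_eq, Rp|lra]).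
    assert (0 <= 2 * M / r ^ k) by (apply Rdiv_le_0_compat; [lra|apply Rp]).
    apply Rmult_le_reg_r with (2 * PI); [lra|].
    unfold Rdiv at 1. rewrite Rmult_assoc, Rinv_l, Rmult_1_r by lra. nra.
  - intros n w Hw.
    assert (E : (q w - Csum (fun k => c k * (w - z0) ^ k)%C n)%C
       = ((w - z0) ^ n / (2 * Ci * PI) * SqInt (fun z => q z / ((z - w) * (z - z0) ^ n)) z0 r)%C).
    { induction n as [|n IH].
      - simpl Csum. rewrite (SqInt_ext _ (fun z => q z / (z - w))%C); auto.
        + rewrite cauchy_square by (auto; lra). simpl. field. repeat split; auto.
          * intros Q; apply RtoC_inj in Q; lra.
          * apply Ci_nz.
        + intros z Hz. simpl. f_equal. ring.
      - change (Csum (fun k => c k * (w - z0) ^ k)%C (S n))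
          with (Csum (fun k => c k * (w - z0) ^ k)%C n + c n * (w - z0) ^ n)%C.
        replace (q w - (Csum (fun k => c k * (w - z0) ^ k)%C n + c n * (w - z0) ^ n))%C
         with (q w - Csum (fun k => c k * (w - z0) ^ k)%C n - c n * (w - z0) ^ n)%C by ring.
        rewrite IH.
        (* From [1 / (z - w) = 1 / (z - z0) + (w - z0) / ((z - w) (z - z0))]: the first summand
           gives the next Taylor term and the second the next remainder. *)
        rewrite (SqInt_ext (fun z => q z / ((z - w) * (z - z0) ^ n))%C
           (fun z => q z / (z - z0) ^ S n + (w - z0) * (q z / ((z - w) * (z - z0) ^ S n)))%C); auto.
        2:{ intros z Hz. rewrite Cpow_S. pose proof (Bz z Hz). pose proof (Bw0 w z Hw Hz).
            field. repeat split; auto; apply Cpow_nz; auto. }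
        rewrite SqInt_plus; auto.
        2:{ intros z Hz; apply holo_cont, Cz, Hz. }
        2:{ intros z Hz; apply holo_cont, holo_mult; [apply holo_const|apply Cw; auto]. }
        rewrite SqInt_scal; auto.
        2:{ intros z Hz; apply holo_cont; apply Cw; auto. }
        unfold c. rewrite (Cpow_S (w - z0) n). unfold Cdiv. ring. }
    rewrite E, Cmod_mult, Cmod_div, Cmod_2PI, Cmod_pow by exact Hpi.
    assert (B : Cmod (SqInt (fun z => q z / ((z - w) * (z - z0) ^ n))%C z0 r) <= 8 * r * (M / (r / 2 * r ^ n))).
    { apply SqInt_bound; auto.
      - intros z Hz. apply holo_cont, Cw; auto.
      - intros z Hz. rewrite Cmod_div by (apply Cmult_neq_0; [apply Bw0; auto|apply Cpow_nz, Bz, Hz]).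
        assert (Bd : r / 2 * r ^ n <= Cmod ((z - w) * (z - z0) ^ n)).
        { rewrite Cmod_mult. apply Rmult_le_compat; [lra|apply Rlt_le, Rp|apply Bw; auto|apply Rn; auto]. }
        assert (0 < r / 2 * r ^ n) by (apply Rmult_lt_0_compat; [lra|apply Rp]).
        apply Rmult_le_compat; try apply Cmod_ge_0.
        + apply Rlt_le, Rinv_0_lt_compat. lra.
        + apply HM, Hz.
        + apply Rinv_le_contravar; lra. }
    replace (8 * r * (M / (r / 2 * r ^ n))) with (16 * M / r ^ n) in B by (field; split; [apply Rgt_not_eq, Rp|lra]).
    unfold Rdiv at 2. rewrite Rpow_mult_distr. rewrite pow_inv.
    assert (0 <= Cmod (w - z0) ^ n) by (apply pow_le, Cmod_ge_0).
    replace (Cmod (w - z0) ^ n / (2 * PI) * Cmod (SqInt (fun z => q z / ((z - w) * (z - z0) ^ n))%C z0 r))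
      with (Cmod (w - z0) ^ n * (Cmod (SqInt (fun z => q z / ((z - w) * (z - z0) ^ n))%C z0 r) / (2 * PI))) by (field; lra).
    replace (3 * M * (Cmod (w - z0) ^ n * / r ^ n)) with (Cmod (w - z0) ^ n * (3 * (M / r ^ n))) by (unfold Rdiv; ring).
    apply Rmult_le_compat_l; [assumption|].
    assert (0 <= M / r ^ n) by (apply Rdiv_le_0_compat; [lra|apply Rp]).
    apply Rmult_le_reg_r with (2 * PI); [lra|].
    unfold Rdiv at 1. rewrite Rmult_assoc, Rinv_l, Rmult_1_r by lra.
    eapply Rle_trans; [apply B|]. replace (16 * M / r ^ n) with (16 * (M / r ^ n)) by (unfold Rdiv; ring). nra.
Qed.

(** The two orders in use: the quadratic remainder for derivatives of limits and integrals, the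
    cubic one for the derivative of a difference quotient at its centre. *)
Lemma taylor_square_2 (q : C -> C) (z0 : C) (r M : R) : 0 < r ->
  (forall z, in_square z0 r z -> holo q z) ->
  (forall z, in_square z0 r z -> Cmod (q z) <= M) ->
  exists c : nat -> C, q z0 = c O /\ Cderive q z0 (c 1%nat) /\
    (forall w, Cmod (w - z0) <= r / 2 ->
      Cmod (q w - q z0 - c 1%nat * (w - z0)) <= 3 * M / r ^ 2 * Cmod (w - z0) ^ 2) /\
    (forall w, Cmod (w - z0) <= r / 2 ->
      Cmod (q w - q z0 - c 1%nat * (w - z0) - c 2%nat * (w - z0) ^ 2) <= 3 * M / r ^ 3 * Cmod (w - z0) ^ 3).
Proof.
  intros Hr Hq HM. destruct (taylor_square q z0 r M Hr Hq HM) as [c [_ H]]. exists c.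
  assert (HM0 : 0 <= M) by (eapply Rle_trans; [apply Cmod_ge_0|]; apply (HM z0); split; lra).
  assert (E0 : q z0 = c O).
  { pose proof (H 1%nat z0) as H0. replace (z0 - z0)%C with (RtoC 0) in H0 by ring.
    rewrite Cmod_0 in H0. specialize (H0 ltac:(lra)). simpl Csum in H0.
    replace (3 * M * (0 / r) ^ 1) with 0 in H0 by (field; lra). apply Cmod_le_0 in H0.
    replace (q z0) with ((q z0 - (0 + c O * 1)) + c O)%C by ring. rewrite H0. ring. }
  assert (H2 : forall w, Cmod (w - z0) <= r / 2 ->
      Cmod (q w - q z0 - c 1%nat * (w - z0)) <= 3 * M / r ^ 2 * Cmod (w - z0) ^ 2).
  { intros w Hw. replace (q w - q z0 - c 1%nat * (w - z0))%C with
      (q w - Csum (fun k => c k * (w - z0) ^ k)%C 2)%C by (rewrite E0; simpl; ring).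
    eapply Rle_trans; [apply H, Hw|]. right. field. lra. }
  split; [exact E0|split; [|split; [exact H2|]]].
  - apply Cderive_quadratic with (3 * M / r ^ 2) (r / 2); [|lra|exact H2].
    apply Rdiv_le_0_compat; [lra|apply pow_lt; auto].
  - intros w Hw. replace (q w - q z0 - c 1%nat * (w - z0) - c 2%nat * (w - z0) ^ 2)%C with
      (q w - Csum (fun k => c k * (w - z0) ^ k)%C 3)%C by (rewrite E0; simpl; ring).
    eapply Rle_trans; [apply H, Hw|]. right. field. lra.
Qed.

(** * Limits of holomorphic functions and the identity theorem *)

Lemma square_in_disc (z0 z : C) (r : R) : in_square z0 r z -> Cmod (z - z0) <= 2 * r.
Proof.
  intros [H1 H2]. eapply Rle_trans; [apply Cmod_le_abs|].
  assert (A : Rabs (Re z - Re z0) <= r) by (apply Rabs_le; lra).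
  assert (B : Rabs (Im z - Im z0) <= r) by (apply Rabs_le; lra).
  change (Rabs (Re z - Re z0) + Rabs (Im z - Im z0) <= 2 * r). lra.
Qed.

(** Compactness by bisection: bounds on the quarters combine to a bound on the whole, and continuity
    bounds [g] near each point. *)
Lemma square_bounded (g : C -> C) (z0 : C) (r : R) : 0 <= r ->
  (forall z, in_square z0 r z -> Ccont g z) ->
  exists M, forall z, in_square z0 r z -> Cmod (g z) <= M.
Proof.
  intros Hr H.
  set (P := fun a b c d : R => exists M, forall x y, a <= x <= b -> c <= y <= d ->
    in_square z0 r (x, y) -> Cmod (g (x, y)) <= M).
  enough (HP : P (Re z0 - r) (Re z0 + r) (Im z0 - r) (Im z0 + r)).
  { destruct HP as [M HM]. exists M. intros z Hz. rewrite (C_surj z) in *. apply HM; auto; apply Hz. }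
  apply rect_bisection; try lra.
  - intros a b c d Hab Hcd [M1 H1] [M2 H2] [M3 H3] [M4 H4].
    exists (Rmax (Rmax M1 M2) (Rmax M3 M4)). intros x y Hx Hy Hs.
    pose proof (Rmax_l (Rmax M1 M2) (Rmax M3 M4)). pose proof (Rmax_r (Rmax M1 M2) (Rmax M3 M4)).
    pose proof (Rmax_l M1 M2). pose proof (Rmax_r M1 M2). pose proof (Rmax_l M3 M4). pose proof (Rmax_r M3 M4).
    destruct (Rle_dec x ((a + b) / 2)); destruct (Rle_dec y ((c + d) / 2)).
    + specialize (H1 x y ltac:(lra) ltac:(lra) Hs). lra.
    + specialize (H3 x y ltac:(lra) ltac:(lra) Hs). lra.
    + specialize (H2 x y ltac:(lra) ltac:(lra) Hs). lra.
    + specialize (H4 x y ltac:(lra) ltac:(lra) Hs). lra.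
  - intros x y Hx Hy. destruct (H (x, y) (conj Hx Hy) 1 Rlt_0_1) as [del [Hd Hc]].
    exists (del / 2). split; [lra|]. intros a b c d Hx1 Hy1 Hba Hdc.
    exists (Cmod (g (x, y)) + 1). intros x' y' Hx' Hy' _.
    assert (B : Cmod ((x', y') - (x, y)) < del).
    { eapply Rle_lt_trans; [apply Cmod_le_abs|]. change (Rabs (x' - x) + Rabs (y' - y) < del).
      assert (Rabs (x' - x) <= b - a) by (apply Rabs_le; lra).
      assert (Rabs (y' - y) <= d - c) by (apply Rabs_le; lra). lra. }
    specialize (Hc _ B).
    pose proof (Cmod_triangle_inv (g (x', y')) (g (x, y))). lra.
Qed.

(** * Limits of complex sequences and series *)

Definition Clim (u : nat -> C) (l : C) : Prop :=
  forall eps, 0 < eps -> exists N, forall n, (N <= n)%nat -> Cmod (u n - l) < eps.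

Lemma Clim_cauchy (u : nat -> C) :
  (forall eps, 0 < eps -> exists N, forall n m, (N <= n)%nat -> (N <= m)%nat -> Cmod (u n - u m) < eps) ->
  exists l, Clim u l.
Proof.
  intros H.
  assert (A : forall p : C -> R, (forall a b, Rabs (p a - p b) <= Cmod (a - b)) ->
     exists l : R, is_lim_seq (fun n => p (u n)) l).
  { intros p Hp. destruct (proj2 (ex_lim_seq_cauchy_corr (fun n => p (u n)))) as [l Hl].
    - intros eps. destruct (H eps (cond_pos eps)) as [N HN]. exists N. intros n m Hn Hm.
      eapply Rle_lt_trans; [apply Hp|]. apply HN; auto.
    - exists l; exact Hl. }
  destruct (A Re) as [x Hx].
  { intros a b. exact (re_le_Cmod (a - b)). }
  destruct (A Im) as [y Hy].
  { intros a b. exact (im_le_Cmod (a - b)). }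
  exists (x, y). intros eps He.
  apply is_lim_seq_spec in Hx. apply is_lim_seq_spec in Hy.
  assert (He2 : 0 < eps / 2) by lra.
  destruct (Hx (mkposreal _ He2)) as [N1 H1]. destruct (Hy (mkposreal _ He2)) as [N2 H2].
  exists (max N1 N2). intros n Hn.
  specialize (H1 n ltac:(lia)). specialize (H2 n ltac:(lia)). simpl in H1, H2.
  eapply Rle_lt_trans; [apply Cmod_le_abs|].
  change (Rabs (Re (u n) - x) + Rabs (Im (u n) - y) < eps). lra.
Qed.

Lemma Clim_re (u : nat -> C) (l : C) : Clim u l -> is_lim_seq (fun n => Re (u n)) (Re l).
Proof.
  intros H. apply is_lim_seq_spec. intros eps. destruct (H eps (cond_pos eps)) as [N HN].
  exists N. intros n Hn. eapply Rle_lt_trans; [|apply (HN n Hn)]. exact (re_le_Cmod (u n - l)).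
Qed.

Lemma Clim_im (u : nat -> C) (l : C) : Clim u l -> is_lim_seq (fun n => Im (u n)) (Im l).
Proof.
  intros H. apply is_lim_seq_spec. intros eps. destruct (H eps (cond_pos eps)) as [N HN].
  exists N. intros n Hn. eapply Rle_lt_trans; [|apply (HN n Hn)]. exact (im_le_Cmod (u n - l)).
Qed.

Lemma CLim_seq_unique (u : nat -> C) (l : C) : Clim u l -> CLim_seq u = l.
Proof.
  intros H. unfold CLim_seq.
  rewrite (is_lim_seq_unique _ _ (Clim_re u l H)), (is_lim_seq_unique _ _ (Clim_im u l H)).
  symmetry; apply C_surj.
Qed.

Lemma Csum_re (a : nat -> C) (n : nat) : Re (Csum a (S n)) = sum_n (fun k => Re (a k)) n.
Proof.
  induction n as [|n IH].
  - rewrite sum_O. change (Csum a 1) with (0 + a O)%C. rewrite re_plus, re_RtoC. ring.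
  - change (Csum a (S (S n))) with (Csum a (S n) + a (S n))%C.
    rewrite sum_Sn, re_plus, IH. reflexivity.
Qed.

Lemma Csum_im (a : nat -> C) (n : nat) : Im (Csum a (S n)) = sum_n (fun k => Im (a k)) n.
Proof.
  induction n as [|n IH].
  - rewrite sum_O. change (Csum a 1) with (0 + a O)%C. rewrite im_plus, im_RtoC. ring.
  - change (Csum a (S (S n))) with (Csum a (S n) + a (S n))%C.
    rewrite sum_Sn, im_plus, IH. reflexivity.
Qed.

Definition is_Cseries (a : nat -> C) (l : C) : Prop := Clim (Csum a) l.

Lemma Clim_incr (u : nat -> C) (l : C) : Clim u l -> Clim (fun n => u (S n)) l.
Proof. intros H eps He. destruct (H eps He) as [N HN]. exists N. intros n Hn. apply HN. lia. Qed.

Lemma CSeries_unique (a : nat -> C) (l : C) : is_Cseries a l -> CSeries a = l.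
Proof.
  intros H. apply Clim_incr in H. unfold CSeries.
  rewrite (is_series_unique (fun n => Re (a n)) (Re l)).
  - rewrite (is_series_unique (fun n => Im (a n)) (Im l)).
    + symmetry; apply C_surj.
    + apply is_lim_seq_ext with (2 := Clim_im _ _ H). intros n. apply Csum_im.
  - apply is_lim_seq_ext with (2 := Clim_re _ _ H). intros n. apply Csum_re.
Qed.

Lemma Clim_unique (u : nat -> C) (l l' : C) : Clim u l -> Clim u l' -> l = l'.
Proof. intros H H'. rewrite <- (CLim_seq_unique u l H). apply CLim_seq_unique. exact H'. Qed.

Lemma Clim_ext (u v : nat -> C) (l : C) : (forall n, u n = v n) -> Clim u l -> Clim v l.
Proof. intros E H eps He. destruct (H eps He) as [N HN]. exists N. intros n Hn. rewrite <- E. auto. Qed.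

Lemma Clim_const (a : C) : Clim (fun _ => a) a.
Proof. intros eps He. exists O. intros n _. replace (a - a)%C with (RtoC 0) by ring. rewrite Cmod_0. exact He. Qed.

Lemma Clim_plus (u v : nat -> C) (a b : C) : Clim u a -> Clim v b -> Clim (fun n => u n + v n)%C (a + b)%C.
Proof.
  intros Hu Hv eps He. destruct (Hu (eps / 2) ltac:(lra)) as [N1 H1]. destruct (Hv (eps / 2) ltac:(lra)) as [N2 H2].
  exists (max N1 N2). intros n Hn. specialize (H1 n ltac:(lia)). specialize (H2 n ltac:(lia)).
  replace (u n + v n - (a + b))%C with ((u n - a) + (v n - b))%C by ring.
  eapply Rle_lt_trans; [apply Cmod_triangle|]. lra.
Qed.

Lemma Clim_comp (g : C -> C) (u : nat -> C) (a : C) : Ccont g a -> Clim u a -> Clim (fun n => g (u n)) (g a).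
Proof.
  intros Hg Hu eps He. destruct (Hg eps He) as [d [Hd H]]. destruct (Hu d Hd) as [N HN].
  exists N. intros n Hn. apply H, HN, Hn.
Qed.

Lemma Clim_scal (k : C) (u : nat -> C) (a : C) : Clim u a -> Clim (fun n => k * u n)%C (k * a)%C.
Proof.
  apply (Clim_comp (fun w => k * w)%C). apply holo_cont, holo_mult; [apply holo_const|apply holo_id].
Qed.

Lemma Clim_minus (u v : nat -> C) (a b : C) : Clim u a -> Clim v b -> Clim (fun n => u n - v n)%C (a - b)%C.
Proof.
  intros Hu Hv. apply Clim_ext with (fun n => u n + (- (1)) * v n)%C; [intros; ring|].
  replace (a - b)%C with (a + (-(1)) * b)%C by ring. apply Clim_plus; [exact Hu|]. apply Clim_scal, Hv.
Qed.

Lemma Clim_bounded (u : nat -> C) (l : C) : Clim u l -> exists M, 0 <= M /\ forall n, Cmod (u n) <= M.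
Proof.
  intros H. destruct (H 1 Rlt_0_1) as [N HN].
  assert (A : forall k, exists M, 0 <= M /\ forall n, (n < k)%nat -> Cmod (u n) <= M).
  { induction k as [|k [M [HM0 HM]]]; [exists 0; split; [lra|]; intros; lia|].
    exists (Rmax M (Cmod (u k))). split; [eapply Rle_trans; [apply HM0|apply Rmax_l]|].
    intros n Hn. destruct (Nat.eq_dec n k) as [->|]; [apply Rmax_r|].
    eapply Rle_trans; [apply HM; lia|apply Rmax_l]. }
  destruct (A N) as [M [HM0 HM]]. exists (Rmax M (Cmod l + 1)).
  split; [eapply Rle_trans; [apply HM0|apply Rmax_l]|].
  intros n. destruct (Compare_dec.le_lt_dec N n) as [Hn|Hn].
  - eapply Rle_trans; [|apply Rmax_r]. specialize (HN n Hn). pose proof (Cmod_triangle_inv (u n) l). lra.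
  - eapply Rle_trans; [|apply Rmax_l]. apply HM; auto.
Qed.

Lemma Clim_mult (u v : nat -> C) (a b : C) : Clim u a -> Clim v b -> Clim (fun n => u n * v n)%C (a * b)%C.
Proof.
  intros Hu Hv. destruct (Clim_bounded v b Hv) as [M [HM0 HM]].
  intros eps He. pose proof (Cmod_ge_0 a) as Pa.
  destruct (Hu (eps / (2 * (M + 1)))) as [N1 H1]; [apply Rdiv_lt_0_compat; lra|].
  destruct (Hv (eps / (2 * (Cmod a + 1)))) as [N2 H2]; [apply Rdiv_lt_0_compat; lra|].
  exists (max N1 N2). intros n Hn. specialize (H1 n ltac:(lia)). specialize (H2 n ltac:(lia)). specialize (HM n).
  replace (u n * v n - a * b)%C with ((u n - a) * v n + a * (v n - b))%C by ring.
  eapply Rle_lt_trans; [apply Cmod_triangle|]. rewrite !Cmod_mult.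
  assert (X1 : Cmod (u n - a) * (M + 1) < eps / 2).
  { apply Rmult_lt_reg_r with (/ (M + 1)); [apply Rinv_0_lt_compat; lra|].
    rewrite Rmult_assoc, Rinv_r, Rmult_1_r by lra.
    replace (eps / 2 * / (M + 1)) with (eps / (2 * (M + 1))) by (field; lra). exact H1. }
  assert (X2 : (Cmod a + 1) * Cmod (v n - b) < eps / 2).
  { rewrite Rmult_comm. apply Rmult_lt_reg_r with (/ (Cmod a + 1)); [apply Rinv_0_lt_compat; lra|].
    rewrite Rmult_assoc, Rinv_r, Rmult_1_r by lra.
    replace (eps / 2 * / (Cmod a + 1)) with (eps / (2 * (Cmod a + 1))) by (field; lra). exact H2. }
  pose proof (Cmod_ge_0 (u n - a)). pose proof (Cmod_ge_0 (v n - b)). nra.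
Qed.

Lemma Clim_le (u : nat -> C) (l : C) (M : R) : Clim u l -> (forall n, Cmod (u n) <= M) -> Cmod l <= M.
Proof.
  intros H HM. apply Rle_plus_epsilon. intros eps He. destruct (H eps He) as [N HN].
  specialize (HN N (le_n _)). rewrite Cmod_minus_sym in HN.
  pose proof (Cmod_triangle_inv l (u N)). specialize (HM N). lra.
Qed.

(* The second-order Taylor remainder is bounded uniformly in the sequence. *)
Lemma holo_Clim (g : nat -> C -> C) (f : C -> C) (z0 : C) (r M : R) : 0 < r ->
  (forall n z, in_square z0 r z -> holo (g n) z) ->
  (forall n z, in_square z0 r z -> Cmod (g n z) <= M) ->
  (forall z, in_square z0 r z -> Clim (fun n => g n z) (f z)) ->
  holo f z0.
Proof.
  intros Hr Hg HM Hf.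
  assert (HM0 : 0 <= M) by (eapply Rle_trans; [apply Cmod_ge_0|]; apply (HM O z0); split; lra).
  assert (Hz0 : in_square z0 r z0) by (split; lra).
  set (K := 3 * M / r ^ 2).
  assert (HK : 0 <= K) by (apply Rdiv_le_0_compat; [lra|apply pow_lt; auto]).
  assert (A : forall n, exists c, forall w, Cmod (w - z0) <= r / 2 ->
     Cmod (g n w - g n z0 - c * (w - z0)) <= K * Cmod (w - z0) ^ 2).
  { intros n. destruct (taylor_square_2 (g n) z0 r M Hr (Hg n) (HM n)) as (c & _ & _ & H & _).
    exists (c 1%nat). exact H. }
  set (c := fun n => proj1_sig (constructive_indefinite_description _ (A n))).
  assert (Hc : forall n w, Cmod (w - z0) <= r / 2 ->
     Cmod (g n w - g n z0 - c n * (w - z0)) <= K * Cmod (w - z0) ^ 2)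
    by (intros n; exact (proj2_sig (constructive_indefinite_description _ (A n)))).
  clearbody c.
  assert (Lc : exists l, Clim c l).
  (* The derivatives [c n] form a Cauchy sequence: up to [K t <= eps / 4], each one is the
     difference quotient taken at the single point [z0 + t], and there the functions converge. *)
  { apply Clim_cauchy. intros eps He.
    destruct (Rdiv_add1_le K (eps / 4) HK ltac:(lra)) as [Hq Hq'].
    destruct (pos_min2 (r / 2) _ ltac:(lra) Hq) as (t & Ht & T1 & T2).
    assert (Ht2 : K * t <= eps / 4) by nra.
    set (w := (z0 + t)%C).
    assert (Hw : Cmod (w - z0) = t).
    { unfold w. replace (z0 + t - z0)%C with (RtoC t) by ring. rewrite Cmod_R. apply Rabs_pos_eq; lra. }
    assert (L : Clim (fun n => g n w - g n z0)%C (f w - f z0)%C).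
    { apply Clim_minus; apply Hf; [apply disc_in_square; lra | exact Hz0]. }
    destruct (L (eps * t / 8)) as [N HN]; [apply Rdiv_lt_0_compat; [nra|lra]|].
    exists N. intros n m Hn Hm.
    pose proof (Hc n w ltac:(lra)) as Bn. pose proof (Hc m w ltac:(lra)) as Bm. rewrite Hw in Bn, Bm.
    pose proof (HN n Hn) as Ln. pose proof (HN m Hm) as Lm.
    apply Rmult_lt_reg_r with t; [exact Ht|].
    rewrite <- Hw at 1. rewrite <- Cmod_mult.
    replace ((c n - c m) * (w - z0))%C with
      (((g m w - g m z0 - c m * (w - z0)) - (g n w - g n z0 - c n * (w - z0)))
        + ((g n w - g n z0 - (f w - f z0)) - (g m w - g m z0 - (f w - f z0))))%C by ring.
    eapply Rle_lt_trans; [apply Cmod_triangle|].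
    eapply Rle_lt_trans; [apply Rplus_le_compat; apply Cmod_triangle_minus|].
    assert (K * t ^ 2 <= eps / 4 * t) by (simpl; nra). assert (0 < eps * t) by (apply Rmult_lt_0_compat; lra). lra. }
  destruct Lc as [l Hl]. exists l. apply Cderive_quadratic with K (r / 2); [exact HK|lra|]. intros w Hw.
  apply Clim_le with (fun n => g n w - g n z0 - c n * (w - z0))%C; [|intros n; apply Hc; exact Hw].
  apply Clim_minus.
  - apply Clim_minus; apply Hf; [apply disc_in_square; lra | exact Hz0].
  - apply Clim_mult; [exact Hl|apply Clim_const].
Qed.

(** At [p] the derivative of the extended quotient is the second Taylor coefficient: dividing the
    cubic remainder by [w - p] leaves a quadratic one. *)
Lemma holo_factor (q : C -> C) (p : C) (r : R) : 0 < r ->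
  (forall z, in_square p r z -> holo q z) ->
  exists d, Cderive q p d /\
   (forall z, in_square p r z ->
    holo (fun w => if Ceq_dec w p then d else (q w - q p) / (w - p))%C z).
Proof.
  intros Hr Hq. 
  destruct (square_bounded q p r ltac:(lra)) as [M HM]; [intros; apply holo_cont; auto|].
  destruct (taylor_square_2 q p r M Hr Hq HM) as (c & _ & D & _ & E).
  assert (HM0 : 0 <= M) by (eapply Rle_trans; [apply Cmod_ge_0|]; apply (HM p); split; lra).
  set (K := 3 * M / r ^ 3) in *.
  assert (HK : 0 <= K) by (apply Rdiv_le_0_compat; [lra|apply pow_lt; auto]).
  exists (c 1%nat). split; [exact D|]. intros z Hz.
  destruct (Ceq_dec z p) as [->|Hzp].
  - exists (c 2%nat). apply Cderive_quadratic with K (r / 2); [exact HK|lra|]. intros w H1.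
    destruct (Ceq_dec p p) as [_|N]; [|congruence].
    destruct (Ceq_dec w p) as [->|Hwp].
    + replace (c 1%nat - c 1%nat - c 2%nat * (p - p))%C with (RtoC 0) by ring.
      rewrite Cmod_0. apply Rmult_le_pos; [exact HK|apply pow2_ge_0].
    + assert (Hwp' : (w - p)%C <> RtoC 0) by (apply Cminus_eq_contra; auto).
      assert (Hm : 0 < Cmod (w - p)) by (apply Cmod_gt_0; auto).
      replace ((q w - q p) / (w - p) - c 1%nat - c 2%nat * (w - p))%C with
        ((q w - q p - c 1%nat * (w - p) - c 2%nat * (w - p) ^ 2) / (w - p))%C by (field; auto).
      rewrite Cmod_div by auto. apply Rmult_le_reg_r with (Cmod (w - p)); [exact Hm|].
      unfold Rdiv at 1. rewrite Rmult_assoc, Rinv_l, Rmult_1_r by lra.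
      eapply Rle_trans; [apply E; exact H1|]. right. ring.
  - apply holo_ext_loc with (fun w => (q w - q p) / (w - p))%C (Cmod (z - p)).
    + apply Cmod_gt_0, Cminus_eq_contra, Hzp.
    + intros w Hw. destruct (Ceq_dec w p) as [->|]; [|reflexivity].
      rewrite Cmod_minus_sym in Hw. lra.
    + apply holo_mult; [|apply holo_inv_sub; auto]. apply holo_minus; [auto|apply holo_const].
Qed.

(** The Taylor coefficients at [z0] vanish one after the other: on the small disc the remainder
    bound, divided by [t ^ n], tends to [0] with [t]. As [q] is entire, one square reaches any given
    [z]: with [r = 4 |z - z0| + 1] the ratio [|z - z0| / r] stays below [1 / 2], and the remainders
    tend to [0]. *)
Lemma entire_zero (q : C -> C) (z0 : C) (d : R) : 0 < d ->
  (forall z, holo q z) -> (forall z, Cmod (z - z0) < d -> q z = RtoC 0) ->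
  forall z, q z = RtoC 0.
Proof.
  intros Hd Hq Hz z.
  set (r := 4 * Cmod (z - z0) + 1). pose proof (Cmod_ge_0 (z - z0)) as Hp.
  assert (Hr : 0 < r) by (unfold r; lra).
  destruct (square_bounded q z0 r ltac:(lra)) as [M HM]; [intros; apply holo_cont; auto|].
  destruct (taylor_square q z0 r M Hr (fun z _ => Hq z) HM) as [c [_ H]].
  assert (HM0 : 0 <= M) by (eapply Rle_trans; [apply Cmod_ge_0|]; apply (HM z0); split; lra).
  assert (Hc : forall n, Csum (fun k => c k * (z - z0) ^ k)%C n = RtoC 0 /\ forall k, (k < n)%nat -> c k = RtoC 0).
  { induction n as [|n [IH1 IH2]]; [split; [reflexivity|intros; lia]|].
    assert (X : c n = RtoC 0).
    { apply Cmod_le_0. apply Rle_0_eps with (3 * M / r ^ S n).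
      { apply Rdiv_le_0_compat; [lra|apply pow_lt; auto]. }
      intros eps He.
      destruct (pos_min3 (r / 2) (d / 2) eps ltac:(lra) ltac:(lra) He) as (t & Ht & T1 & T2 & T3).
      set (w := (z0 + t)%C).
      assert (Ew : (w - z0)%C = RtoC t) by (unfold w; ring).
      assert (Hw : Cmod (w - z0) = t) by (rewrite Ew, Cmod_R; apply Rabs_pos_eq; lra).
      pose proof (H (S n) w ltac:(lra)) as B. rewrite (Hz w ltac:(lra)), Hw in B.
      assert (S0 : forall m, (m <= n)%nat -> Csum (fun k => c k * (w - z0) ^ k)%C m = RtoC 0).
      { induction m as [|m IHm]; intros Hm; simpl; [reflexivity|]. rewrite IHm by lia. rewrite IH2 by lia. ring. }
      simpl Csum in B. rewrite S0 in B by lia.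
      replace (0 - (0 + c n * (w - z0) ^ n))%C with (- (c n * (w - z0) ^ n))%C in B by ring.
      rewrite Cmod_opp, Cmod_mult, Cmod_pow, Hw in B.
      assert (Htn : 0 < t ^ n) by (apply pow_lt; auto).
      apply Rmult_le_reg_r with (t ^ n); [exact Htn|]. eapply Rle_trans; [apply B|].
      unfold Rdiv at 1. rewrite Rpow_mult_distr, pow_inv.
      assert (0 <= 3 * M / r ^ S n) by (apply Rdiv_le_0_compat; [lra|apply pow_lt; auto]).
      replace (3 * M * (t ^ S n * / r ^ S n)) with (t * (3 * M / r ^ S n) * t ^ n) by (simpl; unfold Rdiv; ring).
      apply Rmult_le_compat_r; [lra|]. apply Rmult_le_compat_r; lra. }
    split.
    - simpl. rewrite IH1, X. ring.
    - intros k Hk. destruct (Nat.eq_dec k n) as [->|]; [exact X|apply IH2; lia]. }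
  apply Cmod_le_0. apply Rle_plus_epsilon. intros eps He. rewrite Rplus_0_l.
  destruct (geometric_small (3 * M) (/ 2) eps ltac:(lra) He) as [N HN]. specialize (HN N (le_n _)).
  pose proof (H N z ltac:(unfold r; lra)) as B. rewrite (proj1 (Hc N)) in B.
  replace (q z - 0)%C with (q z) in B by ring.
  eapply Rle_trans; [apply B|]. apply Rle_trans with (3 * M * (/ 2) ^ N); [|lra].
  apply Rmult_le_compat_l; [lra|]. apply pow_incr. split; [apply Rdiv_le_0_compat; lra|].
  apply Rmult_le_reg_r with r; [lra|]. unfold Rdiv. rewrite Rmult_assoc, Rinv_l by lra. unfold r; lra.
Qed.

(** * The complex exponential and the principal logarithm *)

Lemma Cexp_plus (a b : C) : Cexp (a + b) = (Cexp a * Cexp b)%C.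
Proof.
  unfold Cexp. rewrite re_plus, im_plus, exp_plus, cos_plus, sin_plus.
  unfold Cmult; simpl. f_equal; ring.
Qed.

Lemma Cexp_0 : Cexp 0 = RtoC 1.
Proof. unfold Cexp. rewrite re_RtoC, im_RtoC, exp_0, cos_0, sin_0. unfold RtoC. f_equal; ring. Qed.

Lemma Cexp_opp_l (a : C) : (Cexp (- a) * Cexp a)%C = RtoC 1.
Proof. rewrite <- Cexp_plus. replace (- a + a)%C with (RtoC 0) by ring. apply Cexp_0. Qed.

Lemma Cmod_Cexp (z : C) : Cmod (Cexp z) = exp (Re z).
Proof.
  unfold Cexp, Cmod; simpl fst; simpl snd.
  replace ((exp (Re z) * cos (Im z)) ^ 2 + (exp (Re z) * sin (Im z)) ^ 2) with (exp (Re z) ^ 2).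
  - apply sqrt_pow2. apply Rlt_le, exp_pos.
  - replace ((exp (Re z) * cos (Im z)) ^ 2 + (exp (Re z) * sin (Im z)) ^ 2)
      with (exp (Re z) ^ 2 * ((sin (Im z)) ^ 2 + (cos (Im z)) ^ 2)) by ring.
    rewrite <- !Rsqr_pow2, sin2_cos2. ring.
Qed.

Lemma Cexp_nz (z : C) : Cexp z <> RtoC 0.
Proof. apply Cmod_gt_0. rewrite Cmod_Cexp. apply exp_pos. Qed.

Lemma Cexp_opp (a : C) : Cexp (- a) = (/ Cexp a)%C.
Proof.
  pose proof (Cexp_nz a).
  rewrite <- (Cmult_1_r (Cexp (- a))), <- (Cinv_r (Cexp a)) by assumption.
  rewrite Cmult_assoc, Cexp_opp_l. ring.
Qed.

Lemma derive_at_0 (f : R -> R) (l : R) : is_derive f 0 l -> f 0 = 0 ->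
  forall eps, 0 < eps -> exists d, 0 < d /\ forall x, Rabs x < d -> Rabs (f x - l * x) <= eps * Rabs x.
Proof.
  intros [_ H] H0 eps He. destruct (H 0 (fun P HP => HP) (mkposreal _ He)) as [d Hd].
  exists d. split; [apply cond_pos|]. intros x Hx.
  assert (Hx' : Rabs (x - 0) < d) by (rewrite Rminus_0_r; exact Hx).
  specialize (Hd x Hx'). change (Rabs ((f x - f 0) - (x - 0) * l) <= eps * Rabs (x - 0)) in Hd.
  rewrite H0, !Rminus_0_r in Hd. rewrite (Rmult_comm l). exact Hd.
Qed.

Lemma Cexp_near_0 (eps : R) : 0 < eps -> exists d, 0 < d /\
  forall u, Cmod u < d -> Cmod (Cexp u - 1 - u) <= eps * Cmod u.
Proof.
  (* The real and imaginary parts of [Cexp u - 1 - u] expand into nine terms, each at most [e * m];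
     hence [eps / 10]. Taking [|u| < e <= 1] absorbs the products of two small factors. *)
  intros He. destruct (pos_min2 1 (eps / 10) Rlt_0_1 ltac:(lra)) as (e & He' & He1 & He2).
  destruct (derive_at_0 (fun x => exp x - 1) 1) with (eps := e) as [d1 [Hd1 H1]]; auto.
  { eapply is_derive_eq; [auto_derive; auto|]. rewrite exp_0. ring. }
  { rewrite exp_0; ring. }
  destruct (derive_at_0 (fun x => cos x - 1) 0) with (eps := e) as [d2 [Hd2 H2]]; auto.
  { eapply is_derive_eq; [auto_derive; auto|]. rewrite sin_0. ring. }
  { rewrite cos_0; ring. }
  destruct (derive_at_0 sin 1) with (eps := e) as [d3 [Hd3 H3]]; auto.
  { eapply is_derive_eq; [auto_derive; auto|]. rewrite cos_0. ring. }
  { apply sin_0. }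
  destruct (pos_min3 d1 d2 d3 Hd1 Hd2 Hd3) as (d0 & Hd0 & D1 & D2 & D3).
  destruct (pos_min2 e d0 He' Hd0) as (d & Hd & D0 & D4). exists d. split; [exact Hd|]. intros u Hu.
  pose proof (re_le_Cmod u) as Bx. pose proof (im_le_Cmod u) as By.
  unfold Cexp. destruct u as [x y]. unfold Re, Im in *; simpl fst in *; simpl snd in *.
  set (m := Cmod (x, y)) in *.
  specialize (H1 x ltac:(lra)). specialize (H2 y ltac:(lra)). specialize (H3 y ltac:(lra)). cbv beta in H1, H2.
  set (a := exp x - 1 - 1 * x) in *. set (b := cos y - 1 - 0 * y) in *. set (c := sin y - 1 * y) in *.
  assert (Ea : exp x = 1 + x + a) by (unfold a; ring).
  assert (Eb : cos y = 1 + b) by (unfold b; ring).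
  assert (Ec : sin y = y + c) by (unfold c; ring).
  clearbody a b c.
  assert (Ba : Rabs a <= e * m) by (eapply Rle_trans; [apply H1|apply Rmult_le_compat_l; lra]).
  assert (Bb : Rabs b <= e * m) by (eapply Rle_trans; [apply H2|apply Rmult_le_compat_l; lra]).
  assert (Bc : Rabs c <= e * m) by (eapply Rle_trans; [apply H3|apply Rmult_le_compat_l; lra]).
  assert (Hm : 0 <= m) by (unfold m; apply Cmod_ge_0).
  assert (Hem : 0 <= e * m) by (apply Rmult_le_pos; lra).
  assert (Hem1 : e * m <= m) by nra. 
  assert (Hm1 : m * m <= e * m) by (apply Rmult_le_compat_r; lra).
  assert (M : forall p q P Q, Rabs p <= P -> Rabs q <= Q -> Rabs (p * q) <= P * Q).
  { intros. rewrite Rabs_mult. apply Rmult_le_compat; auto using Rabs_pos. }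
  eapply Rle_trans; [apply Cmod_le_abs|].
  replace (Re _) with (a + b * 1 + x * b + a * b) by (unfold Re; simpl; rewrite Ea, Eb; ring).
  replace (Im _) with (c + x * y + x * c + a * y + a * c) by (unfold Im; simpl; rewrite Ea, Ec; ring).
  pose proof (M x b m (e * m) Bx Bb). pose proof (M a b m (e * m) ltac:(lra) Bb).
  pose proof (M x y m m Bx By). pose proof (M x c m (e * m) Bx Bc).
  pose proof (M a y (e * m) m Ba By). pose proof (M a c m (e * m) ltac:(lra) Bc).
  assert (m * (e * m) <= e * m) by nra.
  eapply Rle_trans.
  { apply Rplus_le_compat.
    - eapply Rle_trans; [apply Rabs_triang|]. apply Rplus_le_compat_r.
      eapply Rle_trans; [apply Rabs_triang|]. apply Rplus_le_compat_r. apply Rabs_triang.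
    - eapply Rle_trans; [apply Rabs_triang|]. apply Rplus_le_compat_r.
      eapply Rle_trans; [apply Rabs_triang|]. apply Rplus_le_compat_r. 
      eapply Rle_trans; [apply Rabs_triang|]. apply Rplus_le_compat_r. apply Rabs_triang. }
  rewrite Rmult_1_r.
  assert (10 * (e * m) <= eps * m) by nra. lra.
Qed.

Lemma Cderive_Cexp (z : C) : Cderive Cexp z (Cexp z).
Proof.
  apply Cderive_eps. intros eps He.
  assert (Hp : 0 < Cmod (Cexp z)) by (rewrite Cmod_Cexp; apply exp_pos).
  destruct (Cexp_near_0 (eps / Cmod (Cexp z))) as [d [Hd H]]; [apply Rdiv_lt_0_compat; auto|].
  exists d. split; [auto|]. intros w Hw.
  replace (Cexp w) with (Cexp z * Cexp (w - z))%C by (rewrite <- Cexp_plus; f_equal; ring).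
  replace (Cexp z * Cexp (w - z) - Cexp z - Cexp z * (w - z))%C
    with (Cexp z * (Cexp (w - z) - 1 - (w - z)))%C by ring.
  rewrite Cmod_mult. specialize (H _ Hw).
  apply Rle_trans with (Cmod (Cexp z) * (eps / Cmod (Cexp z) * Cmod (w - z))).
  - apply Rmult_le_compat_l; lra.
  - right. field. lra.
Qed.

Lemma holo_Cexp (f : C -> C) (z : C) : holo f z -> holo (fun w => Cexp (f w)) z.
Proof. intros H. apply (holo_comp Cexp); [eexists; apply Cderive_Cexp | exact H]. Qed.

(** The alternating lower bound of degree seven, in which [x ^ 2 <= 4] leaves at least
    [x - 4 x / 6]. The inequality turns a small sine into a small angle for the logarithm, and later
    bounds [x ^ 2] by [9 sin x ^ 2] in the Wallis-type integrals. *)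
Lemma sin_ge_third (x : R) : 0 <= x <= PI / 2 -> x <= 3 * sin x.
Proof.
  intros Hx. pose proof PI_4. pose proof PI_RGT_0. destruct (SIN x ltac:(lra) ltac:(lra)) as [H1 _].
  assert (E : sin_lb x = x - x ^ 3 / 6 + x ^ 5 / 120 - x ^ 7 / 5040).
  { unfold sin_lb, sin_approx, sum_f_R0, sin_term.
    change (2 * 0 + 1)%nat with 1%nat. change (2 * 1 + 1)%nat with 3%nat.
    change (2 * 2 + 1)%nat with 5%nat. change (2 * 3 + 1)%nat with 7%nat.
    rewrite !INR_IZR_INZ.
    change (Z.of_nat (fact 1)) with 1%Z. change (Z.of_nat (fact 3)) with 6%Z.
    change (Z.of_nat (fact 5)) with 120%Z. change (Z.of_nat (fact 7)) with 5040%Z. field. }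
  rewrite E in H1.
  assert (x * x <= 4) by nra.
  assert (0 <= x ^ 5 / 120 - x ^ 7 / 5040).
  { replace (x ^ 5 / 120 - x ^ 7 / 5040) with (x ^ 5 * (42 - x * x) / 5040) by field.
    apply Rdiv_le_0_compat; [|lra]. apply Rmult_le_pos; [apply pow_le; lra|lra]. }
  assert (x ^ 3 / 6 <= x * (4 / 6)). { replace (x ^ 3 / 6) with (x * (x * x / 6)) by field. apply Rmult_le_compat_l; lra. }
  lra.
Qed.

Lemma angle_unique (a b : R) : Rabs (a - b) < 2 * PI -> cos a = cos b -> sin a = sin b -> a = b.
Proof.
  intros H Hc Hs.
  assert (H1 : cos (a - b) = 1). { rewrite cos_minus, Hc, Hs. pose proof (sin2_cos2 b). unfold Rsqr in *. lra. }
  replace (a - b) with (2 * ((a - b) / 2)) in H1 by field. rewrite cos_2a_sin in H1.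
  assert (H2 : sin ((a - b) / 2) = 0) by nra.
  apply Rabs_lt_between in H.
  destruct (Rtotal_order a b) as [L|[E|G]]; auto; exfalso.
  - pose proof (sin_lt_0_var ((a - b) / 2) ltac:(lra) ltac:(lra)). lra.
  - pose proof (sin_gt_0 ((a - b) / 2) ltac:(lra) ltac:(lra)). lra.
Qed.

Lemma Cmod_sqr (z : C) : Cmod z * Cmod z = Re z * Re z + Im z * Im z.
Proof. pose proof (Cmod2_alt z). simpl in H. lra. Qed.

Lemma Re_div_Cmod_bound (z : C) : z <> RtoC 0 -> -1 <= Re z / Cmod z <= 1.
Proof.
  intros Hz. apply Cmod_gt_0 in Hz. pose proof (re_le_Cmod z) as H. apply Rabs_le_between in H.
  split; apply Rmult_le_reg_r with (Cmod z); auto; unfold Rdiv; rewrite Rmult_assoc, Rinv_l; lra.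
Qed.

Lemma cos_Carg (z : C) : z <> RtoC 0 -> cos (Carg z) = Re z / Cmod z.
Proof.
  intros Hz. unfold Carg. pose proof (Re_div_Cmod_bound z Hz).
  destruct (Rle_dec 0 (Im z)); rewrite ?cos_neg; apply cos_acos; auto.
Qed.

Lemma sin_Carg (z : C) : z <> RtoC 0 -> sin (Carg z) = Im z / Cmod z.
Proof.
  intros Hz. unfold Carg. pose proof (Re_div_Cmod_bound z Hz).
  assert (Hm : 0 < Cmod z) by (apply Cmod_gt_0; auto).
  assert (E : 1 - Rsqr (Re z / Cmod z) = Rsqr (Im z / Cmod z)).
  { unfold Rsqr. pose proof (Cmod_sqr z) as E.
    replace (1 - Re z / Cmod z * (Re z / Cmod z)) with ((Cmod z * Cmod z - Re z * Re z) / (Cmod z * Cmod z)) by (field; lra).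
    replace (Cmod z * Cmod z - Re z * Re z) with (Im z * Im z) by lra. field. lra. }
  destruct (Rle_dec 0 (Im z)) as [H0|H0].
  - rewrite sin_acos, E by auto. rewrite sqrt_Rsqr; [reflexivity|]. apply Rdiv_le_0_compat; auto.
  - rewrite sin_neg, sin_acos, E by auto. rewrite sqrt_Rsqr_abs, Rabs_left; [ring|].
    apply Rmult_lt_reg_r with (Cmod z); auto. unfold Rdiv. rewrite Rmult_assoc, Rinv_l; lra.
Qed.

Lemma Cexp_Clog (z : C) : z <> RtoC 0 -> Cexp (Clog z) = z.
Proof.
  intros Hz. assert (Hm : 0 < Cmod z) by (apply Cmod_gt_0; auto).
  unfold Cexp, Clog. change (Re (ln (Cmod z), Carg z)) with (ln (Cmod z)).
  change (Im (ln (Cmod z), Carg z)) with (Carg z).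
  rewrite exp_ln, cos_Carg, sin_Carg by auto.
  transitivity (Re z, Im z); [f_equal; field; lra | symmetry; apply C_surj].
Qed.

Lemma Carg_bound (z : C) : - PI <= Carg z <= PI.
Proof.
  unfold Carg. pose proof (acos_bound (Re z / Cmod z)). destruct (Rle_dec 0 (Im z)); lra.
Qed.

Definition off_slit (z : C) : Prop := 0 < Re z \/ Im z <> 0.

Lemma off_slit_nz (z : C) : off_slit z -> z <> RtoC 0.
Proof. intros H E. rewrite E in H. unfold off_slit in H. rewrite re_RtoC, im_RtoC in H. destruct H; lra. Qed.

Lemma Carg_off_slit (z : C) : off_slit z -> - PI < Carg z < PI.
Proof.
  intros H. pose proof (off_slit_nz z H) as Hz. pose proof (Carg_bound z) as B.
  assert (Hm : 0 < Cmod z) by (apply Cmod_gt_0; auto).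
  pose proof (cos_Carg z Hz) as E1. pose proof (sin_Carg z Hz) as E2.
  assert (N : cos (Carg z) = -1 -> sin (Carg z) = 0 -> False).
  { intros C1 C2. rewrite E1 in C1. rewrite E2 in C2.
    apply (Rmult_eq_compat_r (Cmod z)) in C1, C2. unfold Rdiv in C1, C2.
    rewrite Rmult_assoc, Rinv_l, Rmult_1_r in C1, C2 by lra.
    destruct H; lra. }
  split.
  - destruct (Rle_lt_or_eq_dec _ _ (proj1 B)) as [L|E]; auto. exfalso. apply N; rewrite <- E.
    + rewrite cos_neg. apply cos_PI.
    + rewrite sin_neg, sin_PI. ring.
  - destruct (Rle_lt_or_eq_dec _ _ (proj2 B)) as [L|E]; auto. exfalso. apply N; rewrite E.
    + apply cos_PI.
    + apply sin_PI.
Qed.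

Lemma Cexp_inj (a b : C) : Rabs (Im a - Im b) < 2 * PI -> Cexp a = Cexp b -> a = b.
Proof.
  intros H E.
  assert (Hr : Re a = Re b). { apply exp_inv. rewrite <- !Cmod_Cexp, E. reflexivity. }
  unfold Cexp in E. injection E; intros E2 E1. rewrite Hr in E1, E2.
  apply Rmult_eq_reg_l in E1; [|apply Rgt_not_eq, exp_pos].
  apply Rmult_eq_reg_l in E2; [|apply Rgt_not_eq, exp_pos].
  rewrite (C_surj a), (C_surj b), Hr, (angle_unique (Im a) (Im b)) by auto. reflexivity.
Qed.

Lemma Clog_Cexp (w : C) : - PI < Im w < PI -> Clog (Cexp w) = w.
Proof.
  intros H. apply Cexp_inj; [|apply Cexp_Clog, Cexp_nz].
  pose proof (Carg_bound (Cexp w)). change (Im (Clog (Cexp w))) with (Carg (Cexp w)).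
  apply Rabs_lt_between. lra.
Qed.

(** The modulus is handled by continuity of [ln] at [1]. For the argument, a positive cosine
    confines it to the open interval from [- PI / 2] to [PI / 2], where it is at most three times
    its sine. *)
Lemma Clog_near_1 (eps : R) : 0 < eps -> exists d, 0 < d /\
  forall z, Cmod (z - 1) < d -> z <> RtoC 0 /\ Cmod (Clog z) < eps.
Proof.
  intros He.
  assert (L : exists d, 0 < d /\ forall x, Rabs (x - 1) < d -> Rabs (ln x) < eps / 2).
  { assert (Hc : continuity_pt ln 1) by (apply derivable_continuous_pt; exists (/ 1); apply derivable_pt_lim_ln; lra).
    destruct (Hc (eps / 2) ltac:(lra)) as [d [Hd H]]. exists d. split; [exact Hd|].
    intros x Hx. destruct (Req_dec x 1) as [->|Hn].
    - rewrite ln_1, Rabs_R0. lra.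
    - specialize (H x). simpl in H. unfold R_dist in H. rewrite ln_1, Rminus_0_r in H. apply H.
      split; [split; auto; exact I|exact Hx]. }
  destruct L as [d [Hd H]].
  (* [/ 2] keeps [Cmod z] above [1 / 2], so the sine of the argument is at most [2 |z - 1|] and the
     argument at most [6 |z - 1|]; hence [eps / 12]. *)
  destruct (pos_min3 d (/ 2) (eps / 12) Hd ltac:(lra) ltac:(lra)) as (t & Ht & Z1 & Z2 & Z3).
  exists t. split; [exact Ht|]. intros z Hz.
  assert (Hm : Rabs (Cmod z - 1) <= Cmod (z - 1)).
  { pose proof (Cmod_triangle_inv z 1) as T1. pose proof (Cmod_triangle_inv 1 z) as T2.
    rewrite (Cmod_minus_sym 1 z) in T2. rewrite Cmod_1 in T1, T2. apply Rabs_le. lra. }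
  assert (Hm2 := Hm). apply Rabs_le_between in Hm2.
  assert (Hp : / 2 < Cmod z) by lra.
  assert (Hnz : z <> RtoC 0) by (apply Cmod_gt_0; lra).
  split; [exact Hnz|].
  eapply Rle_lt_trans; [apply Cmod_le_abs|].
  change (Rabs (ln (Cmod z)) + Rabs (Carg z) < eps).
  assert (Rabs (ln (Cmod z)) < eps / 2) by (apply H; lra).
  pose proof (re_le_Cmod (z - 1)) as Br. pose proof (im_le_Cmod (z - 1)) as Bi.
  change (Rabs (Re z - 1) <= Cmod (z - 1)) in Br.
  replace (Im (z - 1)) with (Im z) in Bi by (destruct z; unfold Im; simpl; ring).
  apply Rabs_le_between in Br.
  assert (Hc : 0 < cos (Carg z)) by (rewrite cos_Carg by auto; apply Rdiv_lt_0_compat; lra).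
  assert (Hs : Rabs (sin (Carg z)) <= 2 * Cmod (z - 1)).
  { rewrite sin_Carg by auto. unfold Rdiv. rewrite Rabs_mult, Rabs_inv, (Rabs_pos_eq (Cmod z)) by lra.
    apply Rmult_le_reg_r with (Cmod z); [lra|]. rewrite Rmult_assoc, Rinv_l, Rmult_1_r by lra.
    pose proof (Cmod_ge_0 (z - 1)). nra. }
  assert (Ba : Rabs (Carg z) < PI / 2).
  { pose proof (Carg_bound z). apply Rnot_le_lt. intros Q.
    destruct (Rcase_abs (Carg z)).
    - rewrite Rabs_left in Q by lra. pose proof (cos_le_0 (- Carg z) ltac:(lra) ltac:(lra)). rewrite cos_neg in *. lra.
    - rewrite Rabs_right in Q by lra. pose proof (cos_le_0 (Carg z) ltac:(lra) ltac:(lra)). lra. }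
  assert (Rabs (Carg z) <= 3 * Rabs (sin (Carg z))).
  { destruct (Rcase_abs (Carg z)).
    - rewrite (Rabs_left (Carg z)) in * by lra. pose proof (sin_ge_third (- Carg z) ltac:(lra)) as T.
      rewrite sin_neg in T. pose proof (Rle_abs (- sin (Carg z))) as T'. rewrite Rabs_Ropp in T'. lra.
    - rewrite (Rabs_right (Carg z)) in * by lra. pose proof (sin_ge_third (Carg z) ltac:(lra)) as T.
      pose proof (Rle_abs (sin (Carg z))) as T'. lra. }
  lra.
Qed.

(* Inverse function: if u = Clog (1 + h), then h = Cexp u - 1 is u up to a small
   relative error. *)
Lemma Cderive_Clog_1 (eps : R) : 0 < eps -> exists d, 0 < d /\
  forall z, Cmod (z - 1) < d -> Cmod (Clog z - (z - 1)) <= eps * Cmod (z - 1).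
Proof.
  intros He. destruct (pos_min2 (/ 2) (eps / 2) ltac:(lra) ltac:(lra)) as (e & He' & He1 & He2).
  destruct (Cexp_near_0 e He') as [d1 [Hd1 H1]].
  destruct (Clog_near_1 d1 Hd1) as [d [Hd H]]. exists d. split; [exact Hd|].
  intros z Hz. destruct (H z Hz) as [Hnz Hl]. specialize (H1 _ Hl). rewrite Cexp_Clog in H1 by auto.
  replace (z - 1 - Clog z)%C with (- (Clog z - (z - 1)))%C in H1 by ring. rewrite Cmod_opp in H1.
  pose proof (Cmod_triangle (Clog z - (z - 1)) (z - 1)) as T.
  replace (Clog z - (z - 1) + (z - 1))%C with (Clog z) in T by ring.
  pose proof (Cmod_ge_0 (Clog z)). pose proof (Cmod_ge_0 (z - 1)).
  assert (Cmod (Clog z) <= 2 * Cmod (z - 1)) by nra. nra.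
Qed.

(** Reduction to the point [1] by [Clog w = Clog z + Clog (w / z)]. This holds near [z] because
    [Carg z] is strictly between [- PI] and [PI], so adding a small angle does not leave the
    principal strip. *)
Lemma Cderive_Clog (z : C) : off_slit z -> Cderive Clog z (/ z)%C.
Proof.
  intros Hs. pose proof (off_slit_nz z Hs) as Hz. pose proof (Carg_off_slit z Hs) as Ha.
  assert (Hm : 0 < Cmod z) by (apply Cmod_gt_0; auto).
  destruct (pos_min2 (PI - Carg z) (PI + Carg z) ltac:(lra) ltac:(lra)) as (k & Hk & Hk1 & Hk2).
  destruct (Clog_near_1 k Hk) as [d1 [Hd1 H1]].
  assert (Q : forall w, (w - z)%C = (z * (w / z - 1))%C) by (intros; field; auto).
  assert (Qm : forall w, Cmod (w - z) = Cmod z * Cmod (w / z - 1)) by (intros; rewrite <- Cmod_mult, <- Q; reflexivity).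
  assert (Qlt : forall w d, Cmod (w - z) < Cmod z * d -> Cmod (w / z - 1) < d).
  { intros w d Hw. rewrite Qm in Hw. apply Rmult_lt_reg_l in Hw; auto. }
  assert (E : forall w, Cmod (w - z) < Cmod z * d1 -> Clog w = (Clog z + Clog (w / z))%C).
  { intros w Hw. destruct (H1 _ (Qlt w d1 Hw)) as [N B].
    assert (X : Cexp (Clog z + Clog (w / z)) = w).
    { rewrite Cexp_plus, !Cexp_Clog by auto. field. auto. }
    rewrite <- X at 1. apply Clog_Cexp. rewrite im_plus. change (Im (Clog z)) with (Carg z).
    pose proof (im_le_Cmod (Clog (w / z))) as Bi.
    assert (Bi' := Rle_lt_trans _ _ _ Bi B). apply Rabs_lt_between in Bi'. lra. }
  apply Cderive_eps. intros eps He.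
  destruct (Cderive_Clog_1 (eps * Cmod z)) as [d2 [Hd2 H2]]; [apply Rmult_lt_0_compat; auto|].
  destruct (pos_min2 d1 d2 Hd1 Hd2) as (t & Ht & T1 & T2).
  exists (Cmod z * t). split; [apply Rmult_lt_0_compat; auto|]. intros w Hw.
  assert (Hw1 : Cmod (w - z) < Cmod z * d1) by nra.
  assert (Hw2 : Cmod (w - z) < Cmod z * d2) by nra.
  rewrite (E w Hw1). specialize (H2 _ (Qlt w d2 Hw2)).
  replace (Clog z + Clog (w / z) - Clog z - / z * (w - z))%C with (Clog (w / z) - (w / z - 1))%C by (field; auto).
  rewrite Qm. lra.
Qed.

Lemma holo_Cpower_base (a z : C) : off_slit z -> holo (fun w => Cpower w a) z.
Proof.
  intros H. unfold Cpower. apply holo_Cexp. apply holo_mult; [apply holo_const|].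
  eexists; apply Cderive_Clog; exact H.
Qed.

Lemma holo_Cpower_exp (z a : C) (f : C -> C) : holo f a -> holo (fun b => Cpower z (f b)) a.
Proof. intros H. unfold Cpower. apply holo_Cexp. apply holo_mult; [exact H|apply holo_const]. Qed.

Lemma Cpower_plus (z a b : C) : Cpower z (a + b) = (Cpower z a * Cpower z b)%C.
Proof. unfold Cpower. rewrite <- Cexp_plus. f_equal. ring. Qed.

Lemma Cpower_nz (z a : C) : Cpower z a <> RtoC 0.
Proof. apply Cexp_nz. Qed.

Lemma Cpower_0 (z : C) : Cpower z 0 = RtoC 1.
Proof. unfold Cpower. rewrite Cmult_0_l. apply Cexp_0. Qed.

Lemma Cpower_1 (z : C) : z <> RtoC 0 -> Cpower z 1 = z.
Proof. intros H. unfold Cpower. rewrite Cmult_1_l. apply Cexp_Clog, H. Qed.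

Lemma Cpower_opp (z a : C) : Cpower z (- a) = (/ Cpower z a)%C.
Proof. unfold Cpower. rewrite <- Cexp_opp. f_equal. ring. Qed.

Lemma Cpower_nat (z : C) (n : nat) : z <> RtoC 0 -> Cpower z (INR n) = (z ^ n)%C.
Proof.
  intros H. induction n as [|n IH]; [apply Cpower_0|].
  rewrite S_INR, RtoC_plus, Cpower_plus, IH, Cpower_1 by auto. rewrite Cpow_S. ring.
Qed.

Lemma Cpower_sub_nat (z s : C) (n : nat) : z <> RtoC 0 ->
  Cpower z (s - INR n) = (Cpower z s * / z ^ n)%C.
Proof. intros H. unfold Cminus. rewrite Cpower_plus, Cpower_opp, Cpower_nat by auto. reflexivity. Qed.

Lemma Cmod_Cpower (z s : C) : Cmod (Cpower z s) = exp (Re s * ln (Cmod z) - Im s * Carg z).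
Proof. unfold Cpower. rewrite Cmod_Cexp, re_mult. reflexivity. Qed.

Lemma exp_monotone (a b : R) : a <= b -> exp a <= exp b.
Proof. intros [H| ->]; [left; apply exp_increasing, H | right; reflexivity]. Qed.

Lemma Cmod_Cpower_le (z s : C) : Cmod (Cpower z s) <= exp (Re s * ln (Cmod z)) * exp (PI * Cmod s).
Proof.
  rewrite Cmod_Cpower, <- exp_plus. apply exp_monotone.
  pose proof (Carg_bound z). pose proof (im_le_Cmod s) as B. 
  assert (Rabs (Im s * Carg z) <= Cmod s * PI).
  { rewrite Rabs_mult. apply Rmult_le_compat; auto using Rabs_pos. apply Rabs_le; lra. }
  apply Rabs_le_between in H0. lra.
Qed.

(** * Generalized powers *)

Lemma holo_Cprod (u : nat -> C -> C) (n : nat) (s : C) :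
  (forall j, holo (u j) s) -> holo (fun t => Cprod (fun j => u j t) n) s.
Proof.
  intros H. induction n as [|n IH]; simpl; [apply holo_const|]. apply holo_mult; auto.
Qed.

Lemma holo_Csum (u : nat -> C -> C) (n : nat) (s : C) :
  (forall j, holo (u j) s) -> holo (fun t => Csum (fun j => u j t) n) s.
Proof.
  intros H. induction n as [|n IH]; simpl; [apply holo_const|]. apply holo_plus; auto.
Qed.

Lemma holo_Cbinom (k : nat) (s : C) : holo (fun t => Cbinom t k) s.
Proof.
  unfold Cbinom, Cdiv. apply holo_mult; [|apply holo_const].
  apply (holo_Cprod (fun j t => t - INR j)%C).
  intros j. apply holo_minus; [apply holo_id|apply holo_const].
Qed.

Lemma Cbinom_S (s : C) (k : nat) : Cbinom s (S k) = (Cbinom s k * ((s - INR k) / INR (S k)))%C.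
Proof.
  unfold Cbinom. change (Cprod (fun j => s - INR j)%C (S k)) with (Cprod (fun j => s - INR j) k * (s - INR k))%C.
  rewrite fact_simpl, mult_INR, RtoC_mult. field. split; intros E; apply RtoC_inj in E; revert E;
    [apply not_0_INR; auto | apply INR_fact_neq_0].
Qed.

(** Every factor [|s - k| / (k + 1)] is at most [1 + S0], and at most [1 + eps] as soon as
    [eps k >= S0]. Growth below any exponential rate is what lets generalized powers converge in all
    of [|z| > r_f]. *)
Lemma Cbinom_bound (S0 eps : R) : 0 <= S0 -> 0 < eps -> exists D, 0 < D /\
  forall s k, Cmod s <= S0 -> Cmod (Cbinom s k) <= D * (1 + eps) ^ k.
Proof.
  intros HS He. destruct (INR_unbounded (S0 / eps)) as [J HJ].
  assert (HJ' : S0 < eps * INR J).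
  { apply Rmult_lt_reg_r with (/ eps); [apply Rinv_0_lt_compat; auto|].
    replace (eps * INR J * / eps) with (INR J) by (field; lra). exact HJ. }
  exists ((1 + S0) ^ J). split; [apply pow_lt; lra|].
  intros s k Hs.
  assert (A : Cmod (Cbinom s k) <= (1 + S0) ^ (min k J) * (1 + eps) ^ k).
  { induction k as [|k IH].
    - unfold Cbinom. simpl. replace (1 / 1)%C with (RtoC 1) by (field; intros E; apply RtoC_inj in E; lra).
      rewrite Cmod_1. lra.
    - rewrite Cbinom_S, Cmod_mult, Cmod_div by (intros E; apply RtoC_inj in E; apply (not_0_INR (S k)); auto).
      rewrite Cmod_R, Rabs_pos_eq by apply pos_INR.
      assert (HSk : 0 < INR (S k)) by (apply lt_0_INR; lia).
      assert (B : Cmod (s - INR k) <= S0 + INR k).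
      { eapply Rle_trans; [apply Cmod_triangle_minus|]. rewrite Cmod_R, Rabs_pos_eq by apply pos_INR. lra. }
      assert (P1 : 0 < (1 + eps) ^ k) by (apply pow_lt; lra).
      destruct (Compare_dec.le_lt_dec J k) as [Hk|Hk].
      + replace (min (S k) J) with (min k J) by lia.
        assert (X : Cmod (s - INR k) / INR (S k) <= 1 + eps).
        { apply Rmult_le_reg_r with (INR (S k)); auto. unfold Rdiv. rewrite Rmult_assoc, Rinv_l, Rmult_1_r by lra.
          rewrite S_INR. apply le_INR in Hk. nra. }
        simpl pow. rewrite (Rmult_comm (1 + eps)), <- Rmult_assoc. apply Rmult_le_compat; auto.
        * apply Cmod_ge_0.
        * apply Rdiv_le_0_compat; auto. apply Cmod_ge_0.
      + replace (min (S k) J) with (S (min k J)) by lia.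
        assert (X : Cmod (s - INR k) / INR (S k) <= 1 + S0).
        { apply Rmult_le_reg_r with (INR (S k)); auto. unfold Rdiv. rewrite Rmult_assoc, Rinv_l, Rmult_1_r by lra.
          rewrite S_INR. pose proof (pos_INR k). nra. }
        assert (P2 : 0 < (1 + S0) ^ (min k J)) by (apply pow_lt; lra).
        apply Rle_trans with ((1 + S0) ^ min k J * (1 + eps) ^ k * (1 + S0)).
        * apply Rmult_le_compat; auto. apply Cmod_ge_0. apply Rdiv_le_0_compat; auto. apply Cmod_ge_0.
        * simpl pow. assert (0 < (1 + S0) ^ min k J * (1 + eps) ^ k) by (apply Rmult_lt_0_compat; auto).
          replace ((1 + S0) * (1 + S0) ^ min k J * ((1 + eps) * (1 + eps) ^ k)) with
            ((1 + S0) ^ min k J * (1 + eps) ^ k * ((1 + S0) * (1 + eps))) by ring.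
          apply Rmult_le_compat_l; [lra|]. nra. }
  eapply Rle_trans; [apply A|]. apply Rmult_le_compat_r; [apply pow_le; lra|].
  apply Rle_pow; [lra|lia].
Qed.

Lemma Csum_ext (a b : nat -> C) (n : nat) : (forall k, (k < n)%nat -> a k = b k) -> Csum a n = Csum b n.
Proof. intros H. induction n as [|n IH]; simpl; [reflexivity|]. rewrite IH, H by auto. reflexivity. Qed.

Lemma Csum_scal (k : C) (a : nat -> C) (n : nat) : Csum (fun j => k * a j)%C n = (k * Csum a n)%C.
Proof. induction n as [|n IH]; simpl; [ring|]. rewrite IH. ring. Qed.

Lemma geometric_series (a : nat -> C) (K th : R) : 0 <= K -> 0 <= th < 1 ->
  (forall k, Cmod (a k) <= K * th ^ k) ->
  (exists l, is_Cseries a l) /\ forall n, Cmod (Csum a n) <= K / (1 - th).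
Proof.
  intros HK Hth H.
  assert (A : forall n m, Cmod (Csum a (n + m) - Csum a n) <= K * th ^ n * ((1 - th ^ m) / (1 - th))).
  { intros n m. induction m as [|m IH].
    - rewrite Nat.add_0_r. replace (Csum a n - Csum a n)%C with (RtoC 0) by ring. rewrite Cmod_0.
      simpl. right. field. lra.
    - rewrite Nat.add_succ_r. simpl Csum.
      replace (Csum a (n + m) + a (n + m)%nat - Csum a n)%C with ((Csum a (n + m) - Csum a n) + a (n + m)%nat)%C by ring.
      eapply Rle_trans; [apply Cmod_triangle|].
      eapply Rle_trans; [apply Rplus_le_compat; [apply IH|apply H]|].
      rewrite pow_add. simpl. right. field. lra. }
  assert (B : forall n m, Cmod (Csum a (n + m) - Csum a n) <= K / (1 - th) * th ^ n).
  { intros n m. eapply Rle_trans; [apply A|].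
    assert (0 <= K * th ^ n) by (apply Rmult_le_pos; auto; apply pow_le; lra).
    assert (0 <= th ^ m) by (apply pow_le; lra).
    replace (K / (1 - th) * th ^ n) with (K * th ^ n * (1 / (1 - th))) by (field; lra).
    apply Rmult_le_compat_l; auto. apply Rmult_le_compat_r; [|lra].
    apply Rlt_le, Rinv_0_lt_compat; lra. }
  assert (HK' : 0 <= K / (1 - th)) by (apply Rdiv_le_0_compat; lra).
  split.
  - apply Clim_cauchy. intros eps He.
    destruct (geometric_small (K / (1 - th)) th (eps / 2) Hth ltac:(lra)) as [N HN]. specialize (HN N (le_n _)).
    exists N. intros n m Hn Hm.
    replace (Csum a n - Csum a m)%C with ((Csum a n - Csum a N) - (Csum a m - Csum a N))%C by ring.
    eapply Rle_lt_trans; [apply Cmod_triangle_minus|].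
    pose proof (B N (n - N)%nat) as B1. pose proof (B N (m - N)%nat) as B2.
    replace (N + (n - N))%nat with n in B1 by lia. replace (N + (m - N))%nat with m in B2 by lia. lra.
  - intros n. pose proof (B O n) as B1. simpl in B1. rewrite Rmult_1_r in B1.
    replace (Csum a n - 0)%C with (Csum a n) in B1 by ring. exact B1.
Qed.

Lemma CSeries_correct (a : nat -> C) : (exists l, is_Cseries a l) -> is_Cseries a (CSeries a).
Proof. intros [l H]. rewrite (CSeries_unique a l H). exact H. Qed.

Definition gterm (P : nat -> C) (z s : C) (k : nat) : C :=
  (Cbinom s k * P k * Cpower z (s - INR k))%C.

(** The working form of the radius of convergence: by [P_coef_bound] the coefficients [P_{f,n}]
    satisfy it for every [q > r_ f], whether the radius is finite or not. *)
Definition geom_bounded (P : nat -> C) (q : R) : Prop :=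
  exists M, forall k, Cmod (P k) <= M * q ^ k.

(** The terms are dominated by a geometric series relative to [|z^s|], with constants uniform for
    bounded [s] and [|z| >= c]. Every later estimate of a generalized power thus becomes an estimate
    of an ordinary power. *)
Lemma gterm_series (P : nat -> C) (q c S0 : R) : geom_bounded P q -> 0 < q < c -> 0 <= S0 ->
  exists B, 0 <= B /\ forall s z, Cmod s <= S0 -> c <= Cmod z ->
    (exists l, is_Cseries (gterm P z s) l) /\
    forall n, Cmod (Csum (gterm P z s) n) <= B * Cmod (Cpower z s).
Proof.
  intros [M HM] Hq HS.
  assert (HM0 : 0 <= M). { specialize (HM O). pose proof (Cmod_ge_0 (P O)). simpl in HM. lra. }
  (* Chosen so that the ratio [(1 + eps) q / c] equals [(q + c) / (2 c)], which is below [1]. *)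
  set (eps := (c - q) / (2 * q)).
  assert (He : 0 < eps) by (apply Rdiv_lt_0_compat; lra).
  destruct (Cbinom_bound S0 eps HS He) as [D [HD HB]].
  set (th := (1 + eps) * q / c).
  assert (Hth : 0 <= th < 1).
  { unfold th, eps. replace ((1 + (c - q) / (2 * q)) * q / c) with ((q + c) / (2 * c)) by (field; lra).
    split; [apply Rdiv_le_0_compat; lra|]. apply Rmult_lt_reg_r with (2 * c); [lra|].
    unfold Rdiv. rewrite Rmult_assoc, Rinv_l; lra. }
  exists (D * M / (1 - th)).
  split; [apply Rdiv_le_0_compat; [apply Rmult_le_pos; lra|lra]|]. intros s z Hs Hz.
  assert (Hz0 : z <> RtoC 0) by (apply Cmod_gt_0; lra).
  replace (D * M / (1 - th) * Cmod (Cpower z s)) with (D * M * Cmod (Cpower z s) / (1 - th)) by (field; lra).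
  apply geometric_series; auto.
  - repeat apply Rmult_le_pos; try lra. apply Cmod_ge_0.
  - intros k. unfold gterm. rewrite Cpower_sub_nat, !Cmod_mult by auto.
    rewrite Cmod_inv, Cmod_pow by (apply Cpow_nz; auto).
    assert (Hck : 0 < c ^ k) by (apply pow_lt; lra).
    assert (X : / Cmod z ^ k <= / c ^ k) by (apply Rinv_le_contravar; [auto|apply pow_incr; lra]).
    assert (X0 : 0 <= / Cmod z ^ k) by (apply Rlt_le, Rinv_0_lt_compat, pow_lt; lra).
    assert (Y : Cmod (Cbinom s k) * Cmod (P k) <= D * (1 + eps) ^ k * (M * q ^ k)).
    { apply Rmult_le_compat; auto using Cmod_ge_0. }
    replace (D * M * Cmod (Cpower z s) * th ^ k) with
      (D * (1 + eps) ^ k * (M * q ^ k) * (Cmod (Cpower z s) * / c ^ k)).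
    + apply Rmult_le_compat; auto.
      * apply Rmult_le_pos; apply Cmod_ge_0.
      * apply Rmult_le_pos; [apply Cmod_ge_0|auto].
      * apply Rmult_le_compat_l; [apply Cmod_ge_0|auto].
    + unfold th, Rdiv. rewrite !Rpow_mult_distr, pow_inv. ring.
Qed.

Lemma gpow_series (f : R -> C) (q : R) (z s : C) :
  geom_bounded (P_coef f) q -> 0 < q < Cmod z -> is_Cseries (gterm (P_coef f) z s) (gpow f z s).
Proof.
  intros HP Hq. destruct (gterm_series _ q (Cmod z) (Cmod s) HP Hq (Cmod_ge_0 s)) as [B [_ H]].
  destruct (H s z (Rle_refl _) (Rle_refl _)) as [H1 _]. exact (CSeries_correct _ H1).
Qed.

Lemma gpow_bound (f : R -> C) (q c S0 : R) : geom_bounded (P_coef f) q -> 0 < q < c -> 0 <= S0 ->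
  exists B, 0 <= B /\ forall s z, Cmod s <= S0 -> c <= Cmod z ->
    Cmod (gpow f z s) <= B * Cmod (Cpower z s).
Proof.
  intros HP Hq HS. destruct (gterm_series _ q c S0 HP Hq HS) as [B [HB H]].
  exists B. split; [exact HB|]. intros s z Hs Hz.
  apply Clim_le with (Csum (gterm (P_coef f) z s)); [|apply H; auto].
  apply (gpow_series f q); auto. lra.
Qed.

Lemma off_slit_open (z : C) : off_slit z -> exists d, 0 < d /\ forall w, Cmod (w - z) <= d -> off_slit w.
Proof.
  intros [H|H].
  - exists (Re z / 2). split; [lra|]. intros w Hw. left.
    pose proof (re_le_Cmod (w - z)) as B. change (Rabs (Re w - Re z) <= Cmod (w - z)) in B.
    apply Rabs_le_between in B. lra.
  - pose proof (Rabs_pos_lt _ H). exists (Rabs (Im z) / 2). split; [lra|]. intros w Hw. right. intros E.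
    pose proof (im_le_Cmod (w - z)) as B. change (Rabs (Im w - Im z) <= Cmod (w - z)) in B.
    rewrite E, Rminus_0_l, Rabs_Ropp in B. lra.
Qed.

(** The partial sums are holomorphic and, by [gterm_series], bounded on a small square by a multiple
    of [|w^s|]; the square is kept off the slit and outside a radius [c > q]. *)
Lemma holo_gpow_base (f : R -> C) (q : R) (s z : C) : geom_bounded (P_coef f) q -> 0 < q < Cmod z ->
  off_slit z -> holo (fun w => gpow f w s) z.
Proof.
  intros HP Hq Hz. destruct (off_slit_open z Hz) as [d [Hd Hd']].
  set (c := (q + Cmod z) / 2).
  assert (Hc : q < c < Cmod z) by (unfold c; lra).
  destruct (pos_min2 (d / 2) ((Cmod z - c) / 2) ltac:(lra) ltac:(lra)) as (r & Hr & Hr1 & Hr2).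
  assert (A : forall w, in_square z r w -> off_slit w /\ c <= Cmod w).
  { intros w Hw. apply square_in_disc in Hw. split; [apply Hd'; lra|].
    rewrite Cmod_minus_sym in Hw. pose proof (Cmod_triangle_inv z (z - w)) as T.
    replace (z - (z - w))%C with w in T by ring. lra. }
  destruct (gterm_series _ q c (Cmod s) HP ltac:(lra) (Cmod_ge_0 s)) as [B [HB H]].
  destruct (square_bounded (fun w => Cpower w s) z r ltac:(lra)) as [M HM].
  { intros w Hw. apply holo_cont, holo_Cpower_base, A, Hw. }
  apply (holo_Clim (fun n w => Csum (gterm (P_coef f) w s) n) _ z r (B * M) Hr).
  - intros n w Hw. apply (holo_Csum (fun k w => gterm (P_coef f) w s k)).
    intros k. unfold gterm. apply holo_mult; [apply holo_const|]. apply holo_Cpower_base, A, Hw.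
  - intros n w Hw. eapply Rle_trans; [apply H; [lra|apply A, Hw]|].
    apply Rmult_le_compat_l; auto.
  - intros w Hw. apply (gpow_series f q); auto. destruct (A w Hw). lra.
Qed.

Lemma holo_gpow_exp (f : R -> C) (q : R) (s z : C) : geom_bounded (P_coef f) q -> 0 < q < Cmod z ->
  holo (fun t => gpow f z t) s.
Proof.
  intros HP Hq.
  assert (Hs := Cmod_ge_0 s).
  destruct (gterm_series _ q (Cmod z) (Cmod s + 2) HP Hq ltac:(lra)) as [B [HB H]].
  destruct (square_bounded (fun t => Cpower z t) s 1 ltac:(lra)) as [M HM].
  { intros w Hw. apply holo_cont, holo_Cpower_exp, holo_id. }
  apply (holo_Clim (fun n t => Csum (gterm (P_coef f) z t) n) _ s 1 (B * M) Rlt_0_1).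
  - intros n w Hw. apply (holo_Csum (fun k t => gterm (P_coef f) z t k)).
    intros k. unfold gterm. apply holo_mult; [apply holo_mult; [apply holo_Cbinom|apply holo_const]|].
    apply holo_Cpower_exp. apply holo_minus; [apply holo_id|apply holo_const].
  - intros n w Hw. eapply Rle_trans; [apply H; [|lra]|].
    + apply square_in_disc in Hw. pose proof (Cmod_triangle_inv w s). lra.
    + apply Rmult_le_compat_l; auto.
  - intros w Hw. apply (gpow_series f q); auto.
Qed.

Lemma r_nonneg (f : R -> C) : Rbar_lt 0 (rho f) -> 0 <= r_ f.
Proof.
  unfold r_. destruct (rho f) as [x| |]; simpl; intros H; try lra. apply Rlt_le, Rinv_0_lt_compat, H.
Qed.

(** The radius of convergence is a least upper bound, so some [r > 1 / q] keeps [|P_k| r ^ k]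
    bounded; then [q r >= 1] gives the geometric bound. *)
Lemma P_coef_bound (f : R -> C) (q : R) : Rbar_lt 0 (rho f) -> r_ f < q -> geom_bounded (P_coef f) q.
Proof.
  intros Hrho Hq. pose proof (r_nonneg f Hrho) as Hr.
  assert (Hlt : Rbar_lt (/ q) (rho f)).
  { unfold r_ in Hq, Hr. destruct (rho f) as [x| |]; simpl in *; auto.
    rewrite <- (Rinv_inv x). apply Rinv_lt_contravar; auto.
    apply Rmult_lt_0_compat; [apply Rinv_0_lt_compat; auto|lra]. }
  destruct (CV_radius_bounded (fun n => Cmod (P_coef f n))) as [_ Hlub].
  assert (X : exists r : R, / q < r /\ exists M, forall n, Rabs (Cmod (P_coef f n) * r ^ n) <= M).
  { apply NNPP. intros N. apply Rbar_lt_not_le in Hlt. apply Hlt. apply Hlub.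
    intros r Hr'. simpl. apply Rnot_lt_le. intros L. apply N. exists r; auto. }
  destruct X as [r [Hr1 [M HM]]].
  assert (Hq0 : 0 < / q) by (apply Rinv_0_lt_compat; lra).
  exists M. intros k. specialize (HM k).
  assert (Hrk : 0 < r ^ k) by (apply pow_lt; lra).
  rewrite Rabs_pos_eq in HM by (apply Rmult_le_pos; [apply Cmod_ge_0|lra]).
  assert (HM0 : 0 <= M) by (eapply Rle_trans; [|apply HM]; apply Rmult_le_pos; [apply Cmod_ge_0|lra]).
  apply Rmult_le_reg_r with (r ^ k); auto. eapply Rle_trans; [apply HM|].
  rewrite Rmult_assoc, <- Rpow_mult_distr.
  assert (1 <= q * r). { apply Rmult_le_reg_l with (/ q); auto. rewrite <- Rmult_assoc, Rinv_l by lra. lra. }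
  pose proof (pow_R1_Rle (q * r) k H). nra.
Qed.

(** * Power series, modulators and dilations *)

Lemma is_series_Cseries (a : nat -> C) (l : C) :
  is_series (K := C_AbsRing) (V := C_NormedModule) a l -> is_Cseries a l.
Proof.
  intros H eps He.
  assert (HP : locally (T := C_UniformSpace) l (fun w => Cmod (w - l) < eps)).
  { apply locally_CU_eps. exists eps; auto. }
  destruct (H _ HP) as [N HN]. exists (S N). intros n Hn.
  destruct n as [|n]; [lia|]. specialize (HN n ltac:(lia)).
  replace (Csum a (S n)) with (sum_n (G := C_AbelianMonoid) a n); [exact HN|].
  clear. induction n as [|n IH].
  - rewrite sum_O. simpl. symmetry. apply Cplus_0_l.
  - rewrite sum_Sn, IH. reflexivity.
Qed.

Lemma Cseries_bounded (a : nat -> C) (l : C) : is_Cseries a l -> exists M, forall k, Cmod (a k) <= M.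
Proof.
  intros H. destruct (Clim_bounded _ _ H) as [M [HM0 HM]]. exists (2 * M). intros k.
  replace (a k) with (Csum a (S k) - Csum a k)%C by (simpl; ring).
  eapply Rle_trans; [apply Cmod_triangle_minus|]. pose proof (HM k). pose proof (HM (S k)). lra.
Qed.

Lemma geom_bounded_pos (a : nat -> C) (q q' : R) : geom_bounded a q -> 0 <= q <= q' -> geom_bounded a q'.
Proof.
  intros [M HM] Hq. exists M. intros k. eapply Rle_trans; [apply HM|].
  assert (HM0 : 0 <= M). { specialize (HM O). pose proof (Cmod_ge_0 (a O)). simpl in HM. lra. }
  apply Rmult_le_compat_l; auto. apply pow_incr; auto.
Qed.

Lemma power_series_converges (a : nat -> C) (q : R) (z : C) : geom_bounded a q -> 0 <= q -> q * Cmod z < 1 ->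
  is_Cseries (fun k => a k * z ^ k)%C (CSeries (fun k => a k * z ^ k)%C).
Proof.
  intros [M HM] Hq Hz. apply CSeries_correct.
  assert (HM0 : 0 <= M). { specialize (HM O). pose proof (Cmod_ge_0 (a O)). simpl in HM. lra. }
  apply (geometric_series _ M (q * Cmod z)); auto.
  - split; auto. apply Rmult_le_pos; auto. apply Cmod_ge_0.
  - intros k. rewrite Cmod_mult, Cmod_pow, Rpow_mult_distr, <- Rmult_assoc.
    apply Rmult_le_compat_r; auto. apply pow_le, Cmod_ge_0.
Qed.

Lemma CV_radius_geom (a : nat -> C) (p : C -> R) (q : R) : geom_bounded a q -> 0 < q ->
  (forall z, Rabs (p z) <= Cmod z) -> Rbar_lt 0 (CV_radius (fun n => p (a n))).
Proof.
  intros [M HM] Hq Hp.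
  assert (Hiq : 0 < / q) by (apply Rinv_0_lt_compat; auto).
  apply Rbar_lt_le_trans with (/ q); [exact Hiq|].
  apply (CV_radius_bounded (fun n => p (a n))). exists M. intros n.
  rewrite Rabs_mult, (Rabs_pos_eq ((/ q) ^ n)) by (apply pow_le; lra).
  apply Rmult_le_reg_r with (q ^ n); [apply pow_lt; auto|].
  rewrite Rmult_assoc, <- Rpow_mult_distr, Rinv_l, pow1, Rmult_1_r by lra.
  eapply Rle_trans; [apply Hp|apply HM].
Qed.

Lemma CSeries_real_power (a : nat -> C) (t : R) :
  CSeries (fun k => a k * RtoC t ^ k)%C =
  (PSeries (fun k => Re (a k)) t, PSeries (fun k => Im (a k)) t).
Proof.
  unfold CSeries, PSeries. f_equal; apply Series_ext; intros k; rewrite <- RtoC_pow.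
  - apply re_scal_r.
  - apply im_scal_r.
Qed.

Lemma taylor0_power_series (h : R -> C) (a : nat -> C) (q d : R) : geom_bounded a q -> 0 < q -> 0 < d ->
  (forall t, Rabs t < d -> h t = CSeries (fun k => a k * RtoC t ^ k)%C) ->
  forall n, taylor0 h n = (a n * INR (fact n))%C.
Proof.
  intros Ha Hq Hd H n. unfold taylor0.
  assert (L : forall (p : C -> R), (forall t, Rabs t < d -> p (h t) = PSeries (fun k => p (a k)) t) ->
     (forall z, Rabs (p z) <= Cmod z) -> Derive_n (fun t => p (h t)) n 0 = p (a n) * INR (fact n)).
  { intros p Hp Hpz. rewrite <- (Derive_n_coef (fun k => p (a k))) by (apply (CV_radius_geom a p q); auto).
    apply Derive_n_ext_loc. exists (mkposreal d Hd). intros t Ht. apply Hp.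
    change (Rabs (t - 0) < d) in Ht. rewrite Rminus_0_r in Ht. exact Ht. }
  rewrite (L Re), (L Im).
  - rewrite (C_surj (a n * INR (fact n))), re_scal_r, im_scal_r. reflexivity.
  - intros t Ht. rewrite (H t Ht), CSeries_real_power. reflexivity.
  - apply im_le_Cmod.
  - intros t Ht. rewrite (H t Ht), CSeries_real_power. reflexivity.
  - apply re_le_Cmod.
Qed.

Definition Cconv (a b : nat -> C) (n : nat) : C := Csum (fun k => a k * b (n - k)%nat)%C (S n).

(** The convolution has [n + 1] terms, and [n + 1 <= 2 ^ n] turns their number into the factor [2]
    of the rate. *)
Lemma geom_bounded_conv (a b : nat -> C) (q : R) : 0 <= q -> geom_bounded a q -> geom_bounded b q ->
  geom_bounded (Cconv a b) (2 * q).
Proof.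
  intros Hq [M HM] [N HN]. exists (M * N). intros n.
  assert (HM0 : 0 <= M). { specialize (HM O). pose proof (Cmod_ge_0 (a O)). simpl in HM. lra. }
  assert (HN0 : 0 <= N). { specialize (HN O). pose proof (Cmod_ge_0 (b O)). simpl in HN. lra. }
  assert (Hqn : 0 <= q ^ n) by (apply pow_le; auto).
  assert (A : forall m, (m <= S n)%nat -> Cmod (Csum (fun k => a k * b (n - k)%nat)%C m) <= INR m * (M * N * q ^ n)).
  { induction m as [|m IH]; intros Hm.
    - simpl. rewrite Cmod_0. lra.
    - simpl Csum. eapply Rle_trans; [apply Cmod_triangle|]. rewrite S_INR, Rmult_plus_distr_r, Rmult_1_l.
      apply Rplus_le_compat; [apply IH; lia|]. rewrite Cmod_mult.
      replace (M * N * q ^ n) with ((M * q ^ m) * (N * q ^ (n - m))).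
      + apply Rmult_le_compat; auto using Cmod_ge_0.
      + replace n with (m + (n - m))%nat at 2 by lia. rewrite pow_add. ring. }
  unfold Cconv. eapply Rle_trans; [apply A; lia|].
  rewrite Rpow_mult_distr. replace (M * N * (2 ^ n * q ^ n)) with (2 ^ n * (M * N * q ^ n)) by ring.
  apply Rmult_le_compat_r; [repeat apply Rmult_le_pos; auto|].
  clear. induction n as [|n IH]; [simpl; lra|]. rewrite S_INR. simpl pow. 
  assert (1 <= INR (S n)) by (rewrite S_INR; pose proof (pos_INR n); lra). lra.
Qed.

Lemma Rseries_of_Cseries (a : nat -> C) (l : C) : is_Cseries a l ->
  is_series (fun n => Re (a n)) (Re l) /\ is_series (fun n => Im (a n)) (Im l).
Proof.
  intros H. apply Clim_incr in H. split.
  - apply is_lim_seq_ext with (2 := Clim_re _ _ H). intros n. apply Csum_re.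
  - apply is_lim_seq_ext with (2 := Clim_im _ _ H). intros n. apply Csum_im.
Qed.

Lemma Cseries_of_Rseries (a : nat -> C) (x y : R) :
  is_series (fun n => Re (a n)) x -> is_series (fun n => Im (a n)) y -> CSeries a = (x, y).
Proof. intros Hx Hy. unfold CSeries. rewrite (is_series_unique _ _ Hx), (is_series_unique _ _ Hy). reflexivity. Qed.

Lemma Cconv_re (a b : nat -> C) (n : nat) : Re (Cconv a b n) =
  sum_f_R0 (fun k => Re (a k) * Re (b (n - k)%nat)) n - sum_f_R0 (fun k => Im (a k) * Im (b (n - k)%nat)) n.
Proof.
  unfold Cconv. rewrite Csum_re, <- minus_sum, sum_n_Reals. apply PartSum.sum_eq. intros k _. apply re_mult.
Qed.

Lemma Cconv_im (a b : nat -> C) (n : nat) : Im (Cconv a b n) =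
  sum_f_R0 (fun k => Re (a k) * Im (b (n - k)%nat)) n + sum_f_R0 (fun k => Im (a k) * Re (b (n - k)%nat)) n.
Proof.
  unfold Cconv. rewrite Csum_im, <- plus_sum, sum_n_Reals. apply PartSum.sum_eq. intros k _. apply im_mult.
Qed.

(** Splitting both series into real and imaginary parts gives four Cauchy products of absolutely
    convergent real series. *)
Lemma Cauchy_product (a b : nat -> C) (M th : R) : 0 <= th < 1 ->
  (forall k, Cmod (a k) <= M * th ^ k) -> (forall k, Cmod (b k) <= M * th ^ k) ->
  CSeries (Cconv a b) = (CSeries a * CSeries b)%C.
Proof.
  intros Hth Ha Hb.
  assert (HM0 : 0 <= M). { specialize (Ha O). pose proof (Cmod_ge_0 (a O)). simpl in Ha. lra. }
  assert (A : forall (p : C -> R) u, (forall z, Rabs (p z) <= Cmod z) ->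
     (forall k, Cmod (u k) <= M * th ^ k) -> ex_series (fun k => Rabs (p (u k)))).
  { intros p u Hp Hu. apply (ex_series_le (K := R_AbsRing) (V := R_CompleteNormedModule)) with (fun k => M * th ^ k).
    - intros k. change (Rabs (Rabs (p (u k))) <= M * th ^ k). rewrite Rabs_Rabsolu.
      eapply Rle_trans; [apply Hp|apply Hu].
    - apply (ex_series_scal_l (K := R_AbsRing) M (fun k => th ^ k)). apply ex_series_geom. rewrite Rabs_pos_eq; lra. }
  destruct (Rseries_of_Cseries _ _ (CSeries_correct _ (proj1 (geometric_series a M th HM0 Hth Ha)))) as [Ar Ai].
  destruct (Rseries_of_Cseries _ _ (CSeries_correct _ (proj1 (geometric_series b M th HM0 Hth Hb)))) as [Br Bi].
  assert (Sar := A Re a re_le_Cmod Ha). assert (Sai := A Im a im_le_Cmod Ha).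
  assert (Sbr := A Re b re_le_Cmod Hb). assert (Sbi := A Im b im_le_Cmod Hb).
  apply Cseries_of_Rseries.
  - eapply is_series_ext; [intros n; symmetry; apply Cconv_re|].
    exact (is_series_minus (K := R_AbsRing) (V := R_NormedModule) _ _ _ _
      (is_series_mult _ _ _ _ Ar Br Sar Sbr) (is_series_mult _ _ _ _ Ai Bi Sai Sbi)).
  - eapply is_series_ext; [intros n; symmetry; apply Cconv_im|].
    exact (is_series_plus (K := R_AbsRing) (V := R_NormedModule) _ _ _ _
      (is_series_mult _ _ _ _ Ar Bi Sar Sbi) (is_series_mult _ _ _ _ Ai Br Sai Sbr)).
Qed.

Lemma Cconv_pow (a b : nat -> C) (z : C) (n : nat) :
  Cconv (fun k => a k * z ^ k)%C (fun k => b k * z ^ k)%C n = (Cconv a b n * z ^ n)%C.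
Proof.
  unfold Cconv. rewrite Cmult_comm, <- Csum_scal. apply Csum_ext. intros k Hk.
  replace n with (k + (n - k))%nat at 3 by lia. rewrite Cpow_add_r. ring.
Qed.

Lemma CSeries_ext (a b : nat -> C) : (forall n, a n = b n) -> CSeries a = CSeries b.
Proof. intros H. unfold CSeries. f_equal; apply Series_ext; intros n; rewrite H; reflexivity. Qed.

Lemma power_series_mult (a b : nat -> C) (q : R) (z : C) : geom_bounded a q -> geom_bounded b q ->
  0 <= q -> q * Cmod z < 1 ->
  (CSeries (fun k => a k * z ^ k) * CSeries (fun k => b k * z ^ k))%C = CSeries (fun k => Cconv a b k * z ^ k)%C.
Proof.
  intros [M HM] [N HN] Hq Hz.
  assert (X : forall u K, K <= Rmax M N -> (forall k, Cmod (u k) <= K * q ^ k) ->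
     forall k, Cmod (u k * z ^ k) <= Rmax M N * (q * Cmod z) ^ k).
  { intros u K HK Hu k. rewrite Cmod_mult, Cmod_pow, Rpow_mult_distr, <- Rmult_assoc.
    apply Rmult_le_compat_r; [apply pow_le, Cmod_ge_0|]. eapply Rle_trans; [apply Hu|].
    apply Rmult_le_compat_r; auto. apply pow_le; auto. }
  rewrite <- (Cauchy_product _ _ (Rmax M N) (q * Cmod z)).
  - apply CSeries_ext. intros n. apply Cconv_pow.
  - split; auto. apply Rmult_le_pos; auto. apply Cmod_ge_0.
  - apply (X a M); auto. apply Rmax_l.
  - apply (X b N); auto. apply Rmax_r.
Qed.

(* The Taylor coefficients of Cexp are read off on the real axis. *)
Lemma Cexp_series : exists d, 0 < d /\ forall w, Cmod w < d ->
  is_Cseries (fun k => RtoC (/ INR (fact k)) * w ^ k)%C (Cexp w).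
Proof.
  assert (H0 : forall z, holo Cexp z) by (intros z; eexists; apply Cderive_Cexp).
  destruct (square_bounded Cexp 0 2 ltac:(lra)) as [M HM]; [intros; apply holo_cont; auto|].
  destruct (taylor_square Cexp 0 2 M ltac:(lra) (fun z _ => H0 z) HM) as [c [Hc H]].
  assert (HM0 : 0 <= M) by (eapply Rle_trans; [apply Cmod_ge_0|]; apply (HM 0); split; rewrite ?re_RtoC, ?im_RtoC; lra).
  assert (S1 : forall w, Cmod w < 1 -> is_Cseries (fun k => c k * w ^ k)%C (Cexp w)).
  { intros w Hw eps He.
    destruct (geometric_small (3 * M) (/ 2) eps ltac:(lra) He) as [N HN].
    exists N. intros n Hn. specialize (HN n Hn).
    assert (E0 : (w - 0)%C = w) by ring.
    pose proof (H n w) as B. rewrite E0 in B. specialize (B ltac:(lra)).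
    rewrite Cmod_minus_sym. eapply Rle_lt_trans; [apply B|].
    apply Rle_lt_trans with (3 * M * (/ 2) ^ n); [|lra].
    apply Rmult_le_compat_l; [lra|]. apply pow_incr. pose proof (Cmod_ge_0 w). lra. }
  assert (Gc : geom_bounded c 1).
  { exists (2 * M). intros k. eapply Rle_trans; [apply Hc|]. rewrite pow1, Rmult_1_r.
    apply Rmult_le_reg_r with (2 ^ k); [apply pow_lt; lra|].
    unfold Rdiv. rewrite Rmult_assoc, Rinv_l, Rmult_1_r by (apply pow_nonzero; lra).
    pose proof (pow_R1_Rle 2 k ltac:(lra)). nra. }
  assert (Ge : geom_bounded (fun k => RtoC (/ INR (fact k))) 1).
  { exists 1. intros k. rewrite pow1, Cmod_R, Rabs_pos_eq.
    - rewrite Rmult_1_r. rewrite <- Rinv_1. apply Rinv_le_contravar; [lra|].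
      change 1 with (INR 1). apply le_INR, lt_O_fact.
    - apply Rlt_le, Rinv_0_lt_compat, INR_fact_lt_0. }
  exists 1. split; [lra|]. intros w Hw.
  assert (E : forall k, c k = RtoC (/ INR (fact k))).
  { intros k.
    pose proof (taylor0_power_series (fun t => Cexp t) c 1 1 Gc Rlt_0_1 Rlt_0_1) as T1.
    pose proof (taylor0_power_series (fun t => Cexp t) (fun k => RtoC (/ INR (fact k))) 1 1 Ge Rlt_0_1 Rlt_0_1) as T2.
    assert (NZ : RtoC (INR (fact k)) <> RtoC 0) by (intros Q; apply RtoC_inj in Q; apply (INR_fact_neq_0 k Q)).
    assert (Q : (c k * INR (fact k))%C = (RtoC (/ INR (fact k)) * INR (fact k))%C).
    { rewrite <- T1, <- T2; [reflexivity| |].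
      - intros t Ht. rewrite CSeries_real_power. unfold Cexp. rewrite re_RtoC, im_RtoC, cos_0, sin_0. f_equal.
        + symmetry. rewrite Rmult_1_r. apply is_pseries_unique, is_exp_Reals.
        + unfold PSeries. rewrite (Series_ext _ (fun k => 0 * 0)).
          * rewrite Series_scal_l. ring.
          * intros n. rewrite im_RtoC. ring.
      - intros t Ht. symmetry. apply CSeries_unique, S1. rewrite Cmod_R. exact Ht. }
    rewrite <- (Cmult_1_r (c k)), <- (Cinv_r (INR (fact k))) by auto.
    rewrite Cmult_assoc, Q. rewrite <- Cmult_assoc, Cinv_r by auto. ring. }
  specialize (S1 w Hw). eapply Clim_ext; [|exact S1]. intros n. apply Csum_ext. intros k _. rewrite E. reflexivity.
Qed.

Definition expm1_coef (k : nat) : C := RtoC (/ INR (fact (S k))).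

Lemma geom_bounded_expm1_coef : geom_bounded expm1_coef 1.
Proof.
  exists 1. intros k. unfold expm1_coef. rewrite pow1, Cmod_R, Rabs_pos_eq.
  - rewrite Rmult_1_r. rewrite <- Rinv_1. apply Rinv_le_contravar; [lra|].
    change 1 with (INR 1). apply le_INR, lt_O_fact.
  - apply Rlt_le, Rinv_0_lt_compat, INR_fact_lt_0.
Qed.

Lemma expm1_series : exists d, 0 < d /\ forall w, Cmod w < d -> w <> RtoC 0 ->
  CSeries (fun k => expm1_coef k * w ^ k)%C = ((Cexp w - 1) / w)%C.
Proof.
  destruct Cexp_series as [d [Hd H]]. exists d. split; [exact Hd|]. intros w Hw Hw0.
  apply CSeries_unique. specialize (H w Hw). apply Clim_incr in H.
  apply Clim_ext with (fun n => / w * (Csum (fun k => RtoC (/ INR (fact k)) * w ^ k)%C (S n) - 1))%C.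
  - intros n. induction n as [|n IH].
    + simpl. rewrite Rinv_1. field. exact Hw0.
    + change (Csum (fun k => expm1_coef k * w ^ k)%C (S n)) with
        (Csum (fun k => expm1_coef k * w ^ k)%C n + expm1_coef n * w ^ n)%C.
      rewrite <- IH.
      change (Csum (fun k => RtoC (/ INR (fact k)) * w ^ k)%C (S (S n))) with
       (Csum (fun k => RtoC (/ INR (fact k)) * w ^ k)%C (S n) + expm1_coef n * w ^ S n)%C.
      rewrite Cpow_S. field. exact Hw0.
  - replace ((Cexp w - 1) / w)%C with (/ w * (Cexp w - 1))%C by (unfold Cdiv; ring).
    apply Clim_scal. apply Clim_minus; [exact H|apply Clim_const].
Qed.

Definition f_coef (f : R -> C) (n : nat) : C := (taylor0 f n / INR (fact n))%C.

(** Convergence at one [t > 0] bounds the terms, which gives the rate [q = 1 / t]. Taking [t <= 1]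
    makes [q >= 1], so that the same rate also serves the coefficients of [(e^t - 1) / t]. *)
Lemma f_coef_bound (f : R -> C) : real_analytic0 f -> exists q d, 1 <= q /\ 0 < d /\ geom_bounded (f_coef f) q /\
  forall t, Rabs t < d -> f t = CSeries (fun k => f_coef f k * RtoC t ^ k)%C.
Proof.
  intros [d H]. pose proof (cond_pos d) as Hd.
  assert (S : forall t, Rabs t < d -> is_Cseries (fun k => f_coef f k * RtoC t ^ k)%C (f t)).
  { intros t Ht. apply is_series_Cseries. apply H. change (Rabs (t - 0) < d). rewrite Rminus_0_r. exact Ht. }
  destruct (pos_min2 (d / 2) 1 ltac:(lra) Rlt_0_1) as (t & Ht & Ht1 & Ht2).
  destruct (Cseries_bounded _ _ (S t ltac:(rewrite Rabs_pos_eq; lra))) as [M HM].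
  exists (/ t), d. split; [|split; [exact Hd|split]].
  - rewrite <- Rinv_1. apply Rinv_le_contravar; auto.
  - exists M. intros k. specialize (HM k). rewrite Cmod_mult, Cmod_pow, Cmod_R, Rabs_pos_eq in HM by lra.
    apply Rmult_le_reg_r with (t ^ k); [apply pow_lt; auto|].
    rewrite Rmult_assoc, <- Rpow_mult_distr, Rinv_l, pow1 by lra. lra.
  - intros t' Ht'. symmetry. apply CSeries_unique, S, Ht'.
Qed.

Lemma f_coef_0 (f : R -> C) : f_coef f 0 = f 0.
Proof.
  unfold f_coef, taylor0. simpl.
  replace (Re (f 0), Im (f 0)) with (f 0) by apply C_surj. field.
Qed.

Lemma CSeries_at_0 (a : nat -> C) : CSeries (fun k => a k * RtoC 0 ^ k)%C = a O.
Proof.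
  apply CSeries_unique. intros eps He. exists 1%nat. intros n Hn.
  assert (E : Csum (fun k => a k * RtoC 0 ^ k)%C n = a O).
  { destruct n as [|n]; [lia|]. clear. induction n as [|n IH].
    - simpl. ring.
    - change (Csum (fun k => a k * RtoC 0 ^ k)%C (S (S n))) with
        (Csum (fun k => a k * RtoC 0 ^ k)%C (S n) + a (S n) * RtoC 0 ^ S n)%C.
      rewrite IH, Cpow_S. ring. }
  rewrite E. replace (a O - a O)%C with (RtoC 0) by ring. rewrite Cmod_0. exact He.
Qed.

Definition mod_coef (f : R -> C) : nat -> C := Cconv expm1_coef (f_coef f).

Lemma mod_coef_0 (f : R -> C) : mod_coef f 0 = f 0.
Proof.
  unfold mod_coef, Cconv. simpl. rewrite f_coef_0. unfold expm1_coef. simpl. rewrite Rinv_1. ring.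
Qed.

Lemma mod_coef_bound (f : R -> C) : real_analytic0 f -> exists q, 0 < q /\ geom_bounded (mod_coef f) q.
Proof.
  intros Hf. destruct (f_coef_bound f Hf) as (q & d & Hq & Hd & Hb & _).
  exists (2 * q). split; [lra|]. apply geom_bounded_conv; [lra| |exact Hb].
  apply geom_bounded_pos with 1; [apply geom_bounded_expm1_coef|lra].
Qed.

Lemma mod_product (f : R -> C) : real_analytic0 f -> exists d, 0 < d /\ forall w, Cmod w < d -> w <> RtoC 0 ->
  ((Cexp w - 1) / w * taylor_ext f w)%C = CSeries (fun k => mod_coef f k * w ^ k)%C.
Proof.
  intros Hf. destruct (f_coef_bound f Hf) as (q & d & Hq & Hd & Hb & _).
  destruct expm1_series as [d1 [Hd1 H1]].
  assert (Hiq : 0 < / q) by (apply Rinv_0_lt_compat; lra).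
  destruct (pos_min2 d1 (/ q) Hd1 Hiq) as (t & Ht & T1 & T2).
  exists t. split; [exact Ht|]. intros w Hw Hw0.
  assert (W1 : Cmod w < d1) by lra. assert (W2 : Cmod w < / q) by lra.
  rewrite <- H1 by auto.
  apply (power_series_mult expm1_coef (f_coef f) q); auto; try lra.
  - apply geom_bounded_pos with 1; [apply geom_bounded_expm1_coef|lra].
  - apply Rmult_lt_reg_l with (/ q); auto. rewrite <- Rmult_assoc, Rinv_l by lra. lra.
Qed.

Lemma Cexp_R (t : R) : Cexp t = RtoC (exp t).
Proof. unfold Cexp. rewrite re_RtoC, im_RtoC, cos_0, sin_0. unfold RtoC. f_equal; ring. Qed.

Lemma exp_m1_nz (t : R) : t <> 0 -> exp t - 1 <> 0.
Proof. intros H E. apply H, exp_inv. rewrite exp_0. lra. Qed.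

Lemma P_coef_mod (f : R -> C) : real_analytic0 f -> forall n, P_coef f n = (mod_coef f n * INR (fact n))%C.
Proof.
  intros Hf. destruct (mod_coef_bound f Hf) as (q & Hq & Hb).
  destruct (f_coef_bound f Hf) as (_ & d1 & _ & Hd1 & _ & Hs).
  destruct (mod_product f Hf) as (d2 & Hd2 & Hp).
  destruct (pos_min2 d1 d2 Hd1 Hd2) as (d & Hd & D1 & D2).
  apply (taylor0_power_series _ _ q d); auto.
  intros t Ht. unfold modulator. destruct (Req_EM_T t 0) as [->|Ht0].
  - rewrite CSeries_at_0. symmetry. apply mod_coef_0.
  - rewrite <- Hp; [|rewrite Cmod_R; lra|intros E; apply RtoC_inj in E; auto].
    rewrite Cexp_R, (Hs t), RtoC_div, RtoC_minus by (auto || lra). reflexivity.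
Qed.

(** The factor [e^t - 1] of the modulator cancels the one in the denominator of [dilate]; what
    remains is the power series of the modulator of [f] at [alpha t]. *)
Lemma P_coef_dilate (f : R -> C) (alpha : C) : real_analytic0 f -> alpha <> RtoC 0 ->
  forall n, P_coef (dilate alpha f) n = (alpha ^ n * P_coef f n)%C.
Proof.
  intros Hf Ha n. rewrite (P_coef_mod f Hf).
  destruct (mod_coef_bound f Hf) as (q & Hq & [M HM]).
  destruct (mod_product f Hf) as (d & Hd & Hp).
  assert (Hm : 0 < Cmod alpha) by (apply Cmod_gt_0; auto).
  replace (alpha ^ n * (mod_coef f n * INR (fact n)))%C with ((alpha ^ n * mod_coef f n) * INR (fact n))%C by ring.
  apply (taylor0_power_series _ (fun n => alpha ^ n * mod_coef f n)%C (Cmod alpha * q) (d / Cmod alpha)).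
  - exists M. intros k. rewrite Cmod_mult, Cmod_pow, Rpow_mult_distr.
    replace (M * (Cmod alpha ^ k * q ^ k)) with (Cmod alpha ^ k * (M * q ^ k)) by ring.
    apply Rmult_le_compat_l; auto. apply pow_le; lra.
  - apply Rmult_lt_0_compat; auto.
  - apply Rdiv_lt_0_compat; auto.
  - intros t Ht. rewrite (CSeries_ext _ (fun k => mod_coef f k * (alpha * t) ^ k)%C).
    2:{ intros k. rewrite Cpow_mult_l. ring. }
    unfold modulator, dilate. destruct (Req_EM_T t 0) as [->|Ht0].
    + destruct (Req_EM_T 0 0) as [_|N]; [|congruence].
      rewrite Cmult_0_r, CSeries_at_0. symmetry. apply mod_coef_0.
    + assert (NZt : RtoC t <> RtoC 0) by (intros E; apply RtoC_inj in E; auto).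
      assert (NZe : RtoC (exp t - 1) <> RtoC 0) by (intros E; apply RtoC_inj in E; apply (exp_m1_nz t Ht0 E)).
      rewrite <- Hp.
      * rewrite RtoC_div by auto. field. auto.
      * rewrite Cmod_mult, Cmod_R. apply Rmult_lt_reg_r with (/ Cmod alpha); [apply Rinv_0_lt_compat; auto|].
        replace (Cmod alpha * Rabs t * / Cmod alpha) with (Rabs t) by (field; lra). exact Ht.
      * apply Cmult_neq_0; auto.
Qed.

Lemma CV_radius_dilate (a : nat -> R) (l : R) : 0 < l ->
  CV_radius (fun n => l ^ n * a n) =
  match CV_radius a with Finite x => Finite (x / l) | p_infty => p_infty | m_infty => m_infty end.
Proof.
  intros Hl. destruct (CV_radius_bounded a) as [U1 U2].
  rewrite <- (is_lub_Rbar_unique _ _ (CV_radius_bounded (fun n => l ^ n * a n))).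
  apply is_lub_Rbar_unique. split.
  - intros r [M HM].
    assert (X : Rbar_le (l * r) (CV_radius a)).
    { apply U1. exists M. intros n. replace (a n * (l * r) ^ n) with (l ^ n * a n * r ^ n) by (rewrite Rpow_mult_distr; ring). auto. }
    destruct (CV_radius a) as [x| |]; simpl in *; auto.
    apply Rmult_le_reg_r with l; auto. unfold Rdiv. rewrite Rmult_assoc, Rinv_l; lra.
  - intros b Hb.
    assert (X : forall r, (exists M, forall n, Rabs (a n * r ^ n) <= M) -> Rbar_le (r / l) b).
    { intros r [M HM]. apply Hb. exists M. intros n.
      replace (l ^ n * a n * (r / l) ^ n) with (a n * r ^ n); auto.
      unfold Rdiv. rewrite Rpow_mult_distr, pow_inv. field. apply pow_nonzero; lra. }
    destruct b as [b| |].
    + assert (Y : Rbar_le (CV_radius a) (b * l)).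
      { apply U2. intros r Hr. specialize (X r Hr). simpl in *.
        apply (Rmult_le_compat_r l) in X; [|lra]. unfold Rdiv in X. rewrite Rmult_assoc, Rinv_l in X; lra. }
      destruct (CV_radius a) as [x| |]; simpl in *; auto.
      apply Rmult_le_reg_r with l; auto. unfold Rdiv. rewrite Rmult_assoc, Rinv_l; lra.
    + destruct (CV_radius a); simpl; auto.
    + exfalso. apply (X 0). exists (Rabs (a O)). intros [|n]; simpl.
      * rewrite Rmult_1_r. lra.
      * rewrite Rmult_0_l, Rmult_0_r, Rabs_R0. apply Rabs_pos.
Qed.

Lemma rho_dilate (f : R -> C) (alpha : C) : real_analytic0 f -> alpha <> RtoC 0 ->
  rho (dilate alpha f) =
  match rho f with Finite x => Finite (x / Cmod alpha) | p_infty => p_infty | m_infty => m_infty end.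
Proof.
  intros Hf Ha. unfold rho. rewrite <- CV_radius_dilate by (apply Cmod_gt_0; auto).
  apply CV_radius_ext. intros n. rewrite P_coef_dilate, Cmod_mult, Cmod_pow by auto. reflexivity.
Qed.

Lemma r_dilate (f : R -> C) (alpha : C) : real_analytic0 f -> alpha <> RtoC 0 -> Rbar_lt 0 (rho f) ->
  r_ (dilate alpha f) = Cmod alpha * r_ f /\ Rbar_lt 0 (rho (dilate alpha f)).
Proof.
  intros Hf Ha Hr. unfold r_. rewrite rho_dilate by auto.
  assert (Hm : 0 < Cmod alpha) by (apply Cmod_gt_0; auto).
  destruct (rho f) as [x| |]; simpl in *; [|split; [ring|auto]|tauto].
  split; [field; lra|apply Rdiv_lt_0_compat; auto].
Qed.

Lemma geom_bounded_fact (a : nat -> C) (q : R) : geom_bounded a q -> geom_bounded (fun n => a n / INR (fact n))%C q.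
Proof.
  intros [M HM]. exists M. intros k. eapply Rle_trans; [|apply HM].
  rewrite Cmod_div by (intros Q; apply RtoC_inj in Q; apply (INR_fact_neq_0 k Q)).
  rewrite Cmod_R, Rabs_pos_eq by apply pos_INR.
  assert (1 <= INR (fact k)) by (change 1 with (INR 1); apply le_INR, lt_O_fact).
  apply Rmult_le_reg_r with (INR (fact k)); [lra|].
  unfold Rdiv. rewrite Rmult_assoc, Rinv_l, Rmult_1_r by lra. pose proof (Cmod_ge_0 (a k)). nra.
Qed.

(** The Taylor coefficients of [t -> p_f(-t)] are computed twice, by substitution in the power
    series and from the parity hypothesis. Even and odd modulators are the cases [e = 1] and
    [e = -1]. *)
Lemma modulator_parity (f : R -> C) (e : C) : Rbar_lt 0 (rho f) ->
  (forall z, modulator_ext f (- z)%C = (e * modulator_ext f z)%C) ->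
  forall n, ((- (1)) ^ n * P_coef f n)%C = (e * P_coef f n)%C.
Proof.
  intros Hrho He n.
  pose proof (r_nonneg f Hrho) as Hr.
  pose proof (P_coef_bound f (r_ f + 1) Hrho ltac:(lra)) as Hb.
  set (q := r_ f + 1) in *. assert (Hq : 0 < q) by (unfold q; lra).
  set (a := fun k => (P_coef f k / INR (fact k))%C).
  assert (Ha : geom_bounded a q) by (apply geom_bounded_fact; exact Hb).
  assert (NZ : RtoC (INR (fact n)) <> RtoC 0) by (intros Q; apply RtoC_inj in Q; apply (INR_fact_neq_0 n Q)).
  assert (Gs : forall k : C, Cmod k <= 1 -> geom_bounded (fun n => k ^ n * a n)%C q).
  { intros k Hk. destruct Ha as [M HM]. exists M. intros m. rewrite Cmod_mult, Cmod_pow.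
    assert (Cmod k ^ m <= 1) by (rewrite <- (pow1 m); apply pow_incr; split; [apply Cmod_ge_0|auto]).
    specialize (HM m). pose proof (Cmod_ge_0 (a m)). nra. }
  assert (T1 : taylor0 (fun t => modulator_ext f (- RtoC t)%C) n = ((- (1)) ^ n * a n * INR (fact n))%C).
  { apply (taylor0_power_series _ (fun n => (- (1)) ^ n * a n)%C q 1); auto; try lra.
    - apply Gs. rewrite Cmod_opp, Cmod_1. lra.
    - intros t _. apply CSeries_ext. intros k.
      change (a k * (- RtoC t) ^ k = (- (1)) ^ k * a k * t ^ k)%C.
      replace (- RtoC t)%C with (- (1) * t)%C by ring. rewrite Cpow_mult_l. ring. }
  assert (T2 : taylor0 (fun t => modulator_ext f (- RtoC t)%C) n = (e * a n * INR (fact n))%C).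
  { apply (taylor0_power_series _ (fun n => e * a n)%C q (/ q)); auto.
    - destruct Ha as [M HM]. exists (Cmod e * M). intros m. rewrite Cmod_mult, Rmult_assoc.
      apply Rmult_le_compat_l; [apply Cmod_ge_0|auto].
    - apply Rinv_0_lt_compat; auto.
    - intros t Ht. rewrite He. symmetry. apply CSeries_unique.
      eapply Clim_ext; [intros m; symmetry; rewrite <- (Csum_scal e (fun k => a k * t ^ k)%C); apply Csum_ext; intros k _; ring|].
      apply Clim_scal. apply (power_series_converges a q); auto; [lra|].
      rewrite Cmod_R. apply Rmult_lt_reg_l with (/ q); [apply Rinv_0_lt_compat; auto|].
      rewrite <- Rmult_assoc, Rinv_l by lra. lra. }
  rewrite T1 in T2. unfold a in T2.
  replace (P_coef f n) with (P_coef f n / INR (fact n) * INR (fact n))%C by (field; auto).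
  rewrite !Cmult_assoc. exact T2.
Qed.

(** * Primitives on slit domains *)

Lemma CRInt_swap (f : R -> C) (a b : R) : ex_CRInt f a b -> CRInt f b a = (- CRInt f a b)%C.
Proof. intros H. symmetry. exact (opp_RInt_swap (V := C_R_CompleteNormedModule) f a b H). Qed.

Lemma ex_CRInt_swap (f : R -> C) (a b : R) : ex_CRInt f a b -> ex_CRInt f b a.
Proof. exact (ex_RInt_swap (V := C_R_CompleteNormedModule) f a b). Qed.

Lemma RectInt_hswap (g : C -> C) (a b c d : R) : rect_sides g a b c d ->
  RectInt g b a c d = (- RectInt g a b c d)%C.
Proof.
  intros (H1 & H2 & _). unfold RectInt.
  rewrite (CRInt_swap (fun x => g (x, c)) a b H1), (CRInt_swap (fun x => g (x, d)) a b H2). ring.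
Qed.

Lemma RectInt_vswap (g : C -> C) (a b c d : R) : rect_sides g a b c d ->
  RectInt g a b d c = (- RectInt g a b c d)%C.
Proof.
  intros (_ & _ & H1 & H2). unfold RectInt.
  rewrite (CRInt_swap (fun y => g (b, y)) c d H1), (CRInt_swap (fun y => g (a, y)) c d H2). ring.
Qed.

Lemma goursat_signed (g : C -> C) (a b c d : R) :
  (forall x y, Rmin a b <= x <= Rmax a b -> Rmin c d <= y <= Rmax c d -> holo g (x, y)) ->
  RectInt g a b c d = RtoC 0.
Proof.
  intros H.
  assert (V : forall p q r s, p <= q -> r <= s -> (forall x y, p <= x <= q -> r <= y <= s -> holo g (x, y)) ->
     RectInt g p q r s = RtoC 0 /\ RectInt g p q s r = RtoC 0 /\ RectInt g q p r s = RtoC 0 /\ RectInt g q p s r = RtoC 0).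
  { intros p q r s Hpq Hrs Hg.
    assert (S : rect_sides g p q r s) by (apply rect_sides_cont_all; auto; intros; apply holo_cont, Hg; auto).
    assert (S' : rect_sides g q p r s).
    { destruct S as (S1 & S2 & S3 & S4). repeat split; auto using ex_CRInt_swap. }
    rewrite (RectInt_vswap g q p r s S'), (RectInt_vswap g p q r s S), (RectInt_hswap g p q r s S), goursat by auto.
    repeat split; ring. }
  destruct (Rle_dec a b) as [H1|H1]; destruct (Rle_dec c d) as [H2|H2].
  - rewrite (Rmin_left a b), (Rmax_right a b), (Rmin_left c d), (Rmax_right c d) in H by lra. apply (V a b c d); auto.
  - rewrite (Rmin_left a b), (Rmax_right a b), (Rmin_right c d), (Rmax_left c d) in H by lra. apply (V a b d c); auto; lra.
  - rewrite (Rmin_right a b), (Rmax_left a b), (Rmin_left c d), (Rmax_right c d) in H by lra. apply (V b a c d); auto; lra.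
  - rewrite (Rmin_right a b), (Rmax_left a b), (Rmin_right c d), (Rmax_left c d) in H by lra. apply (V b a d c); auto; lra.
Qed.

Lemma CRInt_le_signed (f : R -> C) (a b M : R) :
  (forall t, Rmin a b <= t <= Rmax a b -> Cmod (f t) <= M) -> ex_CRInt f a b ->
  Cmod (CRInt f a b) <= Rabs (b - a) * M.
Proof.
  intros H Hex. destruct (Rle_dec a b) as [H1|H1].
  - rewrite Rmin_left, Rmax_right in H by lra. rewrite Rabs_pos_eq by lra.
    apply (CRInt_le f); auto. apply CRInt_correct, Hex.
  - rewrite Rmin_right, Rmax_left in H by lra. rewrite Rabs_left by lra.
    rewrite (CRInt_swap f b a (ex_CRInt_swap f a b Hex)), Cmod_opp. replace (- (b - a)) with (a - b) by ring.
    apply (CRInt_le f); [lra|auto|]. apply CRInt_correct, ex_CRInt_swap, Hex.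
Qed.

Lemma CRInt_const (k : C) (a b : R) : is_CRInt (fun _ => k) a b ((b - a)%R * k)%C.
Proof. rewrite <- scal_R_Cmult. exact (is_RInt_const (V := C_R_NormedModule) a b k). Qed.

Lemma CRInt_near_const (f : R -> C) (k : C) (a b M : R) :
  (forall t, Rmin a b <= t <= Rmax a b -> Rcont f t) ->
  (forall t, Rmin a b <= t <= Rmax a b -> Cmod (f t - k) <= M) ->
  Cmod (CRInt f a b - (b - a)%R * k) <= Rabs (b - a) * M.
Proof.
  intros Hc H.
  assert (E1 : ex_CRInt f a b) by (apply ex_CRInt_cont; auto).
  assert (E2 : ex_CRInt (fun _ => (- k)%C) a b) by (eexists; apply CRInt_const).
  replace (CRInt f a b - (b - a)%R * k)%C with (CRInt (fun t => f t + - k)%C a b).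
  - apply CRInt_le_signed; [exact H|]. exact (ex_RInt_plus (V := C_R_NormedModule) f (fun _ => (- k)%C) a b E1 E2).
  - rewrite CRInt_plus by assumption. rewrite (CRInt_unique _ _ _ _ (CRInt_const (- k) a b)). cring.
Qed.

Lemma Rmin_Rmax_between (a b x : R) : Rmin a b <= x <= Rmax a b -> Rabs (x - a) <= Rabs (b - a).
Proof.
  intros H. destruct (Rle_dec a b).
  - rewrite Rmin_left, Rmax_right in H by lra. rewrite !Rabs_pos_eq; lra.
  - rewrite Rmin_right, Rmax_left in H by lra. rewrite !Rabs_left1; lra.
Qed.

(* The primitive integrates along the base line Re = x0, then horizontally. *)
Lemma primitive_horizontal (h : C -> C) (D : R -> R -> Prop) (x0 : R) :
  (forall x y, D x y -> holo h (x, y)) ->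
  (forall x y, D x y -> exists e, 0 < e /\ forall x' y',
     Rmin x0 x - e <= x' <= Rmax x0 x + e -> Rabs (y' - y) <= e -> D x' y') ->
  (forall x y y', D x y -> Rmin 0 y <= y' <= Rmax 0 y -> D x0 y') ->
  exists A : C -> C, forall x y, D x y -> Cderive A (x, y) (h (x, y)).
Proof.
  intros Hh Htube Hbase.
  exists (fun w => Ci * CRInt (fun t => h (x0, t)) 0 (Im w) + CRInt (fun t => h (t, Im w)) x0 (Re w))%C.
  intros x y HD. apply Cderive_eps. intros eps He.
  destruct (Htube x y HD) as [e [He0 Ht]].
  destruct (holo_cont _ _ (Hh x y HD) (eps / 2) ltac:(lra)) as [d [Hd Hc]].
  destruct (pos_min2 e (d / 2) He0 ltac:(lra)) as (t0 & Ht0 & T1 & T2). exists t0. split; [exact Ht0|].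
  intros [x' y'] Hw.
  assert (Hw1 : Cmod ((x', y') - (x, y)) < e) by lra.
  assert (Hw2 : Cmod ((x', y') - (x, y)) < d / 2) by lra.
  pose proof (re_le_Cmod ((x', y') - (x, y))) as Bx. pose proof (im_le_Cmod ((x', y') - (x, y))) as By.
  change (Rabs (x' - x) <= Cmod ((x', y') - (x, y))) in Bx.
  change (Rabs (y' - y) <= Cmod ((x', y') - (x, y))) in By.
  set (m := Cmod ((x', y') - (x, y))) in *.
  assert (Bx1 := proj1 (Rabs_le_between _ _) Bx). assert (By1 := proj1 (Rabs_le_between _ _) By).
  change (Im (x', y')) with y'. change (Re (x', y')) with x'. change (Im (x, y)) with y. change (Re (x, y)) with x.
  pose proof (Rmin_l x0 x) as L1. pose proof (Rmax_l x0 x) as L2. pose proof (Rmin_r x0 x) as L3. pose proof (Rmax_r x0 x) as L4.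
  assert (HC : forall u v, Rmin x0 x - e <= u <= Rmax x0 x + e -> Rabs (v - y) <= e -> Ccont h (u, v)).
  { intros u v Hu Hv. apply holo_cont, Hh, Ht; auto. }
  assert (Ly : forall v, Rmin y y' <= v <= Rmax y y' -> Rabs (v - y) <= e).
  { intros v Hv. apply Rmin_Rmax_between in Hv. lra. }
  assert (Lx : forall u, Rmin x x' <= u <= Rmax x x' -> Rabs (u - x) <= m).
  { intros u Hu. apply Rmin_Rmax_between in Hu. lra. }
  assert (Lx' : forall u, Rmin x x' <= u <= Rmax x x' -> Rmin x0 x - e <= u <= Rmax x0 x + e).
  { intros u Hu. apply Lx, Rabs_le_between in Hu. lra. }
  assert (E1 : ex_CRInt (fun t => h (x0, t)) 0 y).
  { apply ex_CRInt_cont. intros t Hty. apply Rcont_vert, holo_cont, Hh. apply (Hbase x y); auto. }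
  assert (E2 : ex_CRInt (fun t => h (x0, t)) y y').
  { apply ex_CRInt_cont. intros t Hty. apply Rcont_vert, HC; [lra|auto]. }
  assert (E3 : ex_CRInt (fun t => h (t, y')) x0 x).
  { apply ex_CRInt_cont. intros t Htx. apply Rcont_horiz, HC; [lra|lra]. }
  assert (C4 : forall t, Rmin x x' <= t <= Rmax x x' -> Rcont (fun t => h (t, y')) t).
  { intros t Htx. apply Rcont_horiz, HC; [auto|lra]. }
  assert (C5 : forall t, Rmin y y' <= t <= Rmax y y' -> Rcont (fun t => h (x, t)) t).
  { intros t Hty. apply Rcont_vert, HC; [lra|auto]. }
  assert (E4 : ex_CRInt (fun t => h (t, y')) x x') by (apply ex_CRInt_cont; auto).
  (* Goursat's theorem on the rectangle between the heights [y] and [y'] moves the horizontal leg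
     from one height to the other. The increment of the primitive becomes an integral over two short
     segments near [(x, y)], and the tube hypothesis is what makes the rectangle available. *)
  assert (G : RectInt h x0 x y y' = RtoC 0).
  { apply goursat_signed. intros u v Hu Hv. apply Hh, Ht; [lra|auto]. }
  unfold RectInt in G.
  rewrite <- (CRInt_Chasles _ 0 y y' E1 E2), <- (CRInt_Chasles _ x0 x x' E3 E4).
  assert (N1 : Cmod (CRInt (fun t => h (x, t)) y y' - (y' - y)%R * h (x, y)) <= Rabs (y' - y) * (eps / 2)).
  { apply CRInt_near_const; auto. intros t Hty. apply Rlt_le, Hc.
    change (Cmod (((x - x)%R, (t - y)%R) : C) < d).
    eapply Rle_lt_trans; [apply Cmod_le_abs|]. change (Rabs (x - x) + Rabs (t - y) < d).
    apply Rmin_Rmax_between in Hty. rewrite Rminus_diag, Rabs_R0. lra. }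
  assert (N2 : Cmod (CRInt (fun t => h (t, y')) x x' - (x' - x)%R * h (x, y)) <= Rabs (x' - x) * (eps / 2)).
  { apply CRInt_near_const; auto. intros t Htx. apply Rlt_le, Hc.
    change (Cmod (((t - x)%R, (y' - y)%R) : C) < d).
    eapply Rle_lt_trans; [apply Cmod_le_abs|]. change (Rabs (t - x) + Rabs (y' - y) < d).
    apply Lx in Htx. lra. }
  set (I1 := CRInt (fun t => h (x, t)) y y') in *. set (I2 := CRInt (fun t => h (t, y')) x x') in *.
  set (J1 := CRInt (fun t => h (x0, t)) 0 y) in *. set (J2 := CRInt (fun t => h (x0, t)) y y') in *.
  set (K1 := CRInt (fun t => h (t, y')) x0 x) in *. set (K2 := CRInt (fun t => h (t, y)) x0 x) in *.
  rewrite Cminus_pair, (C_re_im (x' - x) (y' - y)).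
  replace (Ci * (J1 + J2) + (K1 + I2) - (Ci * J1 + K2) - h (x, y) * ((x' - x)%R + Ci * (y' - y)%R))%C
   with (Ci * (I1 - (y' - y)%R * h (x, y)) + (I2 - (x' - x)%R * h (x, y)) - (K2 - K1 + Ci * (I1 - J2)))%C by ring.
  rewrite G. replace (Ci * (I1 - (y' - y)%R * h (x, y)) + (I2 - (x' - x)%R * h (x, y)) - 0)%C
   with (Ci * (I1 - (y' - y)%R * h (x, y)) + (I2 - (x' - x)%R * h (x, y)))%C by ring.
  eapply Rle_trans; [apply Cmod_triangle|]. rewrite Cmod_mult, Cmod_Ci, Rmult_1_l.
  nra.
Qed.

(** Besides the negative axis and the disc of radius [rho], the rays of the imaginary axis from
    [i m] and [- i m] outwards are removed. For the kernel these rays carry the poles beyond the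
    contour, and what is left is simply connected. *)
Definition slit_domain (rho m : R) (z : C) : Prop :=
  off_slit z /\ rho < Cmod z /\ (Re z <> 0 \/ Rabs (Im z) < m).

(** In the coordinate [w = log z] the domain is a half-strip [|Im w| < PI] without the half-lines
    [Re w >= ln m], [Im w = PI / 2] or [- PI / 2]. Each point is joined horizontally to the base
    line [Re w = ln c], so [primitive_horizontal] applies to [g (e^w) e^w]; composing with [Clog]
    returns to [z]. *)
Lemma primitive_slit (g : C -> C) (rho c m : R) : 0 < rho < c -> c < m ->
  (forall z, slit_domain rho m z -> holo g z) ->
  exists A : C -> C, forall z, slit_domain rho m z -> Cderive A z (g z).
Proof.
  intros Hc Hm Hg. pose proof PI_RGT_0 as Hpi.
  set (D := fun x y => ln rho < x /\ - PI < y < PI /\ (x < ln m \/ cos y <> 0)).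
  assert (HD : forall x y, D x y -> slit_domain rho m (Cexp (x, y))).
  { intros x y (H1 & H2 & H3).
    assert (M : Cmod (Cexp (x, y)) = exp x) by apply Cmod_Cexp.
    assert (Hx : rho < exp x) by (rewrite <- (exp_ln rho) by lra; apply exp_increasing; auto).
    assert (Px := exp_pos x).
    split; [|split].
    - unfold off_slit. change (Re (Cexp (x, y))) with (exp x * cos y). change (Im (Cexp (x, y))) with (exp x * sin y).
      destruct (Req_dec y 0) as [->|Hy]; [left; rewrite cos_0; lra|right].
      apply Rmult_integral_contrapositive_currified; [lra|].
      destruct (Rlt_le_dec y 0); [pose proof (sin_lt_0_var y)|pose proof (sin_gt_0 y)]; lra.
    - rewrite M. exact Hx.
    - destruct H3 as [H3|H3].
      + right. eapply Rle_lt_trans; [apply im_le_Cmod|]. rewrite M.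
        rewrite <- (exp_ln m) by lra. apply exp_increasing; auto.
      + left. change (exp x * cos y <> 0). apply Rmult_integral_contrapositive_currified; lra. }
  assert (Lc : ln rho < ln c < ln m) by (split; apply ln_increasing; lra).
  destruct (primitive_horizontal (fun w => g (Cexp w) * Cexp w)%C D (ln c)) as [A HA].
  - intros x y H. apply holo_mult; [|eexists; apply Cderive_Cexp].
    apply (holo_comp g Cexp); [apply Hg, HD, H|eexists; apply Cderive_Cexp].
  - intros x y (H1 & H2 & H3).
    assert (X1 : ln rho < Rmin (ln c) x) by (apply Rmin_glb_lt; lra).
    assert (X : exists e, 0 < e /\ forall x' y', x' <= Rmax (ln c) x + e -> Rabs (y' - y) <= e -> x' < ln m \/ cos y' <> 0).
    { destruct H3 as [H3|H3].
      - assert (Rmax (ln c) x < ln m) by (apply Rmax_lub_lt; lra).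
        exists ((ln m - Rmax (ln c) x) / 2). split; [lra|]. intros. left. lra.
      - assert (Hcc : continuity_pt cos y) by apply continuity_cos.
        destruct (Hcc (Rabs (cos y)) (Rabs_pos_lt _ H3)) as [d [Hd Hdc]].
        exists (d / 2). split; [lra|]. intros x' y' _ Hy'. right. intros E.
        destruct (Req_dec y' y) as [->|Hn]; [auto|].
        specialize (Hdc y'). simpl in Hdc. unfold R_dist in Hdc. rewrite E, Rminus_0_l, Rabs_Ropp in Hdc.
        assert (Rabs (cos y) < Rabs (cos y)); [|lra]. apply Hdc. split; [split; auto; exact I|lra]. }
    destruct X as [e [He0 He1]].
    destruct (pos_min2 e ((Rmin (ln c) x - ln rho) / 2) He0 ltac:(lra)) as (e1 & P0 & P1 & P2).
    destruct (pos_min3 e1 ((PI - y) / 2) ((PI + y) / 2) P0 ltac:(lra) ltac:(lra)) as (e' & P3 & P4 & P5 & P6).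
    exists e'. split; [auto|]. intros x' y' Hx' Hy'. pose proof (proj1 (Rabs_le_between _ _) Hy').
    split; [lra|split; [lra|]]. apply He1; lra.
  - intros x y y' (H1 & H2 & H3) Hy'. apply Rmin_Rmax_between in Hy'. rewrite !Rminus_0_r in Hy'.
    split; [lra|split; [|left; lra]].
    assert (Rabs y < PI) by (apply Rabs_lt_between; lra).
    apply Rabs_lt_between. lra.
  - exists (fun z => A (Clog z)). intros z (H1 & H2 & H3).
    pose proof (off_slit_nz z H1) as Hz.
    assert (HDz : D (ln (Cmod z)) (Carg z)).
    { split; [apply ln_increasing; lra|split; [apply Carg_off_slit; auto|]].
      destruct H3 as [H3|H3].
      - right. rewrite cos_Carg by auto. apply Rmult_integral_contrapositive_currified; auto.
        apply Rinv_neq_0_compat. lra.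
      - destruct (Req_dec (Re z) 0) as [E|E].
        + left. apply ln_increasing; [lra|]. eapply Rle_lt_trans; [apply Cmod_le_abs|]. rewrite E, Rabs_R0. lra.
        + right. rewrite cos_Carg by auto. apply Rmult_integral_contrapositive_currified; auto.
          apply Rinv_neq_0_compat. lra. }
    eapply Cderive_eq.
    + apply (Cderive_comp A Clog); [apply (HA _ _ HDz)|apply Cderive_Clog; auto].
    + cbv beta. change (ln (Cmod z), Carg z) with (Clog z). rewrite Cexp_Clog by auto. cfield. exact Hz.
Qed.

Lemma Cexp_eq_1 (z : C) : Cexp z = RtoC 1 -> exists k : Z, z = (0, 2 * PI * IZR k).
Proof.
  intros E.
  assert (Hr : Re z = 0). { apply exp_inv. rewrite <- Cmod_Cexp, E, exp_0. apply Cmod_1. }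
  unfold Cexp in E. rewrite Hr, exp_0 in E. injection E; intros E2 E1.
  rewrite Rmult_1_l in E1.
  assert (H : sin (Im z / 2) = 0).
  { replace (Im z) with (2 * (Im z / 2)) in E1 by field. rewrite cos_2a_sin in E1. nra. }
  apply sin_eq_0_0 in H. destruct H as [k Hk]. exists k.
  rewrite (C_surj z), Hr. f_equal. lra.
Qed.

(** * Hankel integrals *)

Lemma Rcont_plus (f g : R -> C) (t : R) : Rcont f t -> Rcont g t -> Rcont (fun u => f u + g u)%C t.
Proof. exact (continuous_plus (K := R_AbsRing) (V := C_R_NormedModule) f g t). Qed.

Lemma Rcont_scal (k : C) (f : R -> C) (t : R) : Rcont f t -> Rcont (fun u => k * f u)%C t.
Proof.
  apply (Rcont_comp (fun w => k * w)%C). apply holo_cont, holo_mult; [apply holo_const|apply holo_id].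
Qed.

(** Differentiation under the integral sign: for each [t] a derivative with a quadratic remainder
    uniform in [t] is chosen, and integrating the remainder keeps it quadratic. The chosen
    derivative must be integrable; it is continuous in [t] because difference quotients at the
    single point [s0 + h] approximate it uniformly. *)
Lemma CRInt_param_holo (K : C -> R -> C) (a b : R) (s0 : C) (r M : R) : a <= b -> 0 < r ->
  (forall s t, in_square s0 r s -> a <= t <= b -> holo (fun s => K s t) s) ->
  (forall s t, in_square s0 r s -> a <= t <= b -> Rcont (K s) t) ->
  (forall s t, in_square s0 r s -> a <= t <= b -> Cmod (K s t) <= M) ->
  holo (fun s => CRInt (K s) a b) s0.
Proof.
  intros Hab Hr Hh Hc HM.
  assert (Hs0 : in_square s0 r s0) by (split; lra).
  set (N := 3 * M / r ^ 2).
  assert (HM0 : 0 <= M) by (eapply Rle_trans; [apply Cmod_ge_0|apply (HM s0 a); auto; lra]).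
  assert (HN : 0 <= N) by (apply Rdiv_le_0_compat; [lra|apply pow_lt; auto]).
  assert (A : forall t, exists c, a <= t <= b -> forall w, Cmod (w - s0) <= r / 2 ->
    Cmod (K w t - K s0 t - c * (w - s0)) <= N * Cmod (w - s0) ^ 2).
  { intros t. destruct (classic (a <= t <= b)) as [Ht|Ht]; [|exists 0; tauto].
    destruct (taylor_square_2 (fun s => K s t) s0 r M Hr) as (c & _ & _ & Hc' & _); auto. exists (c 1%nat). auto. }
  set (K' := fun t => proj1_sig (constructive_indefinite_description _ (A t))).
  assert (HK' : forall t, a <= t <= b -> forall w, Cmod (w - s0) <= r / 2 ->
    Cmod (K w t - K s0 t - K' t * (w - s0)) <= N * Cmod (w - s0) ^ 2)
    by (intros t; exact (proj2_sig (constructive_indefinite_description _ (A t)))).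
  clearbody K'.
  assert (X0 : forall w, Cmod (w - s0) <= r / 2 -> in_square s0 r w) by (intros w Hw; apply disc_in_square; lra).
  assert (CK : ex_CRInt K' a b).
  (* Outside [[a, b]] the chosen [K'] is arbitrary; clamping [t] to the interval gives a function
     that is continuous from both sides at the end points too. *)
  { apply ex_CRInt_ext with (fun t => K' (Rmax a (Rmin t b))).
    { intros t Ht. rewrite Rmin_left, Rmax_right in Ht by auto. f_equal. rewrite Rmin_left, Rmax_right; lra. }
    apply ex_CRInt_cont. intros t Ht. rewrite Rmin_left, Rmax_right in Ht by auto.
    apply Rcont_eps. intros eps He.
    destruct (Rdiv_add1_le N (eps / 4) HN ltac:(lra)) as [Hq0 Hq1].
    destruct (pos_min2 (r / 2) _ ltac:(lra) Hq0) as (h & Hh0 & Hh1 & Hh3).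
    assert (Hh2 : N * h <= eps / 4) by nra.
    set (w := (s0 + h)%C).
    assert (Hw : Cmod (w - s0) = h).
    { unfold w. replace (s0 + h - s0)%C with (RtoC h) by ring. rewrite Cmod_R. apply Rabs_pos_eq; lra. }
    assert (Q : Rcont (fun u => K w u + (- (1)) * K s0 u)%C t).
    { apply Rcont_plus; [apply Hc; auto; apply X0; lra|]. apply Rcont_scal, Hc; auto. }
    rewrite Rcont_eps in Q. destruct (Q (eps / 4 * h)) as [d [Hd Hq]]; [apply Rmult_lt_0_compat; lra|].
    exists d. split; [auto|]. intros u Hu.
    set (u' := Rmax a (Rmin u b)). 
    assert (Hu' : a <= u' <= b).
    { unfold u'. split; [apply Rmax_l|]. apply Rmax_lub; [lra|apply Rmin_r]. }
    assert (Ht' : Rmax a (Rmin t b) = t) by (rewrite Rmin_left, Rmax_right; lra). rewrite Ht'.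
    assert (Hut : Rabs (u' - t) <= Rabs (u - t)).
    { unfold u'. destruct (Rle_dec u b); [rewrite Rmin_left by lra|rewrite Rmin_right by lra].
      - destruct (Rle_dec a u); [rewrite Rmax_right by lra; lra|rewrite Rmax_left by lra].
        rewrite !Rabs_left1; lra.
      - rewrite Rmax_right by lra. rewrite !Rabs_pos_eq; lra. }
    specialize (Hq u' ltac:(lra)).
    pose proof (HK' u' Hu' w ltac:(lra)) as B1. pose proof (HK' t Ht w ltac:(lra)) as B2.
    rewrite Hw in B1, B2.
    apply Rmult_lt_reg_r with h; [exact Hh0|]. rewrite <- Hw at 1. rewrite <- Cmod_mult.
    replace ((K' u' - K' t) * (w - s0))%C with
      ((K w t - K s0 t - K' t * (w - s0)) - (K w u' - K s0 u' - K' u' * (w - s0))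
        + (K w u' + - (1) * K s0 u' - (K w t + - (1) * K s0 t)))%C by ring.
    eapply Rle_lt_trans; [apply Cmod_triangle|].
    eapply Rle_lt_trans; [apply Rplus_le_compat_r, Cmod_triangle_minus|].
    assert (N * h ^ 2 <= eps / 4 * h) by (simpl; nra).
    assert (0 < eps * h) by (apply Rmult_lt_0_compat; lra). lra. }
  exists (CRInt K' a b). apply Cderive_quadratic with ((b - a) * N) (r / 2); [apply Rmult_le_pos; lra|lra|].
  intros w H1.
  assert (EK : forall s, in_square s0 r s -> ex_CRInt (K s) a b).
  { intros s Hs. apply ex_CRInt_cont. intros t Ht. rewrite Rmin_left, Rmax_right in Ht by auto. auto. }
  assert (I : is_CRInt (fun t => (K w t + - (1) * K s0 t) + - (w - s0) * K' t)%C a b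
     ((CRInt (K w) a b + - (1) * CRInt (K s0) a b) + - (w - s0) * CRInt K' a b)%C).
  { apply (is_RInt_plus (V := C_R_NormedModule) (fun t => K w t + - (1) * K s0 t)%C (fun t => - (w - s0) * K' t)%C).
    - apply (is_RInt_plus (V := C_R_NormedModule) (K w) (fun t => - (1) * K s0 t)%C).
      + apply CRInt_correct, EK. auto.
      + apply is_CRInt_scal, CRInt_correct, EK. auto.
    - apply is_CRInt_scal, CRInt_correct, CK. }
  assert (B : Cmod ((CRInt (K w) a b + - (1) * CRInt (K s0) a b) + - (w - s0) * CRInt K' a b)
     <= (b - a) * (N * Cmod (w - s0) ^ 2)).
  { eapply CRInt_le; [exact Hab| |exact I]. intros t Ht.
    eapply Rle_trans; [|exact (HK' t Ht w H1)]. right. f_equal. cring. }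
  replace (CRInt (K w) a b - CRInt (K s0) a b - CRInt K' a b * (w - s0))%C with
   ((CRInt (K w) a b + - (1) * CRInt (K s0) a b) + - (w - s0) * CRInt K' a b)%C by ring.
  rewrite Rmult_assoc. exact B.
Qed.

Lemma CRInt_exp_bound (f : R -> C) (a b K : R) : a <= b -> 0 <= K ->
  (forall t, a <= t <= b -> Cmod (f t) <= K * exp (t / 2)) -> ex_CRInt f a b ->
  Cmod (CRInt f a b) <= 2 * K * exp (b / 2).
Proof.
  intros Hab HK H Hex.
  assert (I : is_RInt (V := R_NormedModule) (fun t => K * exp (t / 2)) a b (2 * K * exp (b / 2) - 2 * K * exp (a / 2))).
  { apply (is_RInt_derive (V := R_CompleteNormedModule) (fun t => 2 * K * exp (t / 2)) (fun t => K * exp (t / 2))).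
    - intros t _. auto_derive; auto. unfold Rdiv. field.
    - intros t _. apply (ex_derive_continuous (fun t => K * exp (t / 2))). auto_derive; auto. }
  apply Rle_trans with (2 * K * exp (b / 2) - 2 * K * exp (a / 2)).
  - rewrite Cmod_norm. apply (norm_RInt_le (V := C_R_NormedModule) f (fun t => K * exp (t / 2)) a b); auto.
    + intros t Ht. rewrite <- Cmod_norm. auto.
    + apply CRInt_correct, Hex.
  - pose proof (exp_pos (a / 2)). assert (0 <= K * exp (a / 2)) by (apply Rmult_le_pos; lra). lra.
Qed.

Lemma exp_half_lim (K eps : R) : 0 <= K -> 0 < eps -> exists N, forall x, x <= - INR N -> K * exp (x / 2) < eps.
Proof.
  intros HK He. 
  assert (Hp : 0 < eps / (K + 1)) by (apply Rdiv_lt_0_compat; lra).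
  destruct (INR_unbounded (- (2 * ln (eps / (K + 1))))) as [N HN].
  exists N. intros x Hx.
  assert (E : exp (x / 2) < eps / (K + 1)).
  { rewrite <- (exp_ln (eps / (K + 1))) by auto. apply exp_increasing. lra. }
  pose proof (exp_pos (x / 2)).
  apply Rlt_le_trans with ((K + 1) * (eps / (K + 1))); [nra|right; field; lra].
Qed.

(** The exponential majorant makes the tails uniformly small. One limit is delivered in three forms:
    along the integer truncations, which are used for computing, and as generalized integrals in
    both orientations, one for each half-line of [hankel_int]. *)
Lemma CRInt_left_tail (f : R -> C) (b K : R) : b <= 0 -> 0 <= K ->
  (forall t, t <= b -> Rcont f t) -> (forall t, t <= b -> Cmod (f t) <= K * exp (t / 2)) ->
  exists l, Clim (fun n => CRInt f (b - INR n) b) l /\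
    is_RInt_gen (V := C_R_NormedModule) f (Rbar_locally m_infty) (at_point b) l /\
    is_RInt_gen (V := C_R_NormedModule) f (at_point b) (Rbar_locally m_infty) (- l)%C.
Proof.
  intros Hb HK Hc Hf.
  assert (Ex : forall x y, x <= b -> y <= b -> ex_CRInt f x y).
  { intros x y Hx Hy. apply ex_CRInt_cont. intros t Ht. apply Hc.
    pose proof (Rmax_lub x y b Hx Hy). lra. }
  assert (D : forall x y, x <= y <= b -> Cmod (CRInt f x b - CRInt f y b) <= 2 * K * exp (y / 2)).
  { intros x y Hxy. rewrite <- (CRInt_Chasles f x y b) by (apply Ex; lra).
    assert (E : (CRInt f x y + CRInt f y b - CRInt f y b)%C = CRInt f x y) by ring. rewrite E.
    apply CRInt_exp_bound; try lra; [|apply Ex; lra]. intros; apply Hf; lra. }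
  assert (L : exists l, Clim (fun n => CRInt f (b - INR n) b) l).
  { apply Clim_cauchy. intros eps He.
    destruct (exp_half_lim (2 * K) eps ltac:(lra) He) as [N HN]. exists N. intros n m Hn Hm.
    apply le_INR in Hn, Hm.
    destruct (Rle_dec (b - INR n) (b - INR m)) as [H|H].
    - eapply Rle_lt_trans; [apply D; pose proof (pos_INR m); lra|]. apply HN. lra.
    - rewrite Cmod_minus_sym. eapply Rle_lt_trans; [apply D; pose proof (pos_INR n); lra|]. apply HN. lra. }
  destruct L as [l Hl]. exists l. split; [exact Hl|].
  assert (T : forall x, x <= b -> Cmod (CRInt f x b - l) <= 2 * K * exp (x / 2)).
  { intros x Hx. apply Rle_plus_epsilon. intros eps He. destruct (Hl eps He) as [N HN].
    destruct (INR_unbounded (b - x)) as [m Hm].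
    specialize (HN (max N m) (Nat.le_max_l _ _)).
    assert (Hmx : INR m <= INR (max N m)) by (apply le_INR, Nat.le_max_r).
    pose proof (D (b - INR (max N m)) x ltac:(lra)) as B.
    replace (CRInt f x b - l)%C with ((CRInt f (b - INR (max N m)) b - l) - (CRInt f (b - INR (max N m)) b - CRInt f x b))%C by ring.
    eapply Rle_trans; [apply Cmod_triangle_minus|]. lra. }
  assert (Q : forall P, locally (T := C_UniformSpace) l P -> exists N, forall x, x <= b -> x <= - INR N -> P (CRInt f x b)).
  { intros P HP. apply locally_CU_eps in HP. destruct HP as [e [He HP]].
    destruct (exp_half_lim (2 * K) e ltac:(lra) He) as [N HN]. exists N. intros x Hx HxN.
    apply HP. eapply Rle_lt_trans; [apply T, Hx|]. apply HN, HxN. }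
  split.
  - intros P HP. destruct (Q P HP) as [N HN].
    exists (fun x => x < Rmin b (- INR N)) (fun y => y = b).
    + exists (Rmin b (- INR N)). auto.
    + reflexivity.
    + intros x y Hx ->. exists (CRInt f x b). split.
      * apply CRInt_correct, Ex; [|lra]. pose proof (Rmin_l b (- INR N)). lra.
      * apply HN; [pose proof (Rmin_l b (- INR N)); lra|pose proof (Rmin_r b (- INR N)); lra].
  - intros P HP.
    assert (HP' : locally (T := C_UniformSpace) l (fun w => P (- w)%C)).
    { apply locally_CU_eps. apply locally_CU_eps in HP. destruct HP as [e [He HP]]. exists e. split; auto.
      intros w Hw. apply HP. replace (- w - - l)%C with (- (w - l))%C by ring. rewrite Cmod_opp. exact Hw. }
    destruct (Q _ HP') as [N HN].
    exists (fun y => y = b) (fun x => x < Rmin b (- INR N)).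
    + reflexivity.
    + exists (Rmin b (- INR N)). auto.
    + intros y x -> Hx. exists (- CRInt f x b)%C. 
      assert (x <= b /\ x <= - INR N) as [X1 X2] by (pose proof (Rmin_l b (- INR N)); pose proof (Rmin_r b (- INR N)); lra).
      split; [|apply HN; auto].
      cbn [fst snd]. rewrite <- (CRInt_swap f x b) by (apply Ex; lra). apply CRInt_correct, Ex; lra.
Qed.

Definition hankel_arc (c th : R) (g : C -> C) : C :=
  CRInt (fun phi : R => g (c * Cexp (Ci * phi)) * (Ci * (c * Cexp (Ci * phi))))%C (- th) th.

Definition hankel_trunc (c th : R) (g : C -> C) (n : nat) : C :=
  (CRInt (fun x => g (x, - (c * sin th))%R) (c * cos th - INR n) (c * cos th)
   + hankel_arc c th g
   - CRInt (fun x => g (x, c * sin th)%R) (c * cos th - INR n) (c * cos th))%C.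

Lemma hankel_limit (c th K : R) (g : C -> C) : c * cos th <= 0 -> 0 <= K ->
  (forall x, x <= c * cos th -> Rcont (fun x => g (x, - (c * sin th))%R) x /\ Rcont (fun x => g (x, c * sin th)%R) x) ->
  (forall x, x <= c * cos th -> Cmod (g (x, - (c * sin th))%R) <= K * exp (x / 2) /\
      Cmod (g (x, c * sin th)%R) <= K * exp (x / 2)) ->
  Clim (hankel_trunc c th g) (hankel_int c th g).
Proof.
  intros Hb HK Hc Hg.
  destruct (CRInt_left_tail (fun x => g (x, - (c * sin th))%R) (c * cos th) K) as [l1 (L1 & G1 & _)]; auto.
  { intros; apply Hc; auto. } { intros; apply Hg; auto. }
  destruct (CRInt_left_tail (fun x => g (x, c * sin th)%R) (c * cos th) K) as [l2 (L2 & _ & G2)]; auto.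
  { intros; apply Hc; auto. } { intros; apply Hg; auto. }
  unfold hankel_int. 
  apply (is_RInt_gen_unique (V := C_R_CompleteNormedModule)) in G1.
  apply (is_RInt_gen_unique (V := C_R_CompleteNormedModule)) in G2.
  rewrite G1, G2. unfold hankel_trunc. apply Clim_plus; [apply Clim_plus; [exact L1|apply Clim_const]|].
  apply Clim_ext with (fun n => - (1) * CRInt (fun x => g (x, c * sin th)%R) (c * cos th - INR n) (c * cos th))%C; [intros; ring|].
  replace (- l2)%C with (- (1) * l2)%C by ring. apply Clim_scal, L2.
Qed.

Definition kern (f : R -> C) (s z : C) : C := (gpow f z (s - 1) / (Cexp (- z) - 1))%C.

Lemma holo_expm1_opp (z : C) : holo (fun z => Cexp (- z) - 1)%C z.
Proof. apply holo_minus; [apply holo_Cexp, holo_opp, holo_id|apply holo_const]. Qed.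

Lemma kern_holo (f : R -> C) (q : R) (s z : C) : geom_bounded (P_coef f) q -> 0 < q < Cmod z ->
  off_slit z -> Cexp (- z) <> RtoC 1 -> holo (kern f s) z.
Proof.
  intros HP Hq Hz He. apply holo_div.
  - apply Cminus_eq_contra. exact He.
  - apply holo_gpow_base with q; auto.
  - apply holo_expm1_opp.
Qed.

Lemma kern_holo_exp (f : R -> C) (q : R) (s z : C) : geom_bounded (P_coef f) q -> 0 < q < Cmod z ->
  holo (fun s => kern f s z) s.
Proof.
  intros HP Hq. apply holo_mult; [|apply holo_const].
  apply (holo_comp (gpow f z) (fun s => s - 1)%C); [apply holo_gpow_exp with q; auto|].
  apply holo_minus; [apply holo_id|apply holo_const].
Qed.

(** By [1 + x <= e^x] at [x = ln (|z| / (2 S))], [S ln |z|] is at most [|z| / 2] plus a constant.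
    The rate [1 / 2] matters: on the half-lines the kernel contributes a decay of rate [1], so half
    of it survives. *)
Lemma Cpower_growth (c S : R) : 0 < c -> 1 <= S -> exists K, 0 <= K /\
  forall a z, Cmod a <= S -> c <= Cmod z -> Cmod (Cpower z a) <= K * exp (Cmod z / 2).
Proof.
  intros Hc HS. pose proof PI_RGT_0 as Hpi.
  exists (exp (S * Rabs (ln c) + S * ln (2 * S) + PI * S)). split; [apply Rlt_le, exp_pos|].
  intros a z Ha Hz. eapply Rle_trans; [apply Cmod_Cpower_le|].
  rewrite <- !exp_plus. apply exp_monotone.
  assert (Hm : 0 < Cmod z) by lra.
  assert (L1 : ln c <= ln (Cmod z)) by (destruct Hz as [Hz|Hz]; [left; apply ln_increasing; auto|rewrite Hz; lra]).
  assert (L2 : ln (Cmod z) <= Cmod z / (2 * S) + ln (2 * S)).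
  { assert (E : ln (Cmod z) = ln (Cmod z / (2 * S)) + ln (2 * S)).
    { rewrite <- ln_mult by (try apply Rdiv_lt_0_compat; lra). f_equal. field. lra. }
    rewrite E. apply Rplus_le_compat_r.
    assert (P : 0 < Cmod z / (2 * S)) by (apply Rdiv_lt_0_compat; lra).
    pose proof (exp_ineq1_le (ln (Cmod z / (2 * S)))) as X. rewrite exp_ln in X by auto. lra. }
  assert (L3 : 0 <= ln (2 * S)) by (rewrite <- ln_1; left; apply ln_increasing; lra).
  assert (P : 0 < Cmod z / (2 * S)) by (apply Rdiv_lt_0_compat; lra).
  assert (B : Rabs (ln (Cmod z)) <= Rabs (ln c) + (Cmod z / (2 * S) + ln (2 * S))).
  { pose proof (Rle_abs (ln c)). pose proof (Rle_abs (- ln c)). rewrite Rabs_Ropp in *.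
    pose proof (Rabs_pos (ln c)). apply Rabs_le. lra. }
  assert (Br : Re a * ln (Cmod z) <= S * (Rabs (ln c) + (Cmod z / (2 * S) + ln (2 * S)))).
  { eapply Rle_trans; [apply Rle_abs|]. rewrite Rabs_mult. apply Rmult_le_compat; auto using Rabs_pos.
    eapply Rle_trans; [apply re_le_Cmod|auto]. }
  replace (S * (Rabs (ln c) + (Cmod z / (2 * S) + ln (2 * S)))) with
    (S * Rabs (ln c) + S * ln (2 * S) + Cmod z / 2) in Br by (field; lra).
  assert (PI * Cmod a <= PI * S) by (apply Rmult_le_compat_l; lra). lra.
Qed.

(** [q] is a radius inside the contour at which the coefficients are still controlled, and [m] is
    the height from which the imaginary axis is cut. The last clause says that the slit domain
    contains no pole of the kernel. *)
Definition regular_contour (f : R -> C) (q c m th : R) : Prop :=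
  geom_bounded (P_coef f) q /\ 0 < q < c /\ c < m /\ PI / 2 < th < PI /\
  (forall z, slit_domain q m z -> Cexp (- z) <> RtoC 1).

Lemma contour_trig (c th : R) : 0 < c -> PI / 2 < th < PI -> c * cos th < 0 /\ 0 < c * sin th.
Proof.
  intros Hc Hth. split.
  - pose proof (cos_lt_0 th ltac:(lra) ltac:(lra)). nra.
  - pose proof (sin_gt_0 th ltac:(lra) ltac:(lra)). nra.
Qed.

Lemma Cmod_pair_le (x y x' y' : R) : Rabs x <= Rabs x' -> Rabs y <= Rabs y' -> Cmod (x, y) <= Cmod (x', y').
Proof.
  intros Hx Hy. unfold Cmod; simpl fst; simpl snd. apply sqrt_le_1_alt.
  apply Rplus_le_compat; rewrite <- !Rsqr_pow2; apply Rsqr_le_abs_1; auto.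
Qed.

Lemma Cmod_circle (c th : R) : 0 < c -> Cmod ((c * cos th)%R, (c * sin th)%R) = c.
Proof.
  intros Hc. replace ((c * cos th)%R, (c * sin th)%R) with (RtoC c * Cexp (0, th))%C.
  - rewrite Cmod_mult, Cmod_Cexp, Cmod_R, Rabs_pos_eq by lra. change (Re (0, th)) with 0. rewrite exp_0. ring.
  - unfold Cexp. change (Re (0, th)) with 0. change (Im (0, th)) with th. rewrite exp_0.
    unfold RtoC, Cmult; simpl. f_equal; ring.
Qed.

Lemma Cmod_on_line (c th x y : R) : 0 < c -> PI / 2 < th < PI -> x <= c * cos th ->
  Rabs y = c * sin th -> c <= Cmod (x, y).
Proof.
  intros Hc Hth Hx Hy. destruct (contour_trig c th Hc Hth) as [T1 T2].
  rewrite <- (Cmod_circle c th Hc) at 1. apply Cmod_pair_le.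
  - rewrite !Rabs_left; lra.
  - rewrite Hy, Rabs_pos_eq; lra.
Qed.

Lemma line_in_slit_domain (q m c th x y : R) : 0 < q < c -> PI / 2 < th < PI -> x <= c * cos th ->
  Rabs y = c * sin th -> slit_domain q m (x, y).
Proof.
  intros Hc Hth Hx Hy. destruct (contour_trig c th ltac:(lra) Hth) as [T1 T2].
  pose proof (Cmod_on_line c th x y ltac:(lra) Hth Hx Hy).
  split; [|split; [lra|]].
  - right. change (y <> 0). intros E. rewrite E, Rabs_R0 in Hy. lra.
  - left. change (x <> 0). lra.
Qed.

Lemma arc_point (c phi : R) : (c * Cexp (Ci * phi))%C = ((c * cos phi)%R, (c * sin phi)%R).
Proof.
  replace (Ci * phi)%C with ((0, phi) : C) by (rewrite C_re_im; ring).
  unfold Cexp. change (Re (0, phi)) with 0. change (Im (0, phi)) with phi. rewrite exp_0.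
  unfold RtoC, Cmult; simpl. f_equal; ring.
Qed.

Lemma arc_in_slit_domain (q m c phi : R) : 0 < q < c -> c < m -> - PI < phi < PI ->
  slit_domain q m (c * Cexp (Ci * phi))%C.
Proof.
  intros Hc Hm Hphi. rewrite arc_point. split; [|split; [rewrite Cmod_circle; lra|]].
  - unfold off_slit. change (0 < c * cos phi \/ c * sin phi <> 0).
    destruct (Req_dec phi 0) as [->|Hp]; [left; rewrite cos_0; lra|right].
    apply Rmult_integral_contrapositive_currified; [lra|].
    destruct (Rlt_le_dec phi 0); [pose proof (sin_lt_0_var phi)|pose proof (sin_gt_0 phi)]; lra.
  - right. eapply Rle_lt_trans; [apply im_le_Cmod|]. rewrite Cmod_circle; lra.
Qed.

Lemma slit_domain_kern (f : R -> C) (q c m th : R) (s z : C) : regular_contour f q c m th ->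
  slit_domain q m z -> holo (kern f s) z.
Proof.
  intros (HP & Hq & Hm & Hth & He) Hz. apply kern_holo with q; auto; [|apply Hz].
  destruct Hz as (_ & Hz & _). lra.
Qed.

Lemma Cmod_expm1_lower (z : C) : exp (- Re z) - 1 <= Cmod (Cexp (- z) - 1).
Proof.
  eapply Rle_trans; [|apply Cmod_triangle_inv]. rewrite Cmod_Cexp, Cmod_1, re_opp. lra.
Qed.

(** With [b = c cos th < 0], the denominator satisfies [|e^(-z) - 1| >= (1 - e^b) e^(-x)], while
    [|z| <= c - x] bounds the numerator by a multiple of [e^(-x / 2)]; the quotient decays like
    [e^(x / 2)]. *)
Lemma kern_line_bound (f : R -> C) (q c m th S : R) : regular_contour f q c m th -> 0 <= S ->
  exists K, 0 <= K /\ forall s x y, Cmod s <= S -> x <= c * cos th -> Rabs y = c * sin th ->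
    Cmod (kern f s (x, y)) <= K * exp (x / 2).
Proof.
  intros (HP & Hq & Hm & Hth & He) HS.
  destruct (contour_trig c th ltac:(lra) Hth) as [T1 T2].
  destruct (gpow_bound f q c (S + 1) HP Hq ltac:(lra)) as [B [HB Hb]].
  destruct (Cpower_growth c (S + 1) ltac:(lra) ltac:(lra)) as [K [HK Hk]].
  set (b := c * cos th) in *.
  assert (Eb : exp b < 1) by (rewrite <- exp_0; apply exp_increasing; auto).
  exists (B * (K * exp (c / 2)) / (1 - exp b)). split.
  { apply Rdiv_le_0_compat; [|lra]. apply Rmult_le_pos; auto. apply Rmult_le_pos; auto. apply Rlt_le, exp_pos. }
  intros s x y Hs Hx Hy.
  pose proof (Cmod_on_line c th x y ltac:(lra) Hth Hx Hy) as Hz.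
  assert (Hs1 : Cmod (s - 1) <= S + 1).
  { eapply Rle_trans; [apply Cmod_triangle_minus|]. rewrite Cmod_1. lra. }
  assert (Ex : exp x <= exp b) by (apply exp_monotone; auto).
  pose proof (exp_pos x) as Px.
  assert (D : (1 - exp b) / exp x <= Cmod (Cexp (- (x, y)) - 1)).
  { eapply Rle_trans; [|apply Cmod_expm1_lower]. change (Re (x, y)) with x. rewrite exp_Ropp.
    unfold Rdiv. apply Rmult_le_reg_r with (exp x); auto. rewrite Rmult_assoc, Rinv_l by lra.
    replace ((/ exp x - 1) * exp x) with (1 - exp x) by (field; lra). lra. }
  assert (D0 : 0 < (1 - exp b) / exp x) by (apply Rdiv_lt_0_compat; lra).
  unfold kern. rewrite Cmod_div.
  2:{ apply Cmod_gt_0. lra. }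
  assert (Hm' : Cmod (x, y) <= c - x).
  { eapply Rle_trans; [apply Cmod_le_abs|]. change (Rabs x + Rabs y <= c - x).
    rewrite Hy, Rabs_left by lra. pose proof (SIN_bound th). nra. }
  assert (N : Cmod (gpow f (x, y) (s - 1)) <= B * (K * exp (c / 2)) * exp (- x / 2)).
  { eapply Rle_trans; [apply Hb; auto|]. rewrite Rmult_assoc. apply Rmult_le_compat_l; auto.
    eapply Rle_trans; [apply Hk; auto|]. rewrite Rmult_assoc. apply Rmult_le_compat_l; auto.
    rewrite <- exp_plus. apply exp_monotone. lra. }
  apply Rle_trans with (B * (K * exp (c / 2)) * exp (- x / 2) * / ((1 - exp b) / exp x)).
  - apply Rmult_le_compat; auto using Cmod_ge_0.
    + apply Rlt_le, Rinv_0_lt_compat. lra.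
    + apply Rinv_le_contravar; auto.
  - right. replace (exp x) with (exp (- x / 2) * exp (- x / 2) * exp (x + x)) at 1.
    + replace (exp (x + x)) with (exp (x / 2) * exp (x / 2) * (exp (x / 2) * exp (x / 2)))
        by (rewrite <- !exp_plus; f_equal; field).
      assert (E1 : exp (- x / 2) * exp (x / 2) = 1).
      { rewrite <- exp_plus. replace (- x / 2 + x / 2) with 0 by field. apply exp_0. }
      assert (Pn := exp_pos (- x / 2)). assert (Pp := exp_pos (x / 2)).
      replace (exp (- x / 2)) with (/ exp (x / 2)) by (apply Rmult_eq_reg_r with (exp (x / 2)); [rewrite E1; field; lra|lra]).
      field. split; lra.
    + rewrite <- !exp_plus. f_equal. field.
Qed.

Lemma Rcont_arc (c t : R) : Rcont (fun phi => c * Cexp (Ci * phi))%C t.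
Proof.
  apply (Rcont_comp (fun w => c * Cexp w)%C (fun phi => Ci * phi)%C).
  - apply holo_cont, holo_mult; [apply holo_const|eexists; apply Cderive_Cexp].
  - apply Rderive_cont with Ci. apply Rderive_ext with (fun u => 0 + Ci * RtoC u)%C; [intros; ring|apply Rderive_linear].
Qed.

(** By polarization, a product is a combination of two squares, and squaring is continuous. *)
Lemma Rcont_mult (f g : R -> C) (t : R) : Rcont f t -> Rcont g t -> Rcont (fun u => f u * g u)%C t.
Proof.
  intros Hf Hg. apply (continuous_ext (fun u => / 4 * ((f u + g u) * (f u + g u)) + - / 4 * ((f u + - (1) * g u) * (f u + - (1) * g u)))%C).
  - intros u. cfield.
  - assert (Sq : forall a w, Ccont (fun w => a * (w * w))%C w).
    { intros a w. apply holo_cont, holo_mult; [apply holo_const|apply holo_mult; apply holo_id]. }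
    apply Rcont_plus.
    + apply (Rcont_comp (fun w => / 4 * (w * w))%C (fun u => f u + g u)%C); [apply Sq|apply Rcont_plus; auto].
    + apply (Rcont_comp (fun w => - / 4 * (w * w))%C (fun u => f u + - (1) * g u)%C); [apply Sq|].
      apply Rcont_plus; [auto|apply Rcont_scal; auto].
Qed.

Lemma kern_arc_cont (f : R -> C) (q c m th : R) (s : C) (t : R) : regular_contour f q c m th ->
  - th <= t <= th -> Rcont (fun phi => kern f s (c * Cexp (Ci * phi)) * (Ci * (c * Cexp (Ci * phi))))%C t.
Proof.
  intros H Ht. pose proof H as (HP & Hq & Hm & Hth & He).
  apply Rcont_mult; [|apply Rcont_scal, Rcont_arc].
  apply (Rcont_comp (kern f s)); [|apply Rcont_arc].
  apply holo_cont, (slit_domain_kern f q c m th); auto.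
  apply arc_in_slit_domain; auto. lra.
Qed.

Lemma kern_arc_bound (f : R -> C) (q c m th S : R) : regular_contour f q c m th -> 0 <= S ->
  exists K, forall s t, Cmod s <= S -> - th <= t <= th ->
    Cmod (kern f s (c * Cexp (Ci * t)) * (Ci * (c * Cexp (Ci * t)))) <= K.
Proof.
  intros (HP & Hq & Hm & Hth & He) HS.
  destruct (gpow_bound f q c (S + 1) HP Hq ltac:(lra)) as [B [HB Hb]].
  destruct (Cpower_growth c (S + 1) ltac:(lra) ltac:(lra)) as [K [HK Hk]].
  assert (Mc : forall t : R, Cmod (c * Cexp (Ci * t)) = c) by (intros; rewrite arc_point; apply Cmod_circle; lra).
  destruct (bounded_continuity (K := R_AbsRing) (V := C_R_NormedModule)
     (fun t => / (Cexp (- (c * Cexp (Ci * t))) - 1))%C (- th) th) as [N HN].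
  { intros t Ht. apply (Rcont_comp (fun z => / (Cexp (- z) - 1))%C (fun t => c * Cexp (Ci * t))%C); [|apply Rcont_arc].
    apply holo_cont, holo_inv; [|apply holo_expm1_opp].
    apply Cminus_eq_contra, He, arc_in_slit_domain; auto. lra. }
  exists (B * (K * exp (c / 2)) * N * c). intros s t Hs Ht.
  assert (Hs1 : Cmod (s - 1) <= S + 1).
  { eapply Rle_trans; [apply Cmod_triangle_minus|]. rewrite Cmod_1. lra. }
  specialize (HN t Ht). rewrite <- Cmod_norm in HN.
  unfold kern, Cdiv.
  rewrite (Cmod_mult _ (Ci * _)), (Cmod_mult Ci), Cmod_Ci, Mc, Rmult_1_l, (Cmod_mult (gpow f _ _)).
  apply Rmult_le_compat_r; [lra|]. apply Rmult_le_compat; auto using Cmod_ge_0; [|apply Rlt_le, HN].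
  eapply Rle_trans; [apply Hb; auto; rewrite Mc; lra|]. apply Rmult_le_compat_l; auto.
  eapply Rle_trans; [apply Hk; auto; rewrite Mc; lra|]. rewrite Mc. lra.
Qed.

Lemma Rabs_sides (a : R) : 0 < a -> Rabs (- a) = a /\ Rabs a = a.
Proof. intros H. rewrite Rabs_Ropp, Rabs_pos_eq; lra. Qed.

Lemma FC_int_limit (f : R -> C) (q c m th : R) (s : C) : regular_contour f q c m th ->
  Clim (hankel_trunc c th (kern f s)) (FC_int f c th s).
Proof.
  intros H. pose proof H as (HP & Hq & Hm & Hth & He).
  destruct (contour_trig c th ltac:(lra) Hth) as [T1 T2]. destruct (Rabs_sides _ T2) as [A1 A2].
  destruct (kern_line_bound f q c m th (Cmod s) H (Cmod_ge_0 s)) as [K [HK Hk]].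
  apply (hankel_limit c th K (kern f s)); auto; [lra| |].
  - intros x Hx. split; apply Rcont_horiz, holo_cont, (slit_domain_kern f q c m th); auto;
      apply line_in_slit_domain with c th; auto.
  - intros x Hx. split; apply Hk; auto; lra.
Qed.

(** The truncated integrals are holomorphic in [s] and, by the exponential majorant, bounded
    independently of the truncation, so their limit is holomorphic. *)
Lemma FC_int_holo (f : R -> C) (q c m th : R) (s0 : C) : regular_contour f q c m th ->
  holo (FC_int f c th) s0.
Proof.
  intros H. pose proof H as (HP & Hq & Hm & Hth & He).
  destruct (contour_trig c th ltac:(lra) Hth) as [T1 T2]. destruct (Rabs_sides _ T2) as [A1 A2].
  (* Two nested squares of half-side [1] are used, around [s0] and around a point of the first; each
     moves a point by at most [2]. *)
  set (S := Cmod s0 + 4). pose proof (Cmod_ge_0 s0) as Hs0.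
  destruct (kern_line_bound f q c m th S H ltac:(unfold S; lra)) as [K [HK Hk]].
  destruct (kern_arc_bound f q c m th S H ltac:(unfold S; lra)) as [N HN].
  set (b := c * cos th) in *. set (y := c * sin th) in *.
  assert (Sq : forall s t, in_square s0 1 s -> in_square s 1 t -> Cmod t <= S).
  { intros s t Hs Ht. apply square_in_disc in Hs. apply square_in_disc in Ht.
    pose proof (Cmod_triangle_inv t s). pose proof (Cmod_triangle_inv s s0). unfold S. lra. }
  assert (Sq0 : forall s, in_square s0 1 s -> Cmod s <= S).
  { intros s Hs. apply (Sq s s); auto. split; lra. }
  assert (Hline : forall y' n s, Rabs y' = y -> in_square s0 1 s ->
    holo (fun s => CRInt (fun x => kern f s (x, y')) (b - INR n) b) s).
  { intros y' n s Hy' Hs. pose proof (pos_INR n).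
    apply (CRInt_param_holo (fun s x => kern f s (x, y')) (b - INR n) b s 1 K); try lra.
    - intros t x Ht Hx. apply kern_holo_exp with q; auto.
      pose proof (Cmod_on_line c th x y' ltac:(lra) Hth ltac:(fold b; lra) Hy'). lra.
    - intros t x Ht Hx. apply Rcont_horiz, holo_cont, (slit_domain_kern f q c m th); auto.
      apply line_in_slit_domain with c th; auto. fold b; lra.
    - intros t x Ht Hx. eapply Rle_trans; [apply Hk; auto; [apply (Sq s); auto|lra]|].
      assert (exp (x / 2) <= 1) by (rewrite <- exp_0; apply exp_monotone; lra). nra. }
  assert (Hbound : forall y' n s, Rabs y' = y -> in_square s0 1 s ->
    Cmod (CRInt (fun x => kern f s (x, y')) (b - INR n) b) <= 2 * K).
  { intros y' n s Hy' Hs. pose proof (pos_INR n).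
    apply Rle_trans with (2 * K * exp (b / 2)).
    - apply CRInt_exp_bound; auto; try lra.
      + intros t Ht. apply Hk; auto; lra.
      + apply ex_CRInt_horiz; [lra|]. intros x Hx. apply holo_cont, (slit_domain_kern f q c m th); auto.
        apply line_in_slit_domain with c th; auto. fold b; lra.
    - assert (exp (b / 2) <= 1) by (rewrite <- exp_0; apply exp_monotone; lra). nra. }
  assert (Harc : forall s, in_square s0 1 s -> holo (fun s => hankel_arc c th (kern f s)) s).
  { intros s Hs. unfold hankel_arc.
    apply (CRInt_param_holo (fun s phi => kern f s (c * Cexp (Ci * phi)) * (Ci * (c * Cexp (Ci * phi))))%C (- th) th s 1 N); try lra.
    - intros t phi Ht Hphi. apply holo_mult; [|apply holo_const]. apply kern_holo_exp with q; auto.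
      rewrite arc_point, Cmod_circle; lra.
    - intros t phi Ht Hphi. apply (kern_arc_cont f q c m th); auto.
    - intros t phi Ht Hphi. apply HN; auto. apply (Sq s); auto. }
  assert (HarcB : forall s, in_square s0 1 s -> Cmod (hankel_arc c th (kern f s)) <= (th - - th) * N).
  { intros s Hs. apply (CRInt_le (fun phi => kern f s (c * Cexp (Ci * phi)) * (Ci * (c * Cexp (Ci * phi))))%C (- th) th N); try lra.
    - intros t Ht. apply HN; auto.
    - apply CRInt_correct, ex_CRInt_cont. intros t Ht. rewrite Rmin_left, Rmax_right in Ht by lra.
      apply (kern_arc_cont f q c m th); auto. }
  apply (holo_Clim (fun n s => hankel_trunc c th (kern f s) n) _ s0 1 (2 * K + (th - - th) * N + 2 * K)); [lra| | |].
  - intros n s Hs. unfold hankel_trunc. fold b y. apply holo_minus; [apply holo_plus|]; auto.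
  - intros n s Hs. unfold hankel_trunc. fold b y.
    eapply Rle_trans; [apply Cmod_triangle_minus|]. apply Rplus_le_compat; auto.
    eapply Rle_trans; [apply Cmod_triangle|]. apply Rplus_le_compat; auto.
  - intros s Hs. apply FC_int_limit with q m; auto.
Qed.

(** * Residues at the poles of 1 / (e^(-z) - 1) *)

Lemma Cexp_opp_2PI (k : Z) : Cexp (- (0, 2 * PI * IZR k)%R) = RtoC 1.
Proof.
  unfold Cexp. rewrite re_opp, im_opp.
  change (Re (0, 2 * PI * IZR k)) with 0. change (Im (0, 2 * PI * IZR k)) with (2 * PI * IZR k).
  rewrite Ropp_0, exp_0, cos_neg, sin_neg.
  assert (S : sin (PI * IZR k) = 0) by (apply sin_eq_0_1; exists k; ring).
  replace (2 * PI * IZR k) with (2 * (PI * IZR k)) by ring.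
  rewrite cos_2a_sin, sin_2a, S. unfold RtoC. f_equal; ring.
Qed.

(** The value [-1] at the origin is the derivative of [e^(-w)] there; it is responsible for the
    minus sign in the residues of the kernel. *)
Lemma holo_expm1_quotient (z : C) :
  holo (fun w => if Ceq_dec w 0 then - (1) else (Cexp (- w) - 1) / w)%C z.
Proof.
  assert (H0 : forall w, Cderive (fun w => Cexp (- w)) w (- (1) * Cexp (- w))%C).
  { intros w. apply (Cderive_comp Cexp (fun w => - w)%C); [apply Cderive_Cexp|apply Cderive_opp, Cderive_id]. }
  set (r := Cmod z + 1).
  destruct (holo_factor (fun w => Cexp (- w)) 0 r) as [d [Hd H]].
  - unfold r. pose proof (Cmod_ge_0 z). lra.
  - intros w _. eexists; apply H0.
  - assert (E0 : Cexp (- 0) = RtoC 1) by (replace (- 0)%C with (RtoC 0) by ring; apply Cexp_0).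
    assert (Ed : d = (- (1))%C).
    { pose proof (is_C_derive_unique _ _ _ (H0 (RtoC 0))) as U1. pose proof (is_C_derive_unique _ _ _ Hd) as U2.
      transitivity (- (1) * Cexp (- 0))%C; [exact (eq_trans (eq_sym U2) U1)|rewrite E0; cring]. }
    apply holo_ext with (2 := H z ltac:(apply disc_in_square; unfold r; replace (z - 0)%C with z by ring; lra)).
    intros w. rewrite Ed, E0. destruct (Ceq_dec w 0); [reflexivity|]. f_equal. ring.
Qed.

Lemma expm1_quotient_nz (z : C) : Rabs (Im z) < 2 * PI ->
  (if Ceq_dec z 0 then - (1) else (Cexp (- z) - 1) / z)%C <> RtoC 0.
Proof.
  intros H. destruct (Ceq_dec z 0) as [->|Hz].
  - intros E. apply (f_equal Re) in E. rewrite re_opp, !re_RtoC in E. lra.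
  - intros E.
    assert (E1 : Cexp (- z) = RtoC 1).
    { apply (proj2 (Ceq_minus _ _)). replace (Cexp (- z) - 1)%C with ((Cexp (- z) - 1) / z * z)%C by (field; auto).
      rewrite E. ring. }
    apply Cexp_eq_1 in E1. destruct E1 as [k Hk].
    assert (Ez : z = (0, - (2 * PI * IZR k))).
    { replace z with (- - z)%C by ring. rewrite Hk. unfold Copp; simpl. f_equal. ring. }
    rewrite Ez in H. change (Im (0, - (2 * PI * IZR k))) with (- (2 * PI * IZR k)) in H.
    rewrite Rabs_Ropp, Rabs_mult, Rabs_pos_eq in H by (pose proof PI_RGT_0; lra).
    assert (Rabs (IZR k) < 1) by (pose proof PI_RGT_0; nra).
    rewrite <- abs_IZR in H0. apply lt_IZR in H0.
    assert (k = 0%Z) by lia. subst k. apply Hz. rewrite Ez. unfold RtoC. f_equal. ring.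
Qed.

Lemma off_slit_im (x y : R) : y <> 0 -> off_slit (x, y).
Proof. intros H. right. exact H. Qed.

(** Since [2 i PI k] is a period of [e^(-z)], the kernel is [h z / (z - p)] with [h] the generalized
    power over the quotient of [holo_expm1_quotient] at [z - p]. The zero of [e^(-w) - 1] at the
    origin is the only one in [|Im w| < 2 PI], so [h] is holomorphic on the rectangle and Cauchy's
    formula gives [h p]. *)
Lemma RectInt_kern_pole (f : R -> C) (q : R) (s : C) (k : Z) (X B y1 y2 : R) :
  geom_bounded (P_coef f) q -> 0 < q ->
  X < 0 < B -> y1 < 2 * PI * IZR k < y2 ->
  2 * PI * IZR k - y1 < 2 * PI -> y2 - 2 * PI * IZR k < 2 * PI ->
  (forall y, y1 <= y <= y2 -> q < Rabs y) ->
  RectInt (kern f s) X B y1 y2 = (- (2 * Ci * PI) * gpow f (0, (2 * PI * IZR k)%R) (s - 1))%C.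
Proof.
  intros HP Hq HX Hy Hy1 Hy2 Hr.
  set (p := ((0, (2 * PI * IZR k)%R) : C)).
  set (psi := fun w => (if Ceq_dec w 0 then - (1) else (Cexp (- w) - 1) / w)%C).
  set (h := fun z => (gpow f z (s - 1) / psi (z - p))%C).
  assert (Hh : forall x y, X <= x <= B -> y1 <= y <= y2 -> holo h (x, y)).
  { intros x y Hx Hxy. specialize (Hr y Hxy). apply holo_div.
    - apply expm1_quotient_nz. change (Rabs (y - 2 * PI * IZR k) < 2 * PI). apply Rabs_lt_between. lra.
    - apply holo_gpow_base with q; auto.
      + split; auto. eapply Rlt_le_trans; [apply Hr|]. exact (im_le_Cmod (x, y)).
      + apply off_slit_im. intros E. rewrite E, Rabs_R0 in Hr. lra.
    - apply (holo_comp psi (fun z => z - p)%C); [apply holo_expm1_quotient|].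
      apply holo_minus; [apply holo_id|apply holo_const]. }
  assert (E : forall x y, X <= x <= B -> y1 <= y <= y2 -> (x <> 0 \/ y <> 2 * PI * IZR k) ->
     kern f s (x, y) = (h (x, y) / ((x, y) - p))%C).
  { intros x y Hx Hxy Hn. unfold h, kern, psi.
    assert (Np : ((x, y) - p)%C <> RtoC 0) by (apply Cminus_eq_contra, pair_neq, Hn).
    destruct (Ceq_dec ((x, y) - p) 0) as [E|_]; [contradiction|].
    assert (Ep : Cexp (- (x, y)) = Cexp (- ((x, y) - p))).
    { replace (- (x, y))%C with (- ((x, y) - p) + - p)%C by ring.
      rewrite Cexp_plus. unfold p at 2. rewrite Cexp_opp_2PI. ring. }
    rewrite Ep.
    assert (Nz : (Cexp (- ((x, y) - p)) - 1)%C <> RtoC 0).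
    { pose proof (expm1_quotient_nz ((x, y) - p)) as Q.
      destruct (Ceq_dec ((x, y) - p) 0) as [E|_]; [contradiction|].
      intros E. apply Q; [change (Rabs (y - 2 * PI * IZR k) < 2 * PI); apply Rabs_lt_between; lra|].
      rewrite E. unfold Cdiv. ring. }
    field. auto. }
  rewrite (RectInt_ext (kern f s) (fun z => h z / (z - p))%C); try lra.
  - unfold p. rewrite cauchy_rect; auto. fold p.
    unfold h, psi. replace (p - p)%C with (RtoC 0) by ring.
    destruct (Ceq_dec 0 0) as [_|N]; [|congruence]. field.
  - intros x Hx. split; apply E; lra.
  - intros y Hxy. split; apply E; lra.
Qed.

(** On the line [Im z = e (2 j - 1) PI] the exponential [e^(-z)] equals [- e^(-x)], so the real part
    of [e^(-z) - 1] is [- (1 + e^(-x))]. Horizontal cuts at these heights stay uniformly away from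
    the poles. *)
Lemma odd_multiple_expm1 (j : nat) (e x : R) : e = 1 \/ e = - (1) ->
  1 <= Cmod (Cexp (- (x, e * (2 * PI * INR j - PI))%R) - 1).
Proof.
  intros He.
  assert (Hc : cos (2 * PI * INR j - PI) = -1).
  { replace (2 * PI * INR j - PI) with (- PI + 2 * INR j * PI) by ring. rewrite cos_period, cos_neg. apply cos_PI. }
  assert (Hce : cos (e * (2 * PI * INR j - PI)) = -1).
  { destruct He as [->| ->]; [rewrite Rmult_1_l; auto|].
    replace (- (1) * (2 * PI * INR j - PI)) with (- (2 * PI * INR j - PI)) by ring. rewrite cos_neg. auto. }
  eapply Rle_trans; [|apply re_le_Cmod].
  replace (Re (Cexp (- (x, e * (2 * PI * INR j - PI))%R) - 1)) with (- (exp (- x) + 1)).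
  - rewrite Rabs_Ropp, Rabs_pos_eq; pose proof (exp_pos (- x)); lra.
  - unfold Cminus. rewrite re_plus, re_opp, re_RtoC. unfold Cexp.
    rewrite re_opp, im_opp. change (Re (x, e * (2 * PI * INR j - PI))) with x.
    change (Im (x, e * (2 * PI * INR j - PI))) with (e * (2 * PI * INR j - PI)).
    rewrite cos_neg, Hce. unfold Re; simpl. ring.
Qed.

(** Heights of the horizontal cuts: the first is the contour height [c], the later ones lie midway
    between consecutive poles. The pole of index [n + j] sits between the levels [j] and [j + 1]. *)
Definition level (n : nat) (c : R) (j : nat) : R :=
  match j with O => c | S _ => 2 * PI * INR (n + j) - PI end.

Lemma level_bounds (n : nat) (c : R) (j : nat) : 2 * PI * (INR n - 1) < c < 2 * PI * INR n -> 0 < c ->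
  c <= level n c j < 2 * PI * INR (n + j) /\ 2 * PI * INR (n + j) - level n c j < 2 * PI.
Proof.
  intros Hc Hc0. pose proof PI_RGT_0. destruct j as [|j]; unfold level.
  - rewrite Nat.add_0_r. lra.
  - rewrite plus_INR, S_INR. pose proof (pos_INR j).
    assert (0 <= PI * INR j) by (apply Rmult_le_pos; lra).
    repeat split; lra.
Qed.

Lemma kern_level_holo (f : R -> C) (q c th : R) (n : nat) (s : C) (e x : R) (j : nat) :
  regular_contour f q c (2 * PI * INR n) th ->
  2 * PI * (INR n - 1) < c < 2 * PI * INR n -> e = 1 \/ e = - (1) ->
  holo (kern f s) (x, e * level n c j).
Proof.
  intros H Hc He. pose proof H as (HP & Hq & Hm & Hth & Hexp).
  pose proof (level_bounds n c j Hc ltac:(lra)) as Hl.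
  assert (Ha : Rabs (e * level n c j) = level n c j).
  { destruct He as [->| ->]; [rewrite Rmult_1_l|rewrite <- Rabs_Ropp]; rewrite Rabs_pos_eq; lra. }
  assert (Hy : e * level n c j <> 0) by (intros E; rewrite E, Rabs_R0 in Ha; lra).
  assert (Hz : q < Cmod (x, e * level n c j)).
  { eapply Rlt_le_trans; [|exact (im_le_Cmod (x, e * level n c j))]. change (q < Rabs (e * level n c j)). lra. }
  destruct j as [|j].
  - apply (slit_domain_kern f q c (2 * PI * INR n) th); auto.
    split; [apply off_slit_im; auto|split; auto]. right. change (Rabs (e * c) < 2 * PI * INR n).
    change (Rabs (e * c) = c) in Ha. lra.
  - apply kern_holo with q; auto; [lra|apply off_slit_im; auto|].
    intros E. pose proof (odd_multiple_expm1 (n + S j) e x He) as O.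
    change (1 <= Cmod (Cexp (- (x, e * level n c (S j))%R) - 1)) in O. rewrite E in O.
    replace (1 - 1)%C with (RtoC 0) in O by ring. rewrite Cmod_0 in O. lra.
Qed.

Lemma RectInt_degenerate (g : C -> C) (a b c : R) : RectInt g a b c c = RtoC 0.
Proof.
  unfold RectInt.
  assert (E : forall h : R -> C, CRInt h c c = RtoC 0) by (intros h; exact (RInt_point (V := C_R_CompleteNormedModule) c h)).
  rewrite !E. ring.
Qed.

(** The horizontal sides run between poles, and the vertical ones avoid the imaginary axis, where
    all poles lie. *)
Lemma stack_sides (f : R -> C) (q c th : R) (n : nat) (s : C) (e X B : R) (i j : nat) :
  regular_contour f q c (2 * PI * INR n) th ->
  2 * PI * (INR n - 1) < c < 2 * PI * INR n -> e = 1 \/ e = - (1) -> X < 0 < B ->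
  rect_sides (kern f s) X B (e * level n c i) (e * level n c j).
Proof.
  intros H Hc He HX. pose proof H as (HP & Hq & Hm & Hth & Hexp).
  assert (V : forall x, x <> 0 -> forall y, Rmin (e * level n c i) (e * level n c j) <= y <= Rmax (e * level n c i) (e * level n c j) ->
     Rcont (fun y => kern f s (x, y)) y).
  { intros x Hx y Hy. apply Rcont_vert, holo_cont, (slit_domain_kern f q c (2 * PI * INR n) th); auto.
    pose proof (level_bounds n c i Hc ltac:(lra)) as Li. pose proof (level_bounds n c j Hc ltac:(lra)) as Lj.
    assert (Hy' : c <= Rabs y).
    { destruct He as [->| ->].
      - assert (c <= Rmin (1 * level n c i) (1 * level n c j)) by (apply Rmin_glb; lra).
        rewrite Rabs_pos_eq; lra.
      - assert (Rmax (- (1) * level n c i) (- (1) * level n c j) <= - c) by (apply Rmax_lub; lra).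
        rewrite Rabs_left; lra. }
    split; [|split].
    - apply off_slit_im. intros E. rewrite E, Rabs_R0 in Hy'. lra.
    - eapply Rlt_le_trans; [|exact (im_le_Cmod (x, y))]. change (q < Rabs y). lra.
    - left. exact Hx. }
  repeat split.
  - apply ex_CRInt_horiz; [lra|]. intros x _. apply holo_cont, kern_level_holo with q th; auto.
  - apply ex_CRInt_horiz; [lra|]. intros x _. apply holo_cont, kern_level_holo with q th; auto.
  - apply ex_CRInt_cont, V; lra.
  - apply ex_CRInt_cont, V; lra.
Qed.

Definition pole (n : nat) (e : R) (k : nat) : C := (0, e * (2 * PI * INR (n + k))).

(** Each further strip encloses exactly one new pole. For [e = - (1)] the levels descend, so the
    rectangle is run through with the opposite orientation; this is the origin of the factor
    [- e]. *)
Lemma RectInt_stack (f : R -> C) (q c th : R) (n : nat) (s : C) (e X B : R) (N : nat) :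
  regular_contour f q c (2 * PI * INR n) th ->
  2 * PI * (INR n - 1) < c < 2 * PI * INR n -> e = 1 \/ e = - (1) -> X < 0 < B ->
  RectInt (kern f s) X B (e * c) (e * level n c N) =
  (- e * (2 * Ci * PI) * Csum (fun k => gpow f (pole n e k) (s - 1)) N)%C.
Proof.
  intros H Hc He HX. pose proof H as (HP & Hq & Hm & Hth & Hexp). pose proof PI_RGT_0 as Hpi.
  induction N as [|N IH].
  - simpl. rewrite RectInt_degenerate. ring.
  - rewrite (RectInt_vsplit _ X B (e * c) (e * level n c N)).
    2:{ apply (stack_sides f q c th n s e X B 0 N); auto. }
    2:{ apply (stack_sides f q c th n s e X B N (S N)); auto. }
    rewrite IH. simpl Csum.
    pose proof (level_bounds n c N Hc ltac:(lra)) as L1. pose proof (level_bounds n c (S N) Hc ltac:(lra)) as L2.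
    assert (E : level n c (S N) = 2 * PI * INR (n + N) + PI).
    { unfold level. rewrite Nat.add_succ_r, S_INR. ring. }
    assert (Z1 : IZR (Z.of_nat (n + N)) = INR (n + N)) by (symmetry; apply INR_IZR_INZ).
    destruct He as [->| ->].
    + rewrite (RectInt_kern_pole f q s (Z.of_nat (n + N))); auto; rewrite ?Z1, ?Rmult_1_l; try lra.
      * unfold pole. rewrite Rmult_1_l. ring.
      * intros y Hy. rewrite Rabs_pos_eq; lra.
    + rewrite (RectInt_vswap _ X B (- (1) * level n c (S N))).
      2:{ apply (stack_sides f q c th n s (- (1)) X B (S N) N); auto. }
      rewrite (RectInt_kern_pole f q s (- Z.of_nat (n + N))); auto; rewrite ?opp_IZR, ?Z1; try lra.
      * unfold pole. replace (2 * PI * - INR (n + N)) with (- (1) * (2 * PI * INR (n + N))) by ring.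
        rewrite RtoC_opp. ring.
      * intros y Hy. rewrite Rabs_left; lra.
Qed.

(** For [Re s < 1] the power [|z|^(Re s - 1)] decreases with [|z|], so far from the origin only a
    lower bound for [|e^(-z) - 1|] is required; [1 / 2] is one that all the far sides satisfy. *)
Lemma kern_decay (f : R -> C) (q c : R) (s : C) : geom_bounded (P_coef f) q -> 0 < q < c -> Re s < 1 ->
  exists K, 0 <= K /\ forall B z, c <= B -> B <= Cmod z -> / 2 <= Cmod (Cexp (- z) - 1) ->
    Cmod (kern f s z) <= K * exp ((Re s - 1) * ln B).
Proof.
  intros HP Hq Hs.
  destruct (gpow_bound f q c (Cmod (s - 1)) HP Hq (Cmod_ge_0 _)) as [D [HD Hb]].
  exists (2 * D * exp (PI * Cmod (s - 1))). split.
  { apply Rmult_le_pos; [lra|apply Rlt_le, exp_pos]. }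
  intros B z HB Hz He. unfold kern. rewrite Cmod_div by (apply Cmod_gt_0; lra).
  assert (E1 : / Cmod (Cexp (- z) - 1) <= 2).
  { rewrite <- (Rinv_inv 2). apply Rinv_le_contravar; lra. }
  assert (E2 : Cmod (gpow f z (s - 1)) <= D * (exp ((Re s - 1) * ln B) * exp (PI * Cmod (s - 1)))).
  { eapply Rle_trans; [apply Hb; lra|]. apply Rmult_le_compat_l; auto.
    eapply Rle_trans; [apply Cmod_Cpower_le|]. apply Rmult_le_compat_r; [apply Rlt_le, exp_pos|].
    apply exp_monotone. unfold Cminus. rewrite re_plus, re_opp, re_RtoC.
    assert (ln B <= ln (Cmod z)) by (destruct Hz as [Hz|Hz]; [left; apply ln_increasing; lra|rewrite Hz; lra]).
    nra. }
  apply Rle_trans with (D * (exp ((Re s - 1) * ln B) * exp (PI * Cmod (s - 1))) * 2).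
  - apply Rmult_le_compat; auto using Cmod_ge_0. apply Rlt_le, Rinv_0_lt_compat. lra.
  - right. ring.
Qed.

(** The truncated contour is one connected path inside the slit domain, so the contributions of its
    three pieces telescope. *)
Lemma hankel_trunc_prim (g A : C -> C) (q c m th : R) (N : nat) : 0 < q < c -> c < m -> PI / 2 < th < PI ->
  (forall z, slit_domain q m z -> holo g z) ->
  (forall z, slit_domain q m z -> Cderive A z (g z)) ->
  hankel_trunc c th g N =
  (A ((c * cos th - INR N)%R, (c * sin th)%R) - A ((c * cos th - INR N)%R, (- (c * sin th))%R))%C.
Proof.
  intros Hq Hm Hth Hg HA.
  destruct (contour_trig c th ltac:(lra) Hth) as [T1 T2]. destruct (Rabs_sides _ T2) as [A1 A2].
  pose proof (pos_INR N) as HN.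
  assert (Line : forall y, Rabs y = c * sin th ->
    CRInt (fun x => g (x, y)) (c * cos th - INR N) (c * cos th) =
      (A ((c * cos th)%R, y) - A ((c * cos th - INR N)%R, y))%C).
  { intros y Hy. apply CRInt_unique, CRInt_horiz_prim; [lra| |].
    - intros x Hx. apply HA, (line_in_slit_domain q m c th); auto; lra.
    - intros x Hx. apply holo_cont, Hg, (line_in_slit_domain q m c th); auto; lra. }
  assert (Arc : hankel_arc c th g = (A (c * Cexp (Ci * th)) - A (c * Cexp (Ci * (- th)%R)))%C).
  { apply CRInt_unique. apply (CRInt_derive (fun phi => A (c * Cexp (Ci * phi))%C));
      intros t Ht; rewrite Rmin_left, Rmax_right in Ht by lra.
    - apply (Rderive_comp A (fun phi => c * Cexp (Ci * phi))%C).
      + apply HA, arc_in_slit_domain; auto; lra.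
      + assert (D : Rderive (fun phi => (fun w => c * Cexp w)%C (Ci * RtoC phi)%C) t (c * Cexp (Ci * t) * Ci)%C).
        { apply (Rderive_comp (fun w => c * Cexp w)%C (fun phi => Ci * RtoC phi)%C).
          - apply (Cderive_scal c Cexp), Cderive_Cexp.
          - apply Rderive_ext with (fun u => 0 + Ci * RtoC u)%C; [intros; ring|apply Rderive_linear]. }
        replace (Ci * (c * Cexp (Ci * t)))%C with (c * Cexp (Ci * t) * Ci)%C by ring. exact D.
    - apply Rcont_mult; [|apply Rcont_scal, Rcont_arc].
      apply (Rcont_comp g); [|apply Rcont_arc]. apply holo_cont, Hg, arc_in_slit_domain; auto; lra. }
  unfold hankel_trunc. rewrite (Line (- (c * sin th))), (Line (c * sin th)), Arc, !arc_point by auto.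
  rewrite cos_neg, sin_neg. replace (c * - sin th) with (- (c * sin th)) by ring. ring.
Qed.

(** On the vertical sides [|e^(-z)|] is well separated from [1]: it is at most [1 / 2] for [x >= 1]
    and at least [2] for [x <= -1]. *)
Lemma kern_far_bound (f : R -> C) (c K : R) (s : C) (B x y : R) :
  (forall B z, c <= B -> B <= Cmod z -> / 2 <= Cmod (Cexp (- z) - 1) ->
    Cmod (kern f s z) <= K * exp ((Re s - 1) * ln B)) ->
  c <= B -> 1 <= B -> B <= Rabs x -> Cmod (kern f s (x, y)) <= K * exp ((Re s - 1) * ln B).
Proof.
  intros HK Hc HB Hx. apply HK; auto.
  - eapply Rle_trans; [exact Hx|]. exact (re_le_Cmod (x, y)).
  - assert (E1 : 2 <= exp 1) by (pose proof (exp_ineq1_le 1); lra).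
    destruct (Rle_dec 0 x) as [H|H].
    + rewrite Rabs_pos_eq in Hx by auto. rewrite Cmod_minus_sym.
      eapply Rle_trans; [|apply Cmod_triangle_inv]. rewrite Cmod_1, Cmod_Cexp, re_opp. change (Re (x, y)) with x.
      assert (exp (- x) <= / 2); [|lra]. rewrite exp_Ropp. apply Rinv_le_contravar; [lra|].
      eapply Rle_trans; [apply E1|]. apply exp_monotone. lra.
    + rewrite Rabs_left in Hx by lra. eapply Rle_trans; [|apply Cmod_expm1_lower]. change (Re (x, y)) with x.
      assert (exp 1 <= exp (- x)) by (apply exp_monotone; lra). lra.
Qed.

(** The primitive allows the truncated contour to be replaced by a path through the lines at heights
    [- c] and [c]. Each of these lines is a side of a stack of rectangles, whose residues give the
    sums. The remaining sides have length of order [B] and carry a kernel of order [B^(Re s - 1)],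
    so they cost [B^(Re s)], which vanishes for [Re s < 0]. *)
Lemma FC_int_poles (f : R -> C) (q c th : R) (n : nat) (s : C) :
  regular_contour f q c (2 * PI * INR n) th ->
  2 * PI * (INR n - 1) < c < 2 * PI * INR n -> Re s < 0 ->
  Clim (fun N => 2 * Ci * PI * (Csum (fun k => gpow f (pole n 1 k) (s - 1)) N
                                + Csum (fun k => gpow f (pole n (- (1)) k) (s - 1)) N))%C (FC_int f c th s).
Proof.
  intros H Hc Hs. pose proof H as (HP & Hq & Hm & Hth & Hexp). pose proof PI_RGT_0 as Hpi.
  pose proof PI2_3_2 as Hpi3. pose proof PI_4 as Hpi4.
  destruct (contour_trig c th ltac:(lra) Hth) as [T1 T2]. destruct (Rabs_sides _ T2) as [A1 A2].
  assert (Y0 : c * sin th <= c) by (pose proof (SIN_bound th); nra).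
  assert (X0 : - c <= c * cos th) by (pose proof (COS_bound th); nra).
  set (m := 2 * PI * INR n) in *. set (g := kern f s) in *.
  assert (Hg : forall z, slit_domain q m z -> holo g z) by (intros; apply (slit_domain_kern f q c m th); auto).
  destruct (primitive_slit g q c m Hq Hm Hg) as [A HA].
  destruct (kern_decay f q c s HP Hq ltac:(lra)) as [K [HK Hk]]. fold g in Hk.
  assert (Hn : 1 <= INR n).
  { change 1 with (INR 1). apply le_INR. destruct n; [|lia]. unfold m in Hc. simpl in Hc. lra. }
  (* Truncation at [10 (n + N)] puts the left end at least as far out as [B], since [PI <= 4], and
     keeps the total width below [6 B]. The two horizontal lines cost [8 B eps] each and the three
     vertical segments [2 B eps] each, together less than [24 B eps]. *)
  assert (Main : forall N, (1 <= N)%nat ->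
    Cmod (hankel_trunc c th g (10 * (n + N)) - 2 * Ci * PI * (Csum (fun k => gpow f (pole n 1 k) (s - 1)) N
       + Csum (fun k => gpow f (pole n (- (1)) k) (s - 1)) N)) <= 24 * K * exp (Re s * ln (level n c N))).
  { intros N HN. set (B := level n c N).
    assert (HN1 : 1 <= INR N) by (change 1 with (INR 1); apply le_INR; auto).
    assert (EB : B = 2 * PI * (INR n + INR N) - PI).
    { unfold B, level. destruct N; [lia|]. rewrite plus_INR. reflexivity. }
    assert (HBc : c <= B) by (apply level_bounds; auto; lra).
    assert (Hsum : 3 <= PI * (INR n + INR N) / 2) by nra.
    assert (HB1 : 1 <= B) by (rewrite EB; nra).
    set (X := c * cos th - INR (10 * (n + N))).
    assert (EX : INR (10 * (n + N)) = 10 * (INR n + INR N)) by (rewrite mult_INR, plus_INR; simpl; ring).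
    assert (HXB : B <= - X) by (unfold X; rewrite EX, EB; nra).
    assert (HX6 : B - X <= 6 * B) by (unfold X; rewrite EX; rewrite EB in *; nra).
    set (eps := K * exp ((Re s - 1) * ln B)).
    assert (Heps0 : 0 <= eps) by (apply Rmult_le_pos; [auto|apply Rlt_le, exp_pos]).
    assert (Heps : B * eps = K * exp (Re s * ln B)).
    { unfold eps. rewrite <- (exp_ln B) at 1 by lra.
      replace (exp (ln B) * (K * exp ((Re s - 1) * ln B))) with (K * (exp (ln B) * exp ((Re s - 1) * ln B))) by ring.
      rewrite <- exp_plus. f_equal. f_equal. ring. }
    assert (Far : forall x y, B <= Rabs x -> Cmod (g (x, y)) <= eps).
    { intros x y Hx. apply (kern_far_bound f c K s B x y); auto. }
    assert (Top : forall e x, e = 1 \/ e = - (1) -> Cmod (g (x, (e * B)%R)) <= eps).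
    { intros e x He. assert (Ra : Rabs (e * B) = B).
      { destruct He as [->| ->]; [rewrite Rmult_1_l|rewrite <- Rabs_Ropp]; rewrite Rabs_pos_eq; lra. }
      apply Hk; auto.
      - rewrite <- Ra at 1. exact (im_le_Cmod (x, (e * B)%R)).
      - pose proof (odd_multiple_expm1 (n + N) e x He) as O.
        replace (2 * PI * INR (n + N) - PI) with B in O by (rewrite EB, plus_INR; ring). lra. }
    (* The line at height [e c] lies in the slit domain, as [c < m], so its integral is an increment
       of [A]. [RectInt_stack] trades it for residues and three far sides of lengths at most [6 B],
       [B] and [B]. *)
    assert (Hor : forall e, e = 1 \/ e = - (1) -> slit_domain q m (X, (e * c)%R) /\ slit_domain q m (B, (e * c)%R) /\
      Cmod ((A (B, (e * c)%R) - A (X, (e * c)%R)) + e * (2 * Ci * PI) * Csum (fun k => gpow f (pole n e k) (s - 1)) N) <= 8 * B * eps).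
    { intros e He. 
      assert (Re1 : Rabs (e * c) = c).
      { destruct He as [->| ->]; [rewrite Rmult_1_l|rewrite <- Rabs_Ropp]; rewrite Rabs_pos_eq; lra. }
      assert (Dom : forall x, slit_domain q m (x, (e * c)%R)).
      { intros x. split; [|split].
        - apply off_slit_im. intros E. rewrite E, Rabs_R0 in Re1. lra.
        - eapply Rlt_le_trans; [|exact (im_le_Cmod (x, (e * c)%R))]. change (q < Rabs (e * c)). lra.
        - right. change (Rabs (e * c) < m). lra. }
      split; [apply Dom|split; [apply Dom|]].
      assert (I1 : CRInt (fun x => g (x, (e * c)%R)) X B = (A (B, (e * c)%R) - A (X, (e * c)%R))%C).
      { apply CRInt_unique, CRInt_horiz_prim; [lra| |]; intros x _; [apply HA, Dom|apply holo_cont, Hg, Dom]. }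
      pose proof (RectInt_stack f q c th n s e X B N H Hc He ltac:(lra)) as R. fold g B in R. unfold RectInt in R.
      assert (S1 := stack_sides f q c th n s e X B 0 N H Hc He ltac:(lra)). fold g B in S1.
      destruct S1 as (_ & S2 & S3 & S4). change (level n c 0) with c in *.
      rewrite I1 in R.
      replace ((A (B, (e * c)%R) - A (X, (e * c)%R)) + e * (2 * Ci * PI) * Csum (fun k => gpow f (pole n e k) (s - 1)) N)%C with
        (CRInt (fun x => g (x, (e * B)%R)) X B - Ci * (CRInt (fun y => g (B, y)) (e * c) (e * B) - CRInt (fun y => g (X, y)) (e * c) (e * B)))%C.
      2:{ replace (e * (2 * Ci * PI) * Csum (fun k => gpow f (pole n e k) (s - 1)) N)%C with
           (- (- e * (2 * Ci * PI) * Csum (fun k => gpow f (pole n e k) (s - 1)) N))%C by ring.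
          rewrite <- R. ring. }
      assert (Len : Rabs (e * B - e * c) <= B).
      { rewrite <- Rmult_minus_distr_l, Rabs_mult.
        assert (Rabs e = 1) by (destruct He as [->| ->]; [apply Rabs_R1|rewrite Rabs_Ropp; apply Rabs_R1]).
        rewrite H0, Rabs_pos_eq; lra. }
      assert (B1 : Cmod (CRInt (fun x => g (x, (e * B)%R)) X B) <= Rabs (B - X) * eps).
      { apply CRInt_le_signed; auto. }
      assert (B2 : Cmod (CRInt (fun y => g (B, y)) (e * c) (e * B)) <= Rabs (e * B - e * c) * eps).
      { apply CRInt_le_signed; auto. intros t _. apply Far. rewrite Rabs_pos_eq; lra. }
      assert (B3 : Cmod (CRInt (fun y => g (X, y)) (e * c) (e * B)) <= Rabs (e * B - e * c) * eps).
      { apply CRInt_le_signed; auto. intros t _. apply Far. rewrite Rabs_left; lra. }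
      rewrite (Rabs_pos_eq (B - X)) in B1 by lra.
      eapply Rle_trans; [apply Cmod_triangle_minus|]. rewrite Cmod_mult, Cmod_Ci, Rmult_1_l.
      pose proof (Cmod_triangle_minus (CRInt (fun y => g (B, y)) (e * c) (e * B)) (CRInt (fun y => g (X, y)) (e * c) (e * B))).
      assert ((B - X) * eps <= 6 * B * eps) by (apply Rmult_le_compat_r; auto).
      assert (Rabs (e * B - e * c) * eps <= B * eps) by (apply Rmult_le_compat_r; auto).
      lra. }
    destruct (Hor 1 (or_introl eq_refl)) as (D1 & D2 & E1).
    destruct (Hor (- (1)) (or_intror eq_refl)) as (D3 & D4 & E2).
    replace (1 * c) with c in * by ring. replace (- (1) * c) with (- c) in * by ring.
    rewrite (hankel_trunc_prim g A q c m th _ Hq Hm Hth Hg HA). fold X.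
    assert (Vert : forall x y1 y2, B <= Rabs x -> (x < 0 -> 0 < Rmin y1 y2 \/ Rmax y1 y2 < 0) -> y1 <= y2 -> y2 - y1 <= 2 * c ->
       Cmod (A (x, y2) - A (x, y1)) <= 2 * B * eps).
    { intros x y1 y2 Hx Hy Hy12 Hl.
      assert (Dom : forall y, y1 <= y <= y2 -> slit_domain q m (x, y)).
      { intros y Hyy. rewrite Rmin_left, Rmax_right in Hy by auto. split; [|split].
        - destruct (Rlt_le_dec x 0) as [Hx0|Hx0].
          + apply off_slit_im. destruct (Hy Hx0); lra.
          + left. change (0 < x). rewrite Rabs_pos_eq in Hx; lra.
        - eapply Rlt_le_trans; [|exact (re_le_Cmod (x, y))]. change (q < Rabs x). lra.
        - left. change (x <> 0). intros E. rewrite E, Rabs_R0 in Hx. lra. }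
      rewrite <- (CRInt_vert_prim A g y1 y2 x); auto.
      2:{ intros y Hyy. apply holo_cont, Hg, Dom, Hyy. }
      rewrite Cmod_mult, Cmod_Ci, Rmult_1_l.
      apply Rle_trans with ((y2 - y1) * eps).
      - apply CRInt_le with (fun y => g (x, y)); auto.
        apply CRInt_correct, ex_CRInt_vert; auto. intros y Hyy. apply holo_cont, Hg, Dom, Hyy.
      - apply Rmult_le_compat_r; lra. }
    set (y0 := c * sin th) in *.
    pose proof (Vert X y0 c ltac:(rewrite Rabs_left; lra) ltac:(intros; left; rewrite Rmin_left; lra) ltac:(lra) ltac:(lra)) as V1.
    pose proof (Vert X (- c) (- y0) ltac:(rewrite Rabs_left; lra) ltac:(intros; right; rewrite Rmax_right; lra) ltac:(lra) ltac:(lra)) as V2.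
    pose proof (Vert B (- c) c ltac:(rewrite Rabs_pos_eq; lra) ltac:(intros; exfalso; lra) ltac:(lra) ltac:(lra)) as V3.
    set (S1 := Csum (fun k => gpow f (pole n 1 k) (s - 1)) N) in *.
    set (S2 := Csum (fun k => gpow f (pole n (- (1)) k) (s - 1)) N) in *.
    (* The new path runs from [(X, - y0)] down to height [- c], right to [B], up to height [c], left
       to [X] and down to [(X, y0)]. At abscissa [B] it crosses the positive axis, where the
       primitive is available. *)
    replace (A (X, y0) - A (X, (- y0)%R) - 2 * Ci * PI * (S1 + S2))%C with
      (- (A (X, c) - A (X, y0)) - (A (B, c) - A (X, c) + 1 * (2 * Ci * PI) * S1) + (A (B, c) - A (B, (- c)%R))
        + (A (B, (- c)%R) - A (X, (- c)%R) + (- (1))%R * (2 * Ci * PI) * S2) - (A (X, (- y0)%R) - A (X, (- c)%R)))%C.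
    2:{ rewrite RtoC_opp. ring. }
    replace (24 * K * exp (Re s * ln B)) with (24 * (B * eps)) by (rewrite Heps; ring).
    eapply Rle_trans; [apply Cmod_triangle_minus|].
    eapply Rle_trans; [apply Rplus_le_compat_r, Cmod_triangle|].
    eapply Rle_trans; [apply Rplus_le_compat_r, Rplus_le_compat_r, Cmod_triangle|].
    eapply Rle_trans; [apply Rplus_le_compat_r, Rplus_le_compat_r, Rplus_le_compat_r, Cmod_triangle_minus|].
    rewrite Cmod_opp. 
    assert (P : 0 <= B * eps) by (apply Rmult_le_pos; lra). lra. }
  intros eps He.
  destruct (FC_int_limit f q c m th s H (eps / 2) ltac:(lra)) as [N1 HN1].
  set (e1 := eps / (2 * (24 * K + 1))).
  assert (He1 : 0 < e1) by (apply Rdiv_lt_0_compat; lra).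
  destruct (INR_unbounded (exp (ln e1 / Re s))) as [N2 HN2].
  exists (S (max N1 N2)). intros N HN.
  specialize (HN1 (10 * (n + N))%nat ltac:(lia)). specialize (Main N ltac:(lia)). fold g in HN1.
  assert (HB : INR N2 <= level n c N).
  { unfold level. destruct N; [lia|]. rewrite plus_INR.
    assert (INR N2 <= INR (S N)) by (apply le_INR; lia). pose proof (pos_INR N2). nra. }
  assert (Small : exp (Re s * ln (level n c N)) < e1).
  { rewrite <- (exp_ln e1) by auto. apply exp_increasing.
    assert (L : ln e1 / Re s < ln (level n c N)).
    { rewrite <- (ln_exp (ln e1 / Re s)). apply ln_increasing; [apply exp_pos|lra]. }
    apply (Rmult_lt_gt_compat_neg_l (Re s)) in L; [|lra].
    replace (Re s * (ln e1 / Re s)) with (ln e1) in L by (field; lra). lra. }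
  set (T := hankel_trunc c th g (10 * (n + N))) in *.
  match goal with |- Cmod (?a - ?b) < _ => replace (a - b)%C with ((T - b) - (T - a))%C by ring end.
  eapply Rle_lt_trans; [apply Cmod_triangle_minus|].
  assert (24 * K * exp (Re s * ln (level n c N)) <= eps / 2).
  { apply Rle_trans with (24 * K * e1); [apply Rmult_le_compat_l; lra|].
    apply Rle_trans with ((24 * K + 1) * e1); [nra|]. right. unfold e1. field. lra. }
  lra.
Qed.

(** * The functional equation in the half-plane Re s < 0 *)

Lemma n_spec (f : R -> C) : Rbar_lt 0 (rho f) ->
  INR (n_ f) - 1 <= r_ f < INR (n_ f) /\ (1 <= n_ f)%nat.
Proof.
  intros H. pose proof (r_nonneg f H) as Hr. destruct (base_Int_part (r_ f)) as [B1 B2].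
  assert (H0 : (-1 < Int_part (r_ f))%Z) by (apply lt_IZR; lra).
  unfold n_. rewrite INR_IZR_INZ, Z2Nat.id by lia. rewrite plus_IZR. split; [lra|lia].
Qed.

(** The inequality [n_f - 1 <= r_f < n_f], scaled by [2 PI], sorts the poles: those with
    [|k| <= n_f - 1] lie in the disc excluded by [q], and those with [|k| >= n_f] on the removed
    rays. The last contour condition at [k = n_f] gives [c < 2 PI n_f]. *)
Lemma regular_contour_dilate (f : R -> C) (c th : R) :
  real_analytic0 f -> Rbar_lt 0 (rho f) -> hankel_contour (dilate (2 * Ci * PI)%C f) c th ->
  2 * PI * (INR (n_ f) - 1) < c < 2 * PI * INR (n_ f) /\
  exists q, regular_contour (dilate (2 * Ci * PI)%C f) q c (2 * PI * INR (n_ f)) th.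
Proof.
  intros Hf Hrho (Hc & Hth & Hk). pose proof PI_RGT_0 as Hpi.
  destruct (r_dilate f _ Hf C2PI_nz Hrho) as [Er Hrho'].
  destruct (n_spec f Hrho) as [Hn Hn1]. pose proof (r_nonneg f Hrho) as Hr.
  rewrite Cmod_2PI in Er.
  assert (Hr' : 0 <= r_ (dilate (2 * Ci * PI)%C f)) by (apply r_nonneg; auto).
  assert (Hc2 : c < 2 * PI * INR (n_ f)).
  { specialize (Hk (Z.of_nat (n_ f))). rewrite <- INR_IZR_INZ, Rabs_pos_eq in Hk by apply pos_INR.
    apply Hk. rewrite Er. apply Rmult_lt_compat_l; lra. }
  assert (Hc1 : 2 * PI * (INR (n_ f) - 1) <= r_ (dilate (2 * Ci * PI)%C f)).
  { rewrite Er. apply Rmult_le_compat_l; lra. }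
  split; [lra|]. set (q := (r_ (dilate (2 * Ci * PI)%C f) + c) / 2).
  exists q. repeat split; try (unfold q; lra).
  - apply P_coef_bound; auto. unfold q; lra.
  - intros z (H1 & H2 & H3) E. apply Cexp_eq_1 in E. destruct E as [k Hz].
    assert (Ez : z = (0, - (2 * PI * IZR k))).
    { replace z with (- - z)%C by ring. rewrite Hz. unfold Copp; simpl. f_equal. ring. }
    rewrite Ez in H2, H3. change (Re (0, - (2 * PI * IZR k))) with 0 in H3.
    change (Im (0, - (2 * PI * IZR k))) with (- (2 * PI * IZR k)) in H3.
    destruct H3 as [H3|H3]; [lra|].
    assert (H4 : Cmod (0, - (2 * PI * IZR k)) <= 2 * PI * Rabs (IZR k)).
    { eapply Rle_trans; [apply Cmod_le_abs|].
      change (Rabs 0 + Rabs (- (2 * PI * IZR k)) <= 2 * PI * Rabs (IZR k)).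
      rewrite Rabs_R0, Rabs_Ropp, Rabs_mult, (Rabs_pos_eq (2 * PI)); lra. }
    rewrite Rabs_Ropp, Rabs_mult, (Rabs_pos_eq (2 * PI)) in H3 by lra.
    apply Rmult_lt_reg_l in H3; [|lra].
    assert (H5 : Rabs (IZR k) <= INR (n_ f) - 1).
    { rewrite <- abs_IZR in *. rewrite INR_IZR_INZ in *. apply lt_IZR in H3.
      rewrite <- minus_IZR. apply IZR_le. lia. }
    assert (2 * PI * Rabs (IZR k) <= 2 * PI * (INR (n_ f) - 1)) by (apply Rmult_le_compat_l; lra).
    unfold q in H2. lra.
Qed.

Lemma Cpower_Cexp (w a : C) : - PI < Im w < PI -> Cpower (Cexp w) a = Cexp (a * w)%C.
Proof. intros H. unfold Cpower. rewrite Clog_Cexp by auto. reflexivity. Qed.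

Lemma Cexp_real (x : R) : 0 < x -> Cexp (ln x, 0) = RtoC x.
Proof.
  intros Hx. unfold Cexp. change (Re (ln x, 0)) with (ln x). change (Im (ln x, 0)) with 0.
  rewrite exp_ln, cos_0, sin_0 by auto. unfold RtoC. f_equal; ring.
Qed.

Lemma Cexp_imag (e x : R) : 0 < x -> e = 1 \/ e = - (1) -> Cexp (ln x, e * (PI / 2)) = (0, e * x).
Proof.
  intros Hx He. unfold Cexp. change (Re (ln x, e * (PI / 2))) with (ln x).
  change (Im (ln x, e * (PI / 2))) with (e * (PI / 2)). rewrite exp_ln by auto.
  destruct He as [->| ->].
  - rewrite !Rmult_1_l, cos_PI2, sin_PI2. f_equal; ring.
  - replace (- (1) * (PI / 2)) with (- (PI / 2)) by ring. rewrite cos_neg, sin_neg, cos_PI2, sin_PI2. f_equal; ring.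
Qed.

Lemma Cpower_pos (x : R) (a : C) : 0 < x -> Cpower x a = Cexp (a * ln x)%C.
Proof.
  intros Hx. rewrite <- (Cexp_real x Hx), Cpower_Cexp.
  - f_equal.
  - change (Im (ln x, 0)) with 0. pose proof PI_RGT_0. lra.
Qed.

Lemma Cpower_imag (e x : R) (a : C) : 0 < x -> e = 1 \/ e = - (1) ->
  Cpower (0, (e * x)%R) a = (Cpower x a * Cexp (a * (Ci * (e * (PI / 2))%R)))%C.
Proof.
  intros Hx He. pose proof PI_RGT_0 as Hpi. rewrite <- (Cexp_imag e x Hx He), Cpower_Cexp, Cpower_pos by
    (auto; change (Im (ln x, (e * (PI / 2))%R)) with (e * (PI / 2)); destruct He as [->| ->]; lra).
  rewrite <- Cexp_plus. f_equal. rewrite (C_re_im (ln x)). ring.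
Qed.

Lemma Cpower_mult_pos (x y : R) (a : C) : 0 < x -> 0 < y ->
  Cpower (x * y)%R a = (Cpower x a * Cpower y a)%C.
Proof.
  intros Hx Hy. rewrite !Cpower_pos, ln_mult, RtoC_plus, <- Cexp_plus by (auto using Rmult_lt_0_compat).
  f_equal. ring.
Qed.

(** The power [i^s] for [e = 1] and [(-i)^s] for [e = -1]. *)
Definition rot (e : R) (s : C) : C := Cexp (s * (Ci * (e * (PI / 2))%R))%C.

(* The factor (2 pi i)^j of the coefficients of f_(2 pi i) cancels against the
   power of the pole 2 pi i (n + k), leaving the parity sign e^j. *)
Lemma gpow_dilate_pole (f : R -> C) (q : R) (par : C) (e : R) (n k : nat) (s : C) :
  real_analytic0 f -> geom_bounded (P_coef f) q -> 0 < q < INR n ->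
  e = 1 \/ e = - (1) ->
  (forall j, (RtoC e ^ j * P_coef f j)%C = (par * P_coef f j)%C) ->
  gpow (dilate (2 * Ci * PI)%C f) (pole n e k) s =
    (Cpower (2 * PI)%R s * rot e s * par * gpow f (INR (n + k)) s)%C.
Proof.
  intros Hf HP Hq He Hpar. pose proof PI_RGT_0 as Hpi.
  assert (Hx : 0 < INR (n + k)) by (rewrite plus_INR; pose proof (pos_INR k); lra).
  apply CSeries_unique.
  assert (Hs : is_Cseries (gterm (P_coef f) (INR (n + k)) s) (gpow f (INR (n + k)) s)).
  { apply (gpow_series f q); auto. rewrite Cmod_R, Rabs_pos_eq by lra. rewrite plus_INR. pose proof (pos_INR k); lra. }
  apply Clim_scal with (k := (Cpower (2 * PI)%R s * rot e s * par)%C) in Hs.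
  apply Clim_ext with (2 := Hs). intros N. rewrite <- Csum_scal. apply Csum_ext. intros j _.
  set (x := INR (n + k)) in *.
  assert (Hz : pole n e k = (2 * Ci * PI * e * x)%C).
  { unfold pole. fold x. rewrite C_re_im, !RtoC_mult. ring. }
  assert (Nx : RtoC x <> RtoC 0) by (intros Q; apply RtoC_inj in Q; lra).
  assert (Ne : RtoC e <> RtoC 0) by (intros Q; apply RtoC_inj in Q; destruct He; lra).
  assert (Nz : pole n e k <> RtoC 0) by (rewrite Hz; repeat apply Cmult_neq_0; auto using C2PI_nz;
    [intros Q; apply RtoC_inj in Q; lra|apply Ci_nz|intros Q; apply RtoC_inj in Q; lra]).
  unfold gterm. rewrite P_coef_dilate by auto using C2PI_nz. rewrite !Cpower_sub_nat by auto.
  assert (Ep : Cpower (pole n e k) s = (Cpower (2 * PI)%R s * Cpower x s * rot e s)%C).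
  { unfold pole. fold x. rewrite Cpower_imag by (auto; apply Rmult_lt_0_compat; lra).
    rewrite Cpower_mult_pos by lra. reflexivity. }
  rewrite Ep, Hz, !Cpow_mult_l.
  assert (Ee : (/ (RtoC e) ^ j)%C = (RtoC e ^ j)%C).
  { rewrite <- Cpow_inv by auto. f_equal. rewrite <- RtoC_inv by (destruct He; lra). f_equal.
    destruct He as [->| ->]; field. }
  assert (Y : (2 * Ci * PI)%C <> RtoC 0) by apply C2PI_nz.
  assert (Nj : ((2 * Ci * PI) ^ j)%C <> RtoC 0) by (apply Cpow_nz; auto).
  rewrite !Cpow_mult_l in Nj.
  set (u := (2 ^ j * Ci ^ j * RtoC PI ^ j)%C) in *.
  assert (Inv : (/ (u * RtoC e ^ j * RtoC x ^ j))%C = (/ u * RtoC e ^ j * / RtoC x ^ j)%C).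
  { rewrite <- Ee at 2. field. repeat split; auto using Cpow_nz. }
  rewrite Inv.
  transitivity (Cbinom s j * (par * P_coef f j) * (Cpower (2 * PI)%R s * Cpower x s * rot e s * / RtoC x ^ j))%C; [ring|].
  rewrite <- Hpar.
  transitivity ((u * / u) * (Cbinom s j * (RtoC e ^ j * P_coef f j) * (Cpower (2 * PI)%R s * Cpower x s * rot e s * / RtoC x ^ j)))%C.
  { rewrite Cinv_r by auto. ring. }
  ring.
Qed.

Lemma rot_shift (e : R) (s : C) : e = 1 \/ e = - (1) -> rot e (s - 1) = (rot e s * (- (e * Ci)))%C.
Proof.
  intros He. unfold rot.
  replace ((s - 1) * (Ci * (e * (PI / 2))%R))%C with (s * (Ci * (e * (PI / 2))%R) + - (Ci * (e * (PI / 2))%R))%C by ring.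
  rewrite Cexp_plus. f_equal. unfold Cexp.
  replace (Re (- (Ci * (e * (PI / 2))%R))) with 0 by (simpl; ring).
  replace (Im (- (Ci * (e * (PI / 2))%R))) with (- (e * (PI / 2))) by (simpl; ring).
  rewrite exp_0, cos_neg, sin_neg.
  destruct He as [->| ->].
  - rewrite !Rmult_1_l, cos_PI2, sin_PI2. unfold RtoC, Ci, Cmult, Copp; simpl. f_equal; ring.
  - replace (- (1) * (PI / 2)) with (- (PI / 2)) by ring. rewrite cos_neg, sin_neg, cos_PI2, sin_PI2.
    unfold RtoC, Ci, Cmult, Copp; simpl. f_equal; ring.
Qed.

Lemma rot_opp (s : C) : rot (- (1)) s = (/ rot 1 s)%C.
Proof.
  unfold rot. rewrite <- Cexp_opp. f_equal. rewrite !RtoC_mult, RtoC_opp. ring.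
Qed.

(* 2 i sin (pi s / 2) if par = 1, and 2 cos (pi s / 2) if par = -1. *)
Definition trig_factor (par s : C) : C := (rot 1 s - par * rot (- (1)) s)%C.

Lemma Csum_limit_div (a : nat -> C) (k F : C) : k <> RtoC 0 ->
  Clim (fun N => k * Csum a N)%C F -> CSeries a = (F / k)%C.
Proof.
  intros Hk H. apply CSeries_unique. apply Clim_scal with (k := (/ k)%C) in H.
  replace (F / k)%C with (/ k * F)%C by (unfold Cdiv; ring).
  eapply Clim_ext; [|exact H]. intros n. cfield. exact Hk.
Qed.

(** A zero would force [|i^s| = |(-i)^s|], that is [e^(- PI Im s / 2) = e^(PI Im s / 2)], hence a
    real [s]. *)
Lemma trig_factor_nz (par s : C) : Cmod par = 1 -> Im s <> 0 -> trig_factor par s <> RtoC 0.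
Proof.
  intros Hp Hs E. unfold trig_factor in E.
  assert (E1 : rot 1 s = (par * rot (- (1)) s)%C) by (apply (proj2 (Ceq_minus _ _)); exact E).
  apply (f_equal Cmod) in E1. rewrite Cmod_mult, Hp, Rmult_1_l in E1. unfold rot in E1. rewrite !Cmod_Cexp in E1.
  apply exp_inv in E1. rewrite !re_mult in E1. simpl in E1. pose proof PI_RGT_0.
  assert (Im s * PI = 0) by lra. apply Rmult_integral in H0. destruct H0; lra.
Qed.

(** The poles at [2 PI i k] and [- 2 PI i k] contribute the same partial sum of the LC-series with
    different constants. Off the real axis the combined constant is nonzero, so convergence of the
    series is a consequence of the convergence of the residue sums. *)
Lemma functional_equation_left (f : R -> C) (L : C -> C) (c th : R) (par s : C) :
  real_analytic0 f -> Rbar_lt 0 (rho f) -> is_LC_function f L ->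
  hankel_contour (dilate (2 * Ci * PI)%C f) c th ->
  par = RtoC 1 \/ par = (- (1))%C ->
  (forall j, ((- (1)) ^ j * P_coef f j)%C = (par * P_coef f j)%C) ->
  Re s < 0 -> Im s <> 0 ->
  (Cpower (2 * PI)%R s * trig_factor par s * L (1 - s))%C = FC_int (dilate (2 * Ci * PI)%C f) c th s.
Proof.
  intros Hf Hrho HL Hmu Hp Hpar Hs Hi. pose proof PI_RGT_0 as Hpi.
  destruct (regular_contour_dilate f c th Hf Hrho Hmu) as [Hc [q Hreg]].
  destruct (n_spec f Hrho) as [Hn Hn1]. pose proof (r_nonneg f Hrho) as Hr.
  pose proof (FC_int_poles _ q c th (n_ f) s Hreg Hc Hs) as Lim.
  set (q0 := (r_ f + INR (n_ f)) / 2). assert (Hq0 : 0 < q0 < INR (n_ f)) by (unfold q0; lra).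
  assert (HP : geom_bounded (P_coef f) q0) by (apply P_coef_bound; auto; unfold q0; lra).
  set (F := FC_int (dilate (2 * Ci * PI)%C f) c th s) in *.
  assert (Hm : Cmod par = 1) by (destruct Hp as [->| ->]; rewrite ?Cmod_opp; apply Cmod_1).
  set (k := (Cpower (2 * PI)%R s * trig_factor par s)%C).
  assert (Hk : k <> RtoC 0) by (apply Cmult_neq_0; [apply Cpower_nz|apply trig_factor_nz; auto]).
  assert (Lim2 : Clim (fun N => k * Csum (fun j => gpow f (INR (n_ f + j)) (- (1 - s))) N)%C F).
  { apply Clim_ext with (2 := Lim). intros N.
    assert (E1 : Csum (fun j => gpow (dilate (2 * Ci * PI)%C f) (pole (n_ f) 1 j) (s - 1)) N =
       (Cpower (2 * PI)%R (s - 1) * rot 1 (s - 1) * 1 * Csum (fun j => gpow f (INR (n_ f + j)) (s - 1)) N)%C).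
    { rewrite <- Csum_scal. apply Csum_ext. intros j _. apply (gpow_dilate_pole f q0); auto.
      intros i. rewrite Cpow_1_l. reflexivity. }
    assert (E2 : Csum (fun j => gpow (dilate (2 * Ci * PI)%C f) (pole (n_ f) (- (1)) j) (s - 1)) N =
       (Cpower (2 * PI)%R (s - 1) * rot (- (1)) (s - 1) * par * Csum (fun j => gpow f (INR (n_ f + j)) (s - 1)) N)%C).
    { rewrite <- Csum_scal. apply Csum_ext. intros j _. apply (gpow_dilate_pole f q0); auto.
      intros i. rewrite RtoC_opp. apply Hpar. }
    rewrite E1, E2. replace (- (1 - s))%C with (s - 1)%C by ring.
    rewrite !rot_shift by auto. rewrite RtoC_opp.
    unfold Cminus at 1 3. rewrite !Cpower_plus, !Cpower_opp, Cpower_1.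
    2:{ intros Q; apply RtoC_inj in Q; lra. }
    unfold k, trig_factor. set (S := Csum _ N). rewrite RtoC_mult.
    assert (NP : RtoC PI <> RtoC 0) by (intros Q; apply RtoC_inj in Q; lra).
    assert (N2 : RtoC 2 <> RtoC 0) by (intros Q; apply RtoC_inj in Q; lra).
    assert (CC : (Ci * Ci)%C = (- (1))%C) by (unfold Ci, Cmult, RtoC, Copp; simpl; f_equal; ring).
    (* The [2 i PI] of the residues meets the [(2 PI)^(-1)] and the factors [- i] and [i] left by
       the shift from [s] to [s - 1]; all constants reduce to [- i^2 = 1]. *)
    transitivity ((- (Ci * Ci)) * (Cpower (2 * PI)%C s * (rot 1 s - par * rot (- (1)) s) * S))%C.
    { field. auto. }
    rewrite CC. ring. }
  pose proof (Csum_limit_div _ k F Hk Lim2) as E.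
  destruct HL as (HL & _). rewrite (HL (1 - s)%C).
  - rewrite E. field. exact Hk.
  - unfold Cminus. rewrite re_plus, re_opp, re_RtoC. lra.
Qed.

(** * The reflection formula for Gamma *)

(** In contrast to [Cexp_near_0], a second-order bound on a disc of given radius; both Gauss's limit
    and the Wallis-type ratio need the square. *)
Lemma Cexp_quadratic (R0 : R) : 0 < R0 -> exists K, 0 <= K /\
  forall w, Cmod w <= R0 -> Cmod (Cexp w - 1 - w) <= K * Cmod w ^ 2.
Proof.
  intros HR.
  assert (H0 : forall z, holo Cexp z) by (intros z; eexists; apply Cderive_Cexp).
  destruct (square_bounded Cexp 0 (2 * R0) ltac:(lra)) as [M HM]; [intros; apply holo_cont; auto|].
  destruct (taylor_square_2 Cexp 0 (2 * R0) M ltac:(lra) (fun z _ => H0 z) HM) as (c & _ & D & Hc & _).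
  assert (HM0 : 0 <= M) by (eapply Rle_trans; [apply Cmod_ge_0|]; apply (HM 0); split; rewrite ?re_RtoC, ?im_RtoC; lra).
  set (K := 3 * M / (2 * R0) ^ 2) in *.
  assert (HK : 0 <= K) by (apply Rdiv_le_0_compat; [lra|apply pow_lt; lra]).
  assert (Ec : c 1%nat = RtoC 1).
  { pose proof (is_C_derive_unique _ _ _ D) as U1.
    pose proof (is_C_derive_unique _ _ _ (Cderive_Cexp 0)) as U2.
    rewrite <- Cexp_0. exact (eq_trans (eq_sym U1) U2). }
  exists K. split; auto. intros w Hw. specialize (Hc w). replace (w - 0)%C with w in Hc by ring.
  rewrite Cexp_0, Ec in Hc. replace (Cexp w - 1 - w)%C with (Cexp w - 1 - 1 * w)%C by ring. apply Hc. lra.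
Qed.

(** Because [1 / (n + 1)^2 <= 1 / n - 1 / (n + 1)], the quantity [|u n| exp (K / n)] does not
    increase, so [u] is bounded; the increments are then dominated by a telescoping sum. *)
Lemma product_converges (u : nat -> C) (K : R) : 0 <= K ->
  (forall n, (1 <= n)%nat -> Cmod (u (S n) - u n) <= K / INR (S n) ^ 2 * Cmod (u n)) ->
  exists l, Clim u l.
Proof.
  intros HK H.
  assert (P : forall n, (1 <= n)%nat -> 1 <= INR n) by (intros n Hn; change 1 with (INR 1); apply le_INR; auto).
  assert (T : forall n, (1 <= n)%nat -> / INR (S n) ^ 2 <= / INR n - / INR (S n)).
  { intros n Hn. specialize (P n Hn). rewrite S_INR.
    apply Rmult_le_reg_r with (INR n * (INR n + 1) ^ 2); [apply Rmult_lt_0_compat; [lra|apply pow_lt; lra]|].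
    replace (/ (INR n + 1) ^ 2 * (INR n * (INR n + 1) ^ 2)) with (INR n) by (field; lra).
    replace ((/ INR n - / (INR n + 1)) * (INR n * (INR n + 1) ^ 2)) with (INR n + 1) by (field; lra). lra. }
  set (M := Cmod (u 1%nat) * exp K).
  assert (B : forall n, Cmod (u (S n)) * exp (K * / INR (S n)) <= M).
  { induction n as [|n IH].
    - unfold M. change (INR 1) with 1. rewrite Rinv_1, Rmult_1_r. lra.
    - eapply Rle_trans; [|apply IH].
      specialize (H (S n) ltac:(lia)). specialize (T (S n) ltac:(lia)).
      assert (X : Cmod (u (S (S n))) <= Cmod (u (S n)) * exp (K / INR (S (S n)) ^ 2)).
      { pose proof (Cmod_triangle_inv (u (S (S n))) (u (S n))).
        pose proof (exp_ineq1_le (K / INR (S (S n)) ^ 2)). pose proof (Cmod_ge_0 (u (S n))). nra. }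
      eapply Rle_trans; [apply Rmult_le_compat_r; [apply Rlt_le, exp_pos|exact X]|].
      rewrite Rmult_assoc, <- exp_plus. apply Rmult_le_compat_l; [apply Cmod_ge_0|].
      apply exp_monotone. unfold Rdiv. nra. }
  assert (HM : 0 <= M) by (apply Rmult_le_pos; [apply Cmod_ge_0|apply Rlt_le, exp_pos]).
  assert (B' : forall n, Cmod (u (S n)) <= M).
  { intros n. eapply Rle_trans; [|apply B]. rewrite <- (Rmult_1_r (Cmod (u (S n)))) at 1.
    apply Rmult_le_compat_l; [apply Cmod_ge_0|]. rewrite <- exp_0. apply exp_monotone.
    apply Rmult_le_pos; auto. apply Rlt_le, Rinv_0_lt_compat, lt_0_INR. lia. }
  assert (D : forall n m, (1 <= n)%nat -> Cmod (u (n + m)%nat - u n) <= K * M * (/ INR n - / INR (n + m))).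
  { intros n m Hn. induction m as [|m IH].
    - rewrite Nat.add_0_r. replace (u n - u n)%C with (RtoC 0) by ring. rewrite Cmod_0. lra.
    - rewrite Nat.add_succ_r.
      replace (u (S (n + m)) - u n)%C with ((u (S (n + m)) - u (n + m)%nat) + (u (n + m)%nat - u n))%C by ring.
      eapply Rle_trans; [apply Cmod_triangle|].
      specialize (H (n + m)%nat ltac:(lia)). specialize (T (n + m)%nat ltac:(lia)).
      assert (Bm : Cmod (u (n + m)%nat) <= M) by (destruct (n + m)%nat as [|k] eqn:E; [lia|apply B']).
      assert (0 <= / INR (S (n + m)) ^ 2) by (apply Rlt_le, Rinv_0_lt_compat, pow_lt, lt_0_INR; lia).
      assert (K / INR (S (n + m)) ^ 2 * Cmod (u (n + m)%nat) <= K * M * / INR (S (n + m)) ^ 2).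
      { unfold Rdiv. rewrite (Rmult_comm K M), (Rmult_comm M K), !Rmult_assoc. apply Rmult_le_compat_l; auto.
        rewrite (Rmult_comm M). apply Rmult_le_compat_l; auto. }
      assert (K * M * / INR (S (n + m)) ^ 2 <= K * M * (/ INR (n + m) - / INR (S (n + m)))).
      { apply Rmult_le_compat_l; auto. apply Rmult_le_pos; auto. }
      lra. }
  apply Clim_cauchy. intros eps He.
  assert (HKM : 0 <= K * M) by (apply Rmult_le_pos; auto).
  destruct (INR_unbounded (2 * (K * M + 1) / eps)) as [N HN].
  exists (S N). 
  assert (Q : forall n, (S N <= n)%nat -> Cmod (u n - u (S N)) < eps / 2).
  { intros n Hn. pose proof (D (S N) (n - S N)%nat ltac:(lia)) as Dn.
    replace (S N + (n - S N))%nat with n in Dn by lia.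
    assert (HSN : INR N < INR (S N)) by (rewrite S_INR; lra).
    assert (0 < 2 * (K * M + 1) / eps) by (apply Rdiv_lt_0_compat; lra).
    assert (/ INR (S N) < eps / (2 * (K * M + 1))).
    { replace (eps / (2 * (K * M + 1))) with (/ (2 * (K * M + 1) / eps)) by (field; lra).
      apply Rinv_lt_contravar; [apply Rmult_lt_0_compat; lra|lra]. }
    assert (0 < / INR n) by (apply Rinv_0_lt_compat, lt_0_INR; lia).
    assert (0 < / INR (S N)) by (apply Rinv_0_lt_compat; lra).
    assert ((K * M + 1) * / INR (S N) < eps / 2).
    { apply Rlt_le_trans with ((K * M + 1) * (eps / (2 * (K * M + 1)))); [apply Rmult_lt_compat_l; lra|right; field; lra]. }
    nra. }
  intros n m Hn Hm.
  replace (u n - u m)%C with ((u n - u (S N)) - (u m - u (S N)))%C by ring.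
  eapply Rle_lt_trans; [apply Cmod_triangle_minus|]. pose proof (Q n Hn). pose proof (Q m Hm). lra.
Qed.

Definition gauss (s : C) (n : nat) : C :=
  (INR (fact n) * Cpower (INR n) s / Cprod (fun j => s + INR j) (S n))%C.

Lemma Cprod_nz (u : nat -> C) (n : nat) : (forall j, u j <> RtoC 0) -> Cprod u n <> RtoC 0.
Proof. intros H. induction n as [|n IH]; simpl; [apply C1_nz|]. apply Cmult_neq_0; auto. Qed.

Lemma RtoC_nz (x : R) : x <> 0 -> RtoC x <> RtoC 0.
Proof. intros H E. apply RtoC_inj in E. auto. Qed.

(** The ratio of consecutive terms is [(1 + 1 / n)^s (n + 1) / (s + n + 1)], which is
    [1 + O(1 / n^2)] because [s ln (1 + 1 / n)] and [s / (n + 1)] agree to first order. *)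
Lemma gauss_converges (s : C) : (forall j : nat, (s + INR j)%C <> RtoC 0) -> Clim (gauss s) (CGamma s).
Proof.
  intros Hs.
  enough (X : exists l, Clim (gauss s) l).
  { destruct X as [l Hl]. replace (CGamma s) with l; [exact Hl|]. symmetry. apply CLim_seq_unique. exact Hl. }
  pose proof (Cmod_ge_0 s) as Ps.
  destruct (Cexp_quadratic (2 * Cmod s + 1) ltac:(lra)) as [K [HK Hq]].
  assert (Hlow : exists a, 0 < a /\ forall n, (1 <= n)%nat -> a <= Cmod (s + INR n) / INR n).
  { destruct (INR_unbounded (2 * Cmod s)) as [N HN].
    assert (A : forall k, exists a, 0 < a /\ forall n, (1 <= n < k)%nat -> a <= Cmod (s + INR n) / INR n).
    { induction k as [|k [a [Ha Hk]]]; [exists 1; split; [lra|intros; lia]|].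
      destruct k as [|k]; [exists 1; split; [lra|intros; lia]|].
      assert (P : 0 < Cmod (s + INR (S k)) / INR (S k)).
      { apply Rdiv_lt_0_compat; [apply Cmod_gt_0, Hs|apply lt_0_INR; lia]. }
      exists (Rmin a (Cmod (s + INR (S k)) / INR (S k))). split; [apply Rmin_glb_lt; auto|].
      intros n Hn. destruct (Nat.eq_dec n (S k)) as [->|]; [apply Rmin_r|].
      eapply Rle_trans; [apply Rmin_l|apply Hk; lia]. }
    destruct (A N) as [a [Ha HaN]]. exists (Rmin a (/ 2)). split; [apply Rmin_glb_lt; lra|].
    intros n Hn. destruct (Compare_dec.le_lt_dec N n) as [Hl|Hl].
    - eapply Rle_trans; [apply Rmin_r|]. apply le_INR in Hl.
      assert (Hn0 : 0 < INR n) by (apply lt_0_INR; lia).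
      apply Rmult_le_reg_r with (INR n); auto. unfold Rdiv. rewrite Rmult_assoc, Rinv_l, Rmult_1_r by lra.
      pose proof (Cmod_triangle_inv (INR n) (- s)) as T. rewrite Cmod_opp, Cmod_R, Rabs_pos_eq in T by lra.
      replace (INR n - - s)%C with (s + INR n)%C in T by ring. lra.
    - eapply Rle_trans; [apply Rmin_l|apply HaN; lia]. }
  destruct Hlow as [a [Ha Hlow]].
  assert (HC : 0 <= 4 * (K * Cmod s ^ 2) + 2 * Cmod s).
  { apply Rplus_le_le_0_compat; [|lra]. apply Rmult_le_pos; [lra|]. apply Rmult_le_pos; auto. apply pow2_ge_0. }
  apply product_converges with ((4 * (K * Cmod s ^ 2) + 2 * Cmod s) / a).
  { apply Rdiv_le_0_compat; auto. }
  intros n Hn.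
  assert (Hn1 : 1 <= INR n) by (change 1 with (INR 1); apply le_INR; auto).
  set (x := INR (S n)). assert (Ex : x = INR n + 1) by apply S_INR.
  set (del := ln (x / INR n)).
  assert (Eg : gauss s (S n) = (gauss s n * (Cexp (s * del) * x / (s + x)))%C).
  { unfold gauss. change (Cprod (fun j => s + INR j)%C (S (S n))) with
      (Cprod (fun j => s + INR j) (S n) * (s + INR (S n)))%C. fold x.
    assert (N1 : Cprod (fun j => s + INR j)%C (S n) <> RtoC 0) by (apply Cprod_nz; auto).
    assert (N2 : (s + x)%C <> RtoC 0) by apply Hs.
    assert (E1 : Cpower x s = (Cpower (INR n) s * Cexp (s * del))%C).
    { rewrite !Cpower_pos by lra. rewrite <- Cexp_plus. f_equal.
      assert (E : ln x = ln (INR n) + del).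
      { unfold del. rewrite <- ln_mult; [f_equal; field; lra|lra|apply Rdiv_lt_0_compat; lra]. }
      rewrite E, RtoC_plus. ring. }
    rewrite E1, fact_simpl, mult_INR. fold x. rewrite RtoC_mult. field. auto. }
  assert (D1 : / x <= del <= / INR n).
  { unfold del. split.
    - pose proof (exp_ineq1_le (- ln (x / INR n))) as E. rewrite exp_Ropp, exp_ln in E by (apply Rdiv_lt_0_compat; lra).
      replace (/ (x / INR n)) with (1 - / x) in E by (rewrite Ex; field; lra). lra.
    - pose proof (exp_ineq1_le (ln (x / INR n))) as E. rewrite exp_ln in E by (apply Rdiv_lt_0_compat; lra).
      replace (x / INR n) with (1 + / INR n) in E at 2 by (rewrite Ex; field; lra). lra. }
  assert (D2 : / INR n <= 2 * / x).
  { apply Rmult_le_reg_r with (INR n * x); [apply Rmult_lt_0_compat; lra|].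
    replace (/ INR n * (INR n * x)) with x by (field; lra).
    replace (2 * / x * (INR n * x)) with (2 * INR n) by (field; lra). lra. }
  assert (D3 : / INR n - / x = / INR n * / x) by (rewrite Ex; field; lra).
  assert (Px : 0 < / x) by (apply Rinv_0_lt_compat; lra).
  assert (Px1 : / x <= / 2) by (apply Rinv_le_contravar; lra).
  assert (Hdel1 : 0 < del <= 1) by lra.
  assert (Msd : Cmod (s * del) = Cmod s * del) by (rewrite Cmod_mult, Cmod_R, Rabs_pos_eq; lra).
  assert (Q1 : Cmod (Cexp (s * del) - 1 - s * del) <= 4 * (K * Cmod s ^ 2) * / x ^ 2).
  { eapply Rle_trans; [apply Hq; rewrite Msd; assert (Cmod s * del <= Cmod s * 1) by (apply Rmult_le_compat_l; lra); lra|]. rewrite Msd, Rpow_mult_distr.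
    assert (E : del ^ 2 <= (2 * / x) ^ 2) by (apply pow_incr; lra).
    replace (4 * (K * Cmod s ^ 2) * / x ^ 2) with (K * (Cmod s ^ 2 * (2 * / x) ^ 2)) by (field; lra).
    apply Rmult_le_compat_l; auto. apply Rmult_le_compat_l; auto. apply pow2_ge_0. }
  assert (Q2 : Cmod (s * del - s / x) <= 2 * Cmod s * / x ^ 2).
  { replace (s * del - s / x)%C with (s * (del - / x)%R)%C by
      (rewrite RtoC_minus, RtoC_inv by lra; unfold Cdiv; ring).
    rewrite Cmod_mult, Cmod_R, Rabs_pos_eq by lra.
    replace (2 * Cmod s * / x ^ 2) with (Cmod s * (2 * / x * / x)) by (field; lra).
    apply Rmult_le_compat_l; auto. nra. }
  assert (Nx : RtoC x <> RtoC 0) by (apply RtoC_nz; lra).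
  assert (N2 : (s + x)%C <> RtoC 0) by apply Hs.
  rewrite Eg.
  replace (gauss s n * (Cexp (s * del) * x / (s + x)) - gauss s n)%C with
    (gauss s n * (((Cexp (s * del) - 1 - s * del) + (s * del - s / x)) * (x / (s + x))))%C by (field; auto).
  rewrite !Cmod_mult, Rmult_comm. apply Rmult_le_compat_r; [apply Cmod_ge_0|].
  rewrite Cmod_div, Cmod_R, (Rabs_pos_eq x) by (auto; lra).
  assert (L : x / Cmod (s + x) <= / a).
  { specialize (Hlow (S n) ltac:(lia)). fold x in Hlow.
    replace (x / Cmod (s + x)) with (/ (Cmod (s + x) / x)).
    - apply Rinv_le_contravar; auto.
    - field. split; (lra || (apply Rgt_not_eq, Cmod_gt_0; auto)). }
  replace ((4 * (K * Cmod s ^ 2) + 2 * Cmod s) / a / x ^ 2) with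
    ((4 * (K * Cmod s ^ 2) * / x ^ 2 + 2 * Cmod s * / x ^ 2) * / a) by (field; lra).
  apply Rmult_le_compat; auto using Cmod_ge_0.
  - apply Rdiv_le_0_compat; [lra|]. apply Cmod_gt_0; auto.
  - eapply Rle_trans; [apply Cmod_triangle|]. lra.
Qed.

Definition sine_product (s : C) (n : nat) : C := Cprod (fun j => 1 - s * s / (INR (S j) * INR (S j)))%C n.

(** An exact identity at each finite [n]: the factors [s + j] and [j - s] pair into [j^2 - s^2]. The
    last factor [1 - s + n] of the second product has no partner and survives as a ratio that tends
    to [1]. *)
Lemma gauss_product (s : C) (n : nat) : (1 <= n)%nat ->
  (forall j : nat, (s + INR j)%C <> RtoC 0) -> (forall j : nat, (1 - s + INR j)%C <> RtoC 0) ->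
  (gauss s n * gauss (1 - s) n * (s * sine_product s n) * ((1 - s + INR n) / INR n))%C = RtoC 1.
Proof.
  intros Hn H1 H2.
  assert (E : forall m, (Cprod (fun j => s + INR j) (S m) * Cprod (fun j => 1 - s + INR j) m)%C =
     (s * (INR (fact m) * INR (fact m)) * sine_product s m)%C).
  { induction m as [|m IH].
    - unfold sine_product. simpl. ring.
    - change (Cprod (fun j => s + INR j)%C (S (S m))) with (Cprod (fun j => s + INR j) (S m) * (s + INR (S m)))%C.
      change (Cprod (fun j => 1 - s + INR j)%C (S m)) with (Cprod (fun j => 1 - s + INR j) m * (1 - s + INR m))%C.
      change (sine_product s (S m)) with (sine_product s m * (1 - s * s / (INR (S m) * INR (S m))))%C.
      replace (Cprod (fun j => s + INR j) (S m) * (s + INR (S m)) * (Cprod (fun j => 1 - s + INR j) m * (1 - s + INR m)))%C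
       with ((Cprod (fun j => s + INR j) (S m) * Cprod (fun j => 1 - s + INR j) m) * ((s + INR (S m)) * (1 - s + INR m)))%C by ring.
      rewrite IH, fact_simpl, mult_INR, RtoC_mult.
      assert (N : RtoC (INR (S m)) <> RtoC 0) by (apply RtoC_nz, not_0_INR; auto).
      replace (1 - s + INR m)%C with (INR (S m) - s)%C by (rewrite S_INR, RtoC_plus; ring).
      field. exact N. }
  assert (Nn : RtoC (INR n) <> RtoC 0) by (apply RtoC_nz, not_0_INR; lia).
  assert (Nc1 : Cprod (fun j => s + INR j)%C (S n) <> RtoC 0) by (apply Cprod_nz; auto).
  assert (Nc2 : Cprod (fun j => 1 - s + INR j)%C n <> RtoC 0) by (apply Cprod_nz; auto).
  assert (Ep : (Cpower (INR n) s * Cpower (INR n) (1 - s))%C = RtoC (INR n)).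
  { rewrite <- Cpower_plus. replace (s + (1 - s))%C with (RtoC 1) by ring. apply Cpower_1. exact Nn. }
  unfold gauss. change (Cprod (fun j => 1 - s + INR j)%C (S n)) with (Cprod (fun j => 1 - s + INR j) n * (1 - s + INR n))%C.
  specialize (E n). specialize (H2 n).
  set (a := Cprod (fun j => s + INR j)%C (S n)) in *. set (b := Cprod (fun j => 1 - s + INR j)%C n) in *.
  transitivity ((Cpower (INR n) s * Cpower (INR n) (1 - s)) * (s * (INR (fact n) * INR (fact n)) * sine_product s n) / (a * b * INR n))%C.
  - field. auto.
  - rewrite Ep, <- E. field. auto.
Qed.

(** * The sine product by Wallis-type integrals *)

Lemma Ci2 : (Ci * Ci)%C = (- (1))%C.
Proof. unfold Ci, Cmult, RtoC, Copp; simpl. f_equal; ring. Qed.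

Lemma C2_nz : RtoC 2 <> RtoC 0.
Proof. apply RtoC_nz. lra. Qed.

Lemma Cderive_Ccos (z : C) : Cderive Ccos z (- Csin z)%C.
Proof.
  unfold Ccos, Csin, Cdiv.
  assert (A : Cderive (fun z => Ci * z)%C z Ci) by (eapply Cderive_eq; [apply Cderive_scal, Cderive_id|ring]).
  assert (B : Cderive (fun z => - (Ci * z))%C z (- Ci)%C) by (apply Cderive_opp, A).
  eapply Cderive_eq.
  - apply Cderive_mult; [|apply Cderive_const]. apply Cderive_plus.
    + apply (Cderive_comp Cexp (fun z => Ci * z)%C); [apply Cderive_Cexp|exact A].
    + apply (Cderive_comp Cexp (fun z => - (Ci * z))%C); [apply Cderive_Cexp|exact B].
  - cbv beta. set (a := Cexp (Ci * z)). set (b := Cexp (- (Ci * z))).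
    pose proof C2_nz. pose proof Ci_nz.
    transitivity ((- (Ci * Ci)) * (- (a - b) * / (2 * Ci)))%C; [cfield; auto|rewrite Ci2; ring].
Qed.

Lemma Cderive_Csin (z : C) : Cderive Csin z (Ccos z).
Proof.
  unfold Ccos, Csin, Cdiv.
  assert (A : Cderive (fun z => Ci * z)%C z Ci) by (eapply Cderive_eq; [apply Cderive_scal, Cderive_id|ring]).
  assert (B : Cderive (fun z => - (Ci * z))%C z (- Ci)%C) by (apply Cderive_opp, A).
  eapply Cderive_eq.
  - apply Cderive_mult; [|apply Cderive_const]. apply Cderive_minus.
    + apply (Cderive_comp Cexp (fun z => Ci * z)%C); [apply Cderive_Cexp|exact A].
    + apply (Cderive_comp Cexp (fun z => - (Ci * z))%C); [apply Cderive_Cexp|exact B].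
  - cbv beta. pose proof C2_nz. pose proof Ci_nz. cfield. auto.
Qed.

Lemma Csin2_cos2 (z : C) : (Csin z * Csin z)%C = (1 - Ccos z * Ccos z)%C.
Proof.
  unfold Csin, Ccos. pose proof C2_nz. pose proof Ci_nz. rewrite Cexp_opp. pose proof (Cexp_nz (Ci * z)).
  set (a := Cexp (Ci * z)) in *.
  transitivity ((- (Ci * Ci)) * ((a - / a) * (a - / a) / (- (Ci * Ci * (2 * Ci) * (2 * Ci)))))%C.
  - field. auto.
  - replace (Ci * Ci * (2 * Ci) * (2 * Ci))%C with (Ci * Ci * (Ci * Ci) * 4)%C by ring. rewrite Ci2. field. auto.
Qed.

Lemma Ccos_R (x : R) : Ccos x = RtoC (cos x).
Proof.
  unfold Ccos, Cexp. rewrite re_opp, im_opp.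
  replace (Re (Ci * x)) with 0 by (simpl; ring). replace (Im (Ci * x)) with x by (simpl; ring).
  rewrite Ropp_0, exp_0, cos_neg, sin_neg. unfold RtoC, Cdiv, Cmult, Cplus, Cinv; simpl. f_equal; field.
Qed.

Lemma Csin_R (x : R) : Csin x = RtoC (sin x).
Proof.
  unfold Csin, Cexp. rewrite re_opp, im_opp.
  replace (Re (Ci * x)) with 0 by (simpl; ring). replace (Im (Ci * x)) with x by (simpl; ring).
  rewrite Ropp_0, exp_0, cos_neg, sin_neg. unfold RtoC, Ci, Cdiv, Cmult, Cplus, Cminus, Copp, Cinv; simpl. f_equal; field.
Qed.

Lemma Cderive_pow (f : C -> C) (n : nat) (z d : C) : Cderive f z d ->
  Cderive (fun w => f w ^ S n)%C z (INR (S n) * f z ^ n * d)%C.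
Proof.
  intros H. induction n as [|n IH].
  - apply Cderive_ext_loc with f 1; [lra|intros; simpl; ring|]. eapply Cderive_eq; [exact H|]. simpl. ring.
  - apply Cderive_ext_loc with (fun w => f w * f w ^ S n)%C 1; [lra|intros; reflexivity|].
    eapply Cderive_eq; [apply Cderive_mult; [exact H|exact IH]|].
    rewrite (S_INR (S n)), RtoC_plus. cbv beta. rewrite !Cpow_S. cring.
Qed.

Lemma CRInt_prim_R (A g : C -> C) (a b : R) : a <= b ->
  (forall z, Cderive A z (g z)) -> (forall z, holo g z) ->
  is_CRInt (fun x => g (RtoC x)) a b (A (RtoC b) - A (RtoC a))%C.
Proof.
  intros Hab HA Hg. exact (CRInt_horiz_prim A g a b 0 Hab (fun x _ => HA (x, 0)) (fun x _ => holo_cont _ _ (Hg (x, 0)))).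
Qed.

Lemma holo_Ccos (z : C) : holo Ccos z.
Proof. eexists; apply Cderive_Ccos. Qed.

Definition wallis (s : C) (n : nat) : C := CRInt (fun x => Ccos x ^ n * Ccos (2 * s * x))%C 0 (PI / 2).

Lemma holo_wallis (s : C) (n : nat) (z : C) : holo (fun z => Ccos z ^ n * Ccos (2 * s * z))%C z.
Proof.
  apply holo_mult; [apply holo_pow, holo_Ccos|].
  apply (holo_comp Ccos (fun z => 2 * s * z)%C); [apply holo_Ccos|]. apply holo_mult; [apply holo_const|apply holo_id].
Qed.

Lemma Rcont_RtoC (g : C -> C) (t : R) : holo g (RtoC t) -> Rcont (fun x => g (RtoC x)) t.
Proof. intros H. exact (Rcont_horiz g t 0 (holo_cont _ _ H)). Qed.

Lemma ex_wallis (s : C) (n : nat) : ex_CRInt (fun x => Ccos x ^ n * Ccos (2 * s * x))%C 0 (PI / 2).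
Proof.
  apply ex_CRInt_cont. intros t _. apply (Rcont_RtoC (fun z => Ccos z ^ n * Ccos (2 * s * z))%C), holo_wallis.
Qed.

(* Integration by parts: the boundary term is cos^n c' + n cos^(n-1) sin c with c(x) = cos (2 s x). *)
Lemma wallis_rec (s : C) (m : nat) :
  ((INR (S (S m)) * INR (S (S m)) - 4 * s * s) * wallis s (S (S m)))%C =
  (INR (S (S m)) * INR (S m) * wallis s m)%C.
Proof.
  pose proof PI_RGT_0 as Hpi.
  set (n := RtoC (INR (S (S m)))). set (n1 := RtoC (INR (S m))).
  assert (En : n = (n1 + 1)%C) by (unfold n, n1; rewrite S_INR, RtoC_plus; reflexivity).
  set (A := fun z => (Ccos z ^ S (S m) * (- (2 * s) * Csin (2 * s * z)) + n * (Ccos z ^ S m * (Csin z * Ccos (2 * s * z))))%C).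
  set (G := fun z => ((n * n - 4 * s * s) * (Ccos z ^ S (S m) * Ccos (2 * s * z))
              + - (n * n1) * (Ccos z ^ m * Ccos (2 * s * z)))%C).
  assert (L : forall z, Cderive (fun z => 2 * s * z)%C z (2 * s)%C).
  { intros z. eapply Cderive_eq; [apply Cderive_scal, Cderive_id|ring]. }
  assert (HA : forall z, Cderive A z (G z)).
  { intros z. unfold A. eapply Cderive_eq.
    - apply Cderive_plus.
      + apply Cderive_mult; [apply Cderive_pow, Cderive_Ccos|]. apply Cderive_scal.
        apply (Cderive_comp Csin (fun z => 2 * s * z)%C); [apply Cderive_Csin|apply L].
      + apply Cderive_scal. apply Cderive_mult; [apply Cderive_pow, Cderive_Ccos|].
        apply Cderive_mult; [apply Cderive_Csin|].
        apply (Cderive_comp Ccos (fun z => 2 * s * z)%C); [apply Cderive_Ccos|apply L].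
    - unfold G. cbv beta. fold n n1. rewrite !Cpow_S.
      set (u := Ccos z). set (v := Csin z). set (c := Ccos (2 * s * z)). set (d := Csin (2 * s * z)).
      set (w := (u ^ m)%C).
      assert (E : (v * v)%C = (1 - u * u)%C) by apply Csin2_cos2.
      transitivity (n * (u * w) * u * c - 4 * s * s * (u * (u * w) * c) - n * n1 * w * (v * v) * c)%C.
      + cring.
      + rewrite E, En. cring. }
  assert (HG : forall z, holo G z).
  { intros z. apply holo_plus; (apply holo_mult; [apply holo_const|apply holo_wallis]). }
  pose proof (CRInt_unique _ _ _ _ (CRInt_prim_R A G 0 (PI / 2) ltac:(lra) HA HG)) as I1.
  assert (I2 : is_CRInt (fun x => G (RtoC x)) 0 (PI / 2)
     ((n * n - 4 * s * s) * wallis s (S (S m)) + - (n * n1) * wallis s m)%C).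
  { apply (is_RInt_plus (V := C_R_NormedModule)
      (fun x => (n * n - 4 * s * s) * (Ccos (RtoC x) ^ S (S m) * Ccos (2 * s * RtoC x)))%C
      (fun x => - (n * n1) * (Ccos (RtoC x) ^ m * Ccos (2 * s * RtoC x)))%C);
      apply is_CRInt_scal, CRInt_correct, ex_wallis. }
  apply CRInt_unique in I2. rewrite I2 in I1.
  assert (Z0 : A (RtoC (PI / 2)) = RtoC 0).
  { unfold A. rewrite Ccos_R, cos_PI2, !Cpow_S. ring. }
  assert (Z1 : A (RtoC 0) = RtoC 0).
  { unfold A. rewrite Cmult_0_r, !Csin_R, sin_0. ring. }
  rewrite Z0, Z1 in I1.
  apply (proj2 (Ceq_minus _ _)). transitivity (0 - 0)%C; [rewrite <- I1; ring|ring].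
Qed.

Definition wallis_R (n : nat) : R := RInt (fun x => cos x ^ n) 0 (PI / 2).

Lemma ex_wallis_R (n : nat) : ex_RInt (V := R_NormedModule) (fun x => cos x ^ n) 0 (PI / 2).
Proof.
  apply (ex_RInt_continuous (V := R_CompleteNormedModule)). intros x _.
  apply (ex_derive_continuous (fun x => cos x ^ n)). auto_derive; auto.
Qed.

Lemma is_CRInt_R (f : R -> R) (a b l : R) : is_RInt (V := R_NormedModule) f a b l ->
  is_CRInt (fun x => RtoC (f x)) a b (RtoC l).
Proof.
  intros H. apply (is_RInt_fct_extend_pair (U := R_NormedModule) (V := R_NormedModule) (fun x => RtoC (f x))).
  - exact H.
  - pose proof (is_RInt_const (V := R_NormedModule) a b 0) as Z.
    replace (scal (b - a) (0 : R_NormedModule)) with 0 in Z by (unfold scal; simpl; unfold mult; simpl; ring). exact Z.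
Qed.

Lemma wallis_0 (n : nat) : wallis 0 n = RtoC (wallis_R n).
Proof.
  apply CRInt_unique. apply CRInt_is_ext with (fun x => RtoC (cos x ^ n)).
  - intros x. rewrite Ccos_R, RtoC_pow. rewrite Cmult_0_r, Cmult_0_l, Ccos_R, cos_0. ring.
  - apply is_CRInt_R. apply (RInt_correct (V := R_CompleteNormedModule)), ex_wallis_R.
Qed.

Lemma wallis_R_rec (m : nat) : INR (S (S m)) * wallis_R (S (S m)) = INR (S m) * wallis_R m.
Proof.
  pose proof (wallis_rec 0 m) as H. rewrite !wallis_0 in H.
  assert (N : INR (S (S m)) <> 0) by (apply not_0_INR; auto).
  apply Rmult_eq_reg_l with (INR (S (S m))); auto. apply RtoC_inj.
  rewrite !RtoC_mult. rewrite !Cmult_assoc. rewrite <- H. ring.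
Qed.

Lemma wallis_R_0 : wallis_R 0 = PI / 2.
Proof.
  unfold wallis_R. apply is_RInt_unique.
  pose proof (is_RInt_const (V := R_NormedModule) 0 (PI / 2) 1) as Z.
  replace (scal (PI / 2 - 0) (1 : R_NormedModule)) with (PI / 2) in Z by (unfold scal; simpl; unfold mult; simpl; ring).
  exact Z.
Qed.

Lemma wallis_R_pos (m : nat) : 0 < wallis_R (2 * m).
Proof.
  pose proof PI_RGT_0. induction m as [|m IH].
  - simpl. rewrite wallis_R_0. lra.
  - replace (2 * S m)%nat with (S (S (2 * m))) by lia.
    pose proof (wallis_R_rec (2 * m)) as R.
    assert (P1 : 0 < INR (S (S (2 * m)))) by (apply lt_0_INR; lia).
    assert (P2 : 0 < INR (S (2 * m))) by (apply lt_0_INR; lia).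
    apply Rmult_lt_reg_l with (INR (S (S (2 * m)))); auto. rewrite R, Rmult_0_r. apply Rmult_lt_0_compat; auto.
Qed.

(** Dividing the recurrence at [s] by the one at [0], with index [2 (m + 1)], gives exactly the
    factor [1 - s^2 / (m + 1)^2]. The identity is written without quotients, since
    [wallis s (2 * m)] may vanish. *)
Lemma sine_product_wallis (s : C) (m : nat) :
  (sine_product s m * wallis s (2 * m) * wallis_R 0)%C = (wallis s 0 * wallis_R (2 * m))%C.
Proof.
  induction m as [|m IH].
  - unfold sine_product. simpl. ring.
  - replace (2 * S m)%nat with (S (S (2 * m))) by lia.
    change (sine_product s (S m)) with (sine_product s m * (1 - s * s / (INR (S m) * INR (S m))))%C.
    pose proof (wallis_rec s (2 * m)) as R1.
    assert (Em : INR (S (S (2 * m))) = 2 * INR (S m)) by (rewrite !S_INR, mult_INR; simpl; ring).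
    assert (R2 : (INR (S (S (2 * m))) * wallis_R (S (S (2 * m))))%C = (INR (S (2 * m)) * wallis_R (2 * m))%C)
      by (rewrite <- !RtoC_mult, wallis_R_rec; reflexivity).
    rewrite Em in R1, R2.
    set (k := RtoC (INR (S m))) in *. set (w := wallis s (S (S (2 * m)))) in *.
    set (w' := RtoC (wallis_R (S (S (2 * m))))) in *. set (p := RtoC (INR (S (2 * m)))) in *.
    assert (Nk : k <> RtoC 0) by (apply RtoC_nz, not_0_INR; auto).
    assert (N2 := C2_nz).
    assert (Np : p <> RtoC 0) by (apply RtoC_nz, not_0_INR; auto).
    rewrite RtoC_mult in R1, R2. fold k in R1, R2.
    assert (Q1 : ((1 - s * s / (k * k)) * w)%C = (p * wallis s (2 * m) / (2 * k))%C).
    { transitivity ((2 * k * (2 * k) - 4 * s * s) * w / (4 * k * k))%C; [field; auto|].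
      rewrite R1. field. auto. }
    assert (Q2 : w' = (p * wallis_R (2 * m) / (2 * k))%C).
    { rewrite <- R2. field. auto. }
    transitivity (sine_product s m * ((1 - s * s / (k * k)) * w) * wallis_R 0)%C; [ring|].
    rewrite Q1, Q2.
    transitivity ((sine_product s m * wallis s (2 * m) * wallis_R 0) * (p / (2 * k)))%C; [field; auto|].
    rewrite IH. field. auto.
Qed.

Lemma wallis_s_0 (s : C) : (2 * s * wallis s 0)%C = Csin (PI * s).
Proof.
  pose proof PI_RGT_0.
  assert (HA : forall z, Cderive (fun z => Csin (2 * s * z)) z (2 * s * (Ccos z ^ 0 * Ccos (2 * s * z)))%C).
  { intros z. eapply Cderive_eq.
    - apply (Cderive_comp Csin (fun z => 2 * s * z)%C); [apply Cderive_Csin|apply Cderive_scal, Cderive_id].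
    - simpl. cring. }
  pose proof (CRInt_prim_R _ _ 0 (PI / 2) ltac:(lra) HA
     (fun z => holo_mult _ _ z (holo_const (2 * s)%C z) (holo_wallis s 0 z))) as I.
  pose proof (is_CRInt_scal _ (2 * s)%C 0 (PI / 2) _ (CRInt_correct _ _ _ (ex_wallis s 0))) as I'.
  apply CRInt_unique in I, I'. unfold wallis. etransitivity; [symmetry; exact I'|].
  etransitivity; [exact I|]. cbv beta.
  rewrite Cmult_0_r, Csin_R, sin_0. replace (2 * s * RtoC (PI / 2))%C with (PI * s)%C.
  - ring.
  - rewrite RtoC_div by lra. field.
Qed.

(** From [|cos (2 s x) - 1| <= D sin x ^ 2], the difference to the case [s = 0] is at most [D] times
    the difference of the integrals of orders [n] and [n + 2]. By the recurrence that difference is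
    the [(n + 2)]-th part of the integral of order [n]. *)
Lemma wallis_ratio (s : C) : Clim (fun m => wallis s (2 * m) * / wallis_R (2 * m))%C (RtoC 1).
Proof.
  pose proof PI_RGT_0 as Hpi. pose proof PI_4 as Hpi4. pose proof (Cmod_ge_0 s) as Ps.
  destruct (Cexp_quadratic (4 * Cmod s + 1) ltac:(lra)) as [K [HK Hq]].
  (* [36 = 4 * 9]: the argument has squared modulus [4 |s|^2 x^2], and [x^2 <= 9 sin x ^ 2]. *)
  set (D := 36 * (K * Cmod s ^ 2)).
  assert (HD : 0 <= D) by (repeat apply Rmult_le_pos; auto; try lra).
  assert (Hc : forall x, 0 <= x <= PI / 2 -> Cmod (Ccos (2 * s * x) - 1) <= D * sin x ^ 2).
  { intros x Hx. set (w := (Ci * (2 * s * x))%C).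
    assert (Mw : Cmod w = 2 * Cmod s * x).
    { unfold w. rewrite !Cmod_mult, Cmod_Ci, !Cmod_R, !Rabs_pos_eq by lra. ring. }
    assert (Hw : Cmod w <= 4 * Cmod s + 1) by (rewrite Mw; nra).
    pose proof (Hq w Hw) as Q1. pose proof (Hq (- w)%C ltac:(rewrite Cmod_opp; auto)) as Q2. rewrite Cmod_opp in Q2.
    unfold Ccos. fold w.
    replace ((Cexp w + Cexp (- w)) / 2 - 1)%C with (((Cexp w - 1 - w) + (Cexp (- w) - 1 - - w)) / 2)%C
      by (field; apply C2_nz).
    rewrite Cmod_div by apply C2_nz. rewrite Cmod_R, (Rabs_pos_eq 2) by lra.
    pose proof (Cmod_triangle (Cexp w - 1 - w) (Cexp (- w) - 1 - - w)).
    apply Rle_trans with (K * Cmod w ^ 2); [lra|]. rewrite Mw.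
    pose proof (sin_ge_third x Hx).
    assert (x ^ 2 <= 9 * sin x ^ 2) by (simpl; nra).
    unfold D. replace (K * (2 * Cmod s * x) ^ 2) with (4 * (K * Cmod s ^ 2) * x ^ 2) by ring.
    assert (0 <= K * Cmod s ^ 2) by (apply Rmult_le_pos; [auto|apply pow2_ge_0]). nra. }
  assert (Hb : forall n, Cmod (wallis s n - wallis_R n) <= D * (wallis_R n - wallis_R (S (S n)))).
  { intros n.
    assert (I1 : is_CRInt (fun x => Ccos x ^ n * Ccos (2 * s * x) + - (1) * RtoC (cos x ^ n))%C 0 (PI / 2)
      (wallis s n + - (1) * RtoC (wallis_R n))%C).
    { apply (is_RInt_plus (V := C_R_NormedModule) (fun x => Ccos (RtoC x) ^ n * Ccos (2 * s * RtoC x))%C (fun x => - (1) * RtoC (cos x ^ n))%C).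
      - apply CRInt_correct, ex_wallis.
      - apply is_CRInt_scal, is_CRInt_R. apply (RInt_correct (V := R_CompleteNormedModule)), ex_wallis_R. }
    assert (I2 : is_RInt (V := R_NormedModule) (fun x => D * (cos x ^ n - cos x ^ S (S n))) 0 (PI / 2)
       (D * (wallis_R n - wallis_R (S (S n))))).
    { apply (is_RInt_scal (V := R_NormedModule) (fun x => cos x ^ n - cos x ^ S (S n))).
      apply (is_RInt_minus (V := R_NormedModule) (fun x => cos x ^ n) (fun x => cos x ^ S (S n)));
        apply (RInt_correct (V := R_CompleteNormedModule)), ex_wallis_R. }
    replace (wallis s n - wallis_R n)%C with (wallis s n + - (1) * RtoC (wallis_R n))%C by ring.
    rewrite Cmod_norm.
    apply (norm_RInt_le (V := C_R_NormedModule) _ _ 0 (PI / 2) _ _ ltac:(lra)) with (2 := I1) (3 := I2).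
    intros x Hx. rewrite <- Cmod_norm. rewrite Ccos_R, <- RtoC_pow.
    assert (E : (RtoC (cos x ^ n) * Ccos (2 * s * x) + - (1) * RtoC (cos x ^ n))%C = (RtoC (cos x ^ n) * (Ccos (2 * s * x) - 1))%C) by ring.
    rewrite E, Cmod_mult, Cmod_R.
    assert (Pc : 0 <= cos x ^ n) by (apply pow_le, cos_ge_0; lra).
    rewrite Rabs_pos_eq by auto.
    replace (D * (cos x ^ n - cos x ^ S (S n))) with (cos x ^ n * (D * sin x ^ 2)).
    - apply Rmult_le_compat_l; auto.
    - simpl. pose proof (sin2_cos2 x) as SC. unfold Rsqr in SC.
      replace (sin x * (sin x * 1)) with (1 - cos x * cos x) by lra. ring. }
  intros eps He. destruct (INR_unbounded (D / eps)) as [N HN]. exists (S N). intros m Hm.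
  pose proof (wallis_R_pos m) as PW.
  assert (NW : RtoC (wallis_R (2 * m)) <> RtoC 0) by (apply RtoC_nz; lra).
  replace (wallis s (2 * m) * / wallis_R (2 * m) - 1)%C with ((wallis s (2 * m) - wallis_R (2 * m)) / wallis_R (2 * m))%C by (field; auto).
  rewrite Cmod_div, Cmod_R, (Rabs_pos_eq (wallis_R (2 * m))) by (auto; lra).
  apply Rmult_lt_reg_r with (wallis_R (2 * m)); auto.
  unfold Rdiv. rewrite Rmult_assoc, Rinv_l, Rmult_1_r by lra.
  eapply Rle_lt_trans; [apply Hb|].
  pose proof (wallis_R_rec (2 * m)) as R.
  assert (P1 : 0 < INR (S (S (2 * m)))) by (apply lt_0_INR; lia).
  apply Rmult_lt_reg_l with (INR (S (S (2 * m)))); auto.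
  replace (INR (S (S (2 * m))) * (D * (wallis_R (2 * m) - wallis_R (S (S (2 * m)))))) with
    (D * (INR (S (S (2 * m))) * wallis_R (2 * m) - INR (S (S (2 * m))) * wallis_R (S (S (2 * m))))) by ring.
  rewrite R, (S_INR (S (2 * m))).
  replace (D * ((INR (S (2 * m)) + 1) * wallis_R (2 * m) - INR (S (2 * m)) * wallis_R (2 * m))) with (D * wallis_R (2 * m)) by ring.
  rewrite <- Rmult_assoc. apply Rmult_lt_compat_r; auto. rewrite <- S_INR.
  assert (INR N <= INR (S (S (2 * m)))) by (apply le_INR; lia).
  replace D with (D / eps * eps) by (field; lra). apply Rmult_lt_compat_r; lra.
Qed.

(** At each finite index, [gauss_product] and [sine_product_wallis] combine to an exact equation
    between the Gauss products times [sin (PI s)] and [PI] times the Wallis ratio; then both sides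
    pass to the limit. *)
Lemma gamma_reflection (s : C) : ~ C_integer s ->
  (CGamma s * CGamma (1 - s) * Csin (PI * s))%C = RtoC PI.
Proof.
  intros Hs. pose proof PI_RGT_0 as Hpi.
  assert (H1 : forall j : nat, (s + INR j)%C <> RtoC 0).
  { intros j E. apply Hs. exists (- Z.of_nat j)%Z. rewrite opp_IZR, <- INR_IZR_INZ, RtoC_opp.
    replace s with (s + INR j - INR j)%C by ring. rewrite E. ring. }
  assert (H2 : forall j : nat, (1 - s + INR j)%C <> RtoC 0).
  { intros j E. apply Hs. exists (1 + Z.of_nat j)%Z. rewrite plus_IZR, <- INR_IZR_INZ, RtoC_plus.
    replace s with (1 + INR j - (1 - s + INR j))%C by ring. rewrite E. ring. }
  assert (L1 := Clim_incr _ _ (gauss_converges s H1)).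
  assert (L2 := Clim_incr _ _ (gauss_converges (1 - s) H2)).
  assert (L3 := Clim_incr _ _ (wallis_ratio s)).
  assert (L4 : Clim (fun n => (1 - s + INR (S n)) / INR (S n))%C (RtoC 1)).
  { intros eps He. pose proof (Cmod_ge_0 (1 - s)) as P. destruct (INR_unbounded (Cmod (1 - s) / eps)) as [N HN]. exists N.
    intros n Hn. apply le_INR in Hn.
    assert (Pn : 0 < INR (S n)) by (apply lt_0_INR; lia).
    assert (Nn : RtoC (INR (S n)) <> RtoC 0) by (apply RtoC_nz; lra).
    replace ((1 - s + INR (S n)) / INR (S n) - 1)%C with ((1 - s) / INR (S n))%C by (field; auto).
    rewrite Cmod_div, (Cmod_R (INR (S n))), Rabs_pos_eq by (auto; lra).
    apply Rmult_lt_reg_r with (INR (S n)); auto. unfold Rdiv. rewrite Rmult_assoc, Rinv_l, Rmult_1_r by lra.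
    replace (Cmod (1 - s)) with (eps * (Cmod (1 - s) / eps)) by (field; lra). apply Rmult_lt_compat_l; auto.
    rewrite S_INR. lra. }
  assert (L5 := Clim_mult _ _ _ _ (Clim_mult _ _ _ _ L1 L2) (Clim_scal (Csin (PI * s)) _ _ L4)).
  assert (L6 := Clim_scal PI _ _ L3).
  rewrite Cmult_1_r in L5, L6.
  eapply Clim_unique; [exact L5|].
  apply Clim_ext with (2 := L6). intros n.
  pose proof (gauss_product s (S n) ltac:(lia) H1 H2) as E.
  pose proof (sine_product_wallis s (S n)) as W. rewrite wallis_R_0 in W.
  pose proof (wallis_R_pos (S n)) as PW.
  assert (NW : RtoC (wallis_R (2 * S n)) <> RtoC 0) by (apply RtoC_nz; lra).
  rewrite <- (wallis_s_0 s).
  set (g1 := gauss s (S n)) in *. set (g2 := gauss (1 - s) (S n)) in *.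
  set (sp := sine_product s (S n)) in *. set (w := wallis s (2 * S n)) in *. set (w0 := wallis s 0) in *.
  set (v := RtoC (wallis_R (2 * S n))) in *. set (r := ((1 - s + INR (S n)) / INR (S n))%C) in *.
  assert (W0 : w0 = (sp * w * RtoC (PI / 2) * / v)%C).
  { rewrite W. field. exact NW. }
  rewrite W0, RtoC_div by lra.
  transitivity ((g1 * g2 * (s * sp) * r) * (PI * (w * / v)))%C.
  - rewrite E. ring.
  - field. auto.
Qed.

(** * Analytic continuation *)

Lemma filterlim_C_punctured (g : C -> C) (z l : C) :
  filterlim g (locally' (T := C_UniformSpace) z) (locally (T := C_UniformSpace) l) <->
  forall eps, 0 < eps -> exists d, 0 < d /\ forall w, Cmod (w - z) < d -> w <> z -> Cmod (g w - l) < eps.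
Proof.
  split.
  - intros H eps He.
    assert (HP : locally (T := C_UniformSpace) l (fun w => Cmod (w - l) < eps)).
    { apply locally_CU_eps. exists eps; auto. }
    specialize (H _ HP). unfold filtermap, locally', within in H. apply locally_CU_eps in H.
    destruct H as [d [Hd H]]. exists d. split; auto.
  - intros H P HP. apply locally_CU_eps in HP. destruct HP as [e [He HP]].
    destruct (H e He) as [d [Hd H1]]. unfold filtermap, locally', within.
    apply locally_CU_eps. exists d. split; auto.
Qed.

(** With one factor [s] the residue limit yields only continuity at [0]. The second factor turns
    that limit into a derivative, equal to [- p_f(0)], so no removable-singularity theorem
    enters. *)
Definition LC_regularized (L : C -> C) (s : C) : C := if Ceq_dec s 0 then RtoC 0 else (s * s * L (1 - s))%C.

Lemma holo_one_minus (s : C) : holo (fun s => 1 - s)%C s.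
Proof. apply holo_minus; [apply holo_const|apply holo_id]. Qed.

Lemma holo_LC_regularized (f : R -> C) (L : C -> C) (s : C) : is_LC_function f L -> holo (LC_regularized L) s.
Proof.
  intros (_ & H1 & _ & H3). destruct (Ceq_dec s 0) as [->|Hs].
  - exists (- modulator_ext f 0)%C. apply Cderive_eps. intros eps He.
    destruct (proj1 (filterlim_C_punctured _ _ _) H3 eps He) as [d [Hd H]].
    exists d. split; auto. intros w Hw. unfold LC_regularized.
    destruct (Ceq_dec 0 0) as [_|N]; [|congruence].
    replace (w - 0)%C with w in * by ring.
    destruct (Ceq_dec w 0) as [->|Nw].
    + replace (0 - 0 - - modulator_ext f 0 * 0)%C with (RtoC 0) by ring. rewrite Cmod_0. lra.
    + specialize (H (1 - w)%C). replace (1 - w - 1)%C with (- w)%C in H by ring. rewrite Cmod_opp in H.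
      specialize (H Hw). assert (Nw1 : (1 - w)%C <> RtoC 1).
      { intros E. apply Nw. replace w with (1 - (1 - w))%C by ring. rewrite E. ring. }
      specialize (H Nw1).
      replace (w * w * L (1 - w) - 0 - - modulator_ext f 0 * w)%C with
        (- (- w * L (1 - w) - modulator_ext f 0) * w)%C by ring.
      rewrite Cmod_mult, Cmod_opp. apply Rmult_le_compat_r; [apply Cmod_ge_0|lra].
  - apply holo_ext_loc with (fun s => s * s * L (1 - s))%C (Cmod s).
    + apply Cmod_gt_0; auto.
    + intros w Hw. unfold LC_regularized. destruct (Ceq_dec w 0) as [->|]; [|reflexivity].
      rewrite Cmod_minus_sym in Hw. replace (s - 0)%C with s in Hw by ring. lra.
    + apply holo_mult; [apply holo_mult; apply holo_id|].
      apply (holo_comp L (fun s => 1 - s)%C); [apply H1|apply holo_one_minus].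
      intros E. apply Hs. replace s with (1 - (1 - s))%C by ring. rewrite E. ring.
Qed.

Lemma holo_trig_factor (par s : C) : holo (trig_factor par) s.
Proof.
  assert (Hr : forall e, holo (rot e) s).
  { intros e. unfold rot. apply holo_Cexp, holo_mult; [apply holo_id|apply holo_const]. }
  apply holo_minus; [apply Hr|]. apply holo_mult; [apply holo_const|apply Hr].
Qed.

(** Multiplied by [s^2], the difference of the sides is entire and vanishes where
    [functional_equation_left] applies; away from [0] the factor is divided out again. *)
Lemma functional_equation (f : R -> C) (L : C -> C) (c th : R) (par s : C) :
  real_analytic0 f -> Rbar_lt 0 (rho f) -> is_LC_function f L ->
  hankel_contour (dilate (2 * Ci * PI)%C f) c th ->
  par = RtoC 1 \/ par = (- (1))%C ->
  (forall j, ((- (1)) ^ j * P_coef f j)%C = (par * P_coef f j)%C) ->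
  s <> RtoC 0 ->
  (Cpower (2 * PI)%R s * trig_factor par s * L (1 - s))%C = FC_int (dilate (2 * Ci * PI)%C f) c th s.
Proof.
  intros Hf Hrho HL Hmu Hp Hpar Hs.
  destruct (regular_contour_dilate f c th Hf Hrho Hmu) as [_ [q Hreg]].
  set (F := FC_int (dilate (2 * Ci * PI)%C f) c th).
  set (E := fun s => (Cpower (2 * PI)%R s * trig_factor par s * LC_regularized L s - s * s * F s)%C).
  assert (Z : E s = RtoC 0).
  (* The disc of radius [1 / 2] about [-1 + i] lies in [Re s < 0], [Im s > 0]. *)
  { apply (entire_zero E (-1, 1) (/ 2)); [lra| |].
    - intros z. apply holo_minus.
      + apply holo_mult; [|apply holo_LC_regularized with f; auto].
        apply holo_mult; [apply holo_Cpower_exp, holo_id|apply holo_trig_factor].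
      + apply holo_mult; [apply holo_mult; apply holo_id|]. apply (FC_int_holo _ q c _ th z Hreg).
    - intros z Hz.
      pose proof (re_le_Cmod (z - (-1, 1))) as Br. pose proof (im_le_Cmod (z - (-1, 1))) as Bi.
      change (Rabs (Re z - -1) <= Cmod (z - (-1, 1))) in Br. change (Rabs (Im z - 1) <= Cmod (z - (-1, 1))) in Bi.
      apply Rabs_le_between in Br. apply Rabs_le_between in Bi.
      unfold E, LC_regularized. destruct (Ceq_dec z 0) as [->|_].
      { rewrite re_RtoC in Br. lra. }
      unfold F. rewrite <- (functional_equation_left f L c th par z) by (auto; lra). ring. }
  unfold E, LC_regularized in Z. destruct (Ceq_dec s 0) as [|_]; [contradiction|].
  apply (proj2 (Ceq_minus _ _)). fold F.
  replace (Cpower (2 * PI)%R s * trig_factor par s * L (1 - s) - F s)%C with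
    ((Cpower (2 * PI)%R s * trig_factor par s * (s * s * L (1 - s)) - s * s * F s) / (s * s))%C by (field; auto).
  rewrite Z. field. auto.
Qed.

Lemma rot_half (s : C) : rot 1 s = Cexp (Ci * (PI * s / 2)).
Proof. unfold rot. rewrite Rmult_1_l, RtoC_div by lra. f_equal. unfold Cdiv. ring. Qed.

Lemma trig_factor_even (s : C) : trig_factor 1 s = (2 * Ci * Csin (PI * s / 2))%C.
Proof.
  unfold trig_factor, Csin. rewrite rot_opp, rot_half, Cexp_opp.
  pose proof C2_nz. pose proof Ci_nz. pose proof (Cexp_nz (Ci * (PI * s / 2))).
  set (a := Cexp (Ci * (PI * s / 2))) in *. field. auto.
Qed.

Lemma trig_factor_odd (s : C) : trig_factor (- (1)) s = (2 * Ccos (PI * s / 2))%C.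
Proof.
  unfold trig_factor, Ccos. rewrite rot_opp, rot_half, Cexp_opp.
  pose proof C2_nz. pose proof (Cexp_nz (Ci * (PI * s / 2))).
  set (a := Cexp (Ci * (PI * s / 2))) in *. field. auto.
Qed.

Lemma Csin_double (z : C) : Csin (2 * z) = (2 * Csin z * Ccos z)%C.
Proof.
  unfold Csin, Ccos. replace (Ci * (2 * z))%C with (Ci * z + Ci * z)%C by ring.
  rewrite !Cexp_opp, Cexp_plus. pose proof C2_nz. pose proof Ci_nz. pose proof (Cexp_nz (Ci * z)).
  set (a := Cexp (Ci * z)) in *. field. auto.
Qed.

Lemma Csin_zero_integer (s : C) : Csin (PI * s) = RtoC 0 -> C_integer s.
Proof.
  intros H. pose proof PI_RGT_0. pose proof C2_nz as N2. pose proof Ci_nz as Ni.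
  assert (E : Cexp (2 * (Ci * (PI * s))) = RtoC 1).
  { unfold Csin in H. rewrite Cexp_opp in H. pose proof (Cexp_nz (Ci * (PI * s))) as Na.
    replace (2 * (Ci * (PI * s)))%C with (Ci * (PI * s) + Ci * (PI * s))%C by ring. rewrite Cexp_plus.
    set (a := Cexp (Ci * (PI * s))) in *.
    transitivity (1 + (a - / a) / (2 * Ci) * (2 * Ci * a))%C; [field; auto|rewrite H; ring]. }
  apply Cexp_eq_1 in E. destruct E as [k Hk]. exists k.
  assert (NP : RtoC PI <> RtoC 0) by (apply RtoC_nz; lra).
  transitivity (2 * (Ci * (PI * s)) / (2 * Ci * PI))%C; [field; auto|].
  rewrite Hk, C_re_im, !RtoC_mult. field. auto.
Qed.

Lemma half_trig_nz (s : C) : ~ C_integer s ->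
  Csin (PI * s / 2) <> RtoC 0 /\ Ccos (PI * s / 2) <> RtoC 0.
Proof.
  intros Hs.
  assert (E : Csin (PI * s) = (2 * Csin (PI * s / 2) * Ccos (PI * s / 2))%C).
  { rewrite <- Csin_double. f_equal. field. }
  split; intros Z; apply Hs, Csin_zero_integer; rewrite E, Z; ring.
Qed.

Lemma integers_isolated (s w : C) : C_integer s -> Cmod (w - s) < 1 -> w <> s -> ~ C_integer w.
Proof.
  intros [j ->] Hw Hn [k ->]. apply Hn. f_equal. f_equal.
  rewrite <- RtoC_minus, <- minus_IZR, Cmod_R, <- abs_IZR in Hw. apply lt_IZR in Hw. lia.
Qed.

(** Integers are isolated, so near a singular point the formula agrees with the continuous function
    [v] and has its value as limit. It covers both singular sets: all integers for the Gamma form,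
    the zeros of one trigonometric factor for the integral form. *)
Lemma continued_value_intro (sing : C -> Prop) (g v : C -> C) (s : C) :
  (forall w, ~ C_integer w -> v w = g w) -> (sing s -> C_integer s) -> Ccont v s ->
  (~ sing s -> v s = g s) -> continued_value sing g s (v s).
Proof.
  intros Hg Hi Hv Hs. split; [exact Hs|]. intros H. apply filterlim_C_punctured. intros eps He.
  destruct (Hv eps He) as [d [Hd Hc]].
  destruct (pos_min2 d 1 Hd Rlt_0_1) as (t & Ht & T1 & T2). exists t. split; [exact Ht|].
  intros w Hw Hn. rewrite <- Hg; [apply Hc; lra|]. apply (integers_isolated s); auto. lra.
Qed.

Lemma not_integer_nz (s : C) : ~ C_integer s -> s <> RtoC 0.
Proof. intros H E. apply H. exists 0%Z. exact E. Qed.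

Lemma Ccont_eq_at (g h : C -> C) (z : C) : Ccont g z -> Ccont h z ->
  (forall w, w <> z -> g w = h w) -> g z = h z.
Proof.
  intros Hg Hh H. apply (proj2 (Ceq_minus _ _)). apply Cmod_le_0. apply Rle_plus_epsilon. intros eps He.
  destruct (Hg (eps / 2) ltac:(lra)) as [d1 [Hd1 H1]]. destruct (Hh (eps / 2) ltac:(lra)) as [d2 [Hd2 H2]].
  destruct (pos_min2 (d1 / 2) (d2 / 2) ltac:(lra) ltac:(lra)) as (t & Ht & T1 & T2).
  assert (Ew : ((z + t) - z)%C = RtoC t) by ring.
  assert (Mw : Cmod ((z + t) - z) = t) by (rewrite Ew, Cmod_R; apply Rabs_pos_eq; lra).
  specialize (H1 (z + t)%C ltac:(lra)). specialize (H2 (z + t)%C ltac:(lra)).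
  rewrite H in H1.
  2:{ intros E. rewrite E in Mw. replace (z - z)%C with (RtoC 0) in Mw by ring. rewrite Cmod_0 in Mw. lra. }
  replace (g z - h z)%C with ((h (z + t) - h z) - (h (z + t) - g z))%C by ring.
  eapply Rle_trans; [apply Cmod_triangle_minus|]. lra.
Qed.

Theorem theorem3p1 (f : R -> C) (L : C -> C) (c th : R)
  (hf : real_analytic0 f)
  (hrho : Rbar_lt (Finite 0) (rho f))
  (hL : is_LC_function f L)
  (hmu : hankel_contour (dilate (2 * Ci * PI)%C f) c th) :
  (modulator_even f ->
   forall s : C, s <> RtoC 0 ->
     continued_value C_integer
       (fun s => 2 * Cpower (2 * PI)%R (- s) * CGamma s * Ccos (PI * s / 2)
                 * FC (dilate (2 * Ci * PI) f) c th s)%C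
       s (L (1 - s)%C) /\
     continued_value (fun s => Csin (PI * s / 2)%C = RtoC 0)
       (fun s => Cpower (2 * PI)%R (- s) / (2 * Ci * Csin (PI * s / 2))
                 * FC_int (dilate (2 * Ci * PI) f) c th s)%C
       s (L (1 - s)%C)) /\
  (modulator_odd f ->
   forall s : C,
     continued_value C_integer
       (fun s => 2 * Ci * Cpower (2 * PI)%R (- s) * CGamma s * Csin (PI * s / 2)
                 * FC (dilate (2 * Ci * PI) f) c th s)%C
       s (L (1 - s)%C) /\
     continued_value (fun s => Ccos (PI * s / 2)%C = RtoC 0)
       (fun s => Cpower (2 * PI)%R (- s) / (2 * Ccos (PI * s / 2))
                 * FC_int (dilate (2 * Ci * PI) f) c th s)%C
       s (L (1 - s)%C)).
Proof.
  pose proof PI_RGT_0 as Hpi. pose proof C2_nz as N2. pose proof Ci_nz as Ni.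
  assert (NP : RtoC PI <> RtoC 0) by (apply RtoC_nz; lra).
  (* The reflection formula with the sine doubled: it removes both Gamma factors of the first form
     and leaves the other half-angle function in the denominator, which is the second form. *)
  assert (Gam : forall s, ~ C_integer s ->
    (CGamma s * CGamma (1 - s) * (2 * Csin (PI * s / 2) * Ccos (PI * s / 2)) / PI)%C = RtoC 1).
  { intros s Hs. rewrite <- Csin_double. replace (2 * (PI * s / 2))%C with (PI * s)%C by (field; auto).
    rewrite gamma_reflection by auto. field. auto. }
  assert (Int : forall s, Csin (PI * s / 2) = RtoC 0 \/ Ccos (PI * s / 2) = RtoC 0 -> C_integer s).
  { intros s H. apply NNPP. intros Hs. destruct (half_trig_nz s Hs). tauto. }
  split.
  - intros He s Hs.
    assert (Hpar : forall j, ((- (1)) ^ j * P_coef f j)%C = (1 * P_coef f j)%C).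
    { apply modulator_parity; auto. intros z. rewrite (He z). ring. }
    assert (FE : forall w, w <> RtoC 0 ->
      (Cpower (2 * PI)%R w * (2 * Ci * Csin (PI * w / 2)) * L (1 - w))%C = FC_int (dilate (2 * Ci * PI)%C f) c th w).
    { intros w Hw. rewrite <- trig_factor_even. apply functional_equation; auto. }
    assert (HLs : Ccont (fun s => L (1 - s)%C) s).
    { apply holo_cont, (holo_comp L (fun s => 1 - s)%C); [apply hL|apply holo_one_minus].
      intros E. apply Hs. replace s with (1 - (1 - s))%C by ring. rewrite E. ring. }
    assert (G2 : forall w, w <> RtoC 0 -> Csin (PI * w / 2) <> RtoC 0 -> L (1 - w)%C =
       (Cpower (2 * PI)%R (- w) / (2 * Ci * Csin (PI * w / 2)) * FC_int (dilate (2 * Ci * PI) f) c th w)%C).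
    { intros w Hw Hsw. rewrite <- FE, Cpower_opp by auto. field. repeat split; auto using Cpower_nz. }
    assert (G1 : forall w, ~ C_integer w -> L (1 - w)%C =
       (2 * Cpower (2 * PI)%R (- w) * CGamma w * Ccos (PI * w / 2) * FC (dilate (2 * Ci * PI) f) c th w)%C).
    { intros w Hw. unfold FC. rewrite <- FE, Cpower_opp by (apply not_integer_nz; auto).
      transitivity ((CGamma w * CGamma (1 - w) * (2 * Csin (PI * w / 2) * Ccos (PI * w / 2)) / PI) * L (1 - w))%C;
        [rewrite Gam by auto; ring|]. field. repeat split; auto using Cpower_nz. }
    (* [s = 0] is excluded, so [L (1 - s)] is continuous at [s] and serves as the common extension
       of both formulas. *)
    split; apply (continued_value_intro _ _ (fun s => L (1 - s)%C)); auto.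
    intros w Hw. apply G2; [apply not_integer_nz; auto|apply half_trig_nz; auto].
  - intros Ho s.
    assert (Hpar : forall j, ((- (1)) ^ j * P_coef f j)%C = (- (1) * P_coef f j)%C).
    { apply modulator_parity; auto. intros z. rewrite (Ho z). ring. }
    (* An odd modulator vanishes at [0], so [L] is differentiable at [1]; this is why the odd case
       includes [s = 0]. *)
    assert (HL1 : ex_derive L (RtoC 1)).
    { apply hL. specialize (Ho 0). replace (- 0)%C with (RtoC 0) in Ho by ring.
      apply (proj1 (Ceq_minus _ _)) in Ho. set (m := modulator_ext f 0) in *.
      replace m with (/ 2 * (m - - m))%C by (field; auto). rewrite Ho. ring. }
    assert (HLs : forall s, Ccont (fun s => L (1 - s)%C) s).
    { intros w. apply holo_cont, (holo_comp L (fun s => 1 - s)%C); [|apply holo_one_minus].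
      destruct (Ceq_dec (1 - w) 1) as [->|N]; [exact HL1|apply hL; exact N]. }
    (* [functional_equation] leaves out [w = 0]; both sides are continuous there, so the equation
       extends. *)
    assert (FE : forall w,
      (Cpower (2 * PI)%R w * (2 * Ccos (PI * w / 2)) * L (1 - w))%C = FC_int (dilate (2 * Ci * PI)%C f) c th w).
    { assert (FE0 : forall w, w <> RtoC 0 ->
        (Cpower (2 * PI)%R w * trig_factor (- (1)) w * L (1 - w))%C = FC_int (dilate (2 * Ci * PI)%C f) c th w)
        by (intros w Hw; apply functional_equation; auto).
      intros w. rewrite <- trig_factor_odd. destruct (Ceq_dec w 0) as [->|Hw]; [|auto].
      destruct (regular_contour_dilate f c th hf hrho hmu) as [_ [q Hreg]].
      apply (Ccont_eq_at (fun w => Cpower (2 * PI)%R w * trig_factor (- (1)) w * L (1 - w))%C); auto.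
      - apply holo_cont, holo_mult.
        + apply holo_mult; [apply holo_Cpower_exp, holo_id|apply holo_trig_factor].
        + apply (holo_comp L (fun s => 1 - s)%C); [|apply holo_one_minus].
          replace (1 - 0)%C with (RtoC 1) by ring. exact HL1.
      - apply holo_cont, (FC_int_holo _ q c _ th _ Hreg). }
    assert (G2 : forall w, Ccos (PI * w / 2) <> RtoC 0 -> L (1 - w)%C =
       (Cpower (2 * PI)%R (- w) / (2 * Ccos (PI * w / 2)) * FC_int (dilate (2 * Ci * PI) f) c th w)%C).
    { intros w Hsw. rewrite <- FE, Cpower_opp. field. repeat split; auto using Cpower_nz. }
    assert (G1 : forall w, ~ C_integer w -> L (1 - w)%C =
       (2 * Ci * Cpower (2 * PI)%R (- w) * CGamma w * Csin (PI * w / 2) * FC (dilate (2 * Ci * PI) f) c th w)%C).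
    { intros w Hw. unfold FC. rewrite <- FE, Cpower_opp.
      transitivity ((CGamma w * CGamma (1 - w) * (2 * Csin (PI * w / 2) * Ccos (PI * w / 2)) / PI) * L (1 - w))%C;
        [rewrite Gam by auto; ring|]. field. repeat split; auto using Cpower_nz. }
    split; apply (continued_value_intro _ _ (fun s => L (1 - s)%C)); auto.
    intros w Hw. apply G2. apply half_trig_nz; auto.
Qed.
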